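(* Let $n,m,p$ be positive integers with $p\le m\le n-p$. Let $\mathbf{G}\in\mathbb{C}^{n\times p}$ be a deterministic matrix of full column rank $p$ whose columns are $\mathbf{g}_i=\partial\mathbf{x}(\boldsymbol{\theta})/\partial\theta_i$, let $\sigma^2>0$, and let $\mathbf{\Phi}\in\mathbb{C}^{m\times n}$ be a random matrix having a density with respect to Lebesgue measure on $\mathbb{C}^{m\times n}$ of the form $g(\mathbf{\Phi}\mathbf{\Phi}^H)$ for some function $g$. Let $\mathbf{J}=\frac{1}{\sigma^2}\mathbf{G}^H\mathbf{G}$ and $\hat{\mathbf{J}}=\frac{1}{\sigma^2}\mathbf{G}^H\mathbf{P}_{\mathbf{\Phi}^H}\mathbf{G}$, where $\mathbf{P}_{\mathbf{\Phi}^H}=\mathbf{\Phi}^H(\mathbf{\Phi}\mathbf{\Phi}^H)^{-1}\mathbf{\Phi}$, and let $c_5=\frac{\tilde{\Gamma}_p(n)}{\tilde{\Gamma}_p(m)\tilde{\Gamma}_p(n-m)}$. Then the Fisher information matrix after compression $\hat{\mathbf{J}}$ has density $$c_5\,|\mathbf{J}|^{p-n}\,|\hat{\mathbf{J}}|^{m-p}\,|\mathbf{J}-\hat{\mathbf{J}}|^{n-m-p}\qquad\text{for } \mathbf{0}\le\hat{\mathbf{J}}\le\mathbf{J},$$ and its inverse $\hat{\mathbf{K}}=\hat{\mathbf{J}}^{-1}$ has density $$c_5\,|\mathbf{J}|^{p-n}\,|\hat{\mathbf{K}}|^{-n}\,|\mathbf{J}\hat{\mathbf{K}}-\mathbf{I}_p|^{n-m-p}\qquad\text{for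 } \hat{\mathbf{K}}\ge\mathbf{J}^{-1}.$$
   Context: Model: $\mathbf{y}\in\mathbb{C}^n$ is a proper complex normal vector distributed as $\mathcal{CN}(\mathbf{x}(\boldsymbol{\theta}),\sigma^2\mathbf{I}_n)$ with mean parameterized by $\boldsymbol{\theta}\in\mathbb{R}^p$; its Fisher information matrix is $\mathbf{J}$. The compressed data $\mathbf{\Phi}\mathbf{y}\sim\mathcal{CN}(\mathbf{\Phi}\mathbf{x}(\boldsymbol{\theta}),\sigma^2\mathbf{\Phi}\mathbf{\Phi}^H)$ has (for given $\mathbf{\Phi}$) Fisher information matrix $\hat{\mathbf{J}}$. The superscript $H$ is conjugate transpose; $|\cdot|$ is the determinant; $\mathbf{A}\le\mathbf{B}$ for Hermitian matrices means $\mathbf{B}-\mathbf{A}$ is positive semidefinite. $\tilde{\Gamma}_p(a)=\pi^{p(p-1)/2}\prod_{i=1}^p\Gamma(a-i+1)$ is the complex multivariate Gamma function. Densities of Hermitian $p\times p$ random matrices are with respect to $\prod_i dV_{ii}\prod_{i<j}d\,\mathrm{Re}V_{ij}\,d\,\mathrm{Im}V_{ij}$. *)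

(* Defs.v *)
From HB Require Import structures.
From mathcomp Require Import all_boot all_order all_algebra.
From mathcomp Require Import all_classical all_reals all_analysis.
From mathcomp Require Import measurable_realfun complex.

Set Implicit Arguments.
Unset Strict Implicit.
Unset Printing Implicit Defensive.

Import Order.TTheory GRing.Theory Num.Theory.
Import numFieldNormedType.Exports.

Local Open Scope classical_set_scope.
Local Open Scope ring_scope.
Local Open Scope complex_scope.
Local Open Scope sesquilinear_scope.

Section complex_measurable.
Variable R : realType.

HB.instance Definition _ := isPointed.Build R[i] 0.

Definition complex_coords (z : R[i]) : measurableTypeR R * measurableTypeR R :=
  (complex.Re z, complex.Im z).

Definition measurable_complex : set (set R[i]) :=
  preimage_set_system setT complex_coords measurable.

Let measurable_complexP : sigma_algebra setT measurable_complex.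
Proof.
apply: sigma_algebra_preimage; exact: sigma_algebra_measurable.
Qed.

Let measurable_complex0 : measurable_complex set0.
Proof. by case: measurable_complexP. Qed.

Let measurable_complexC A : measurable_complex A -> measurable_complex (~` A).
Proof. by case: measurable_complexP => _ + _ => /[apply]; rewrite setTD. Qed.

Let measurable_complex_bigcup (F : (set R[i])^nat) :
  (forall i, measurable_complex (F i)) -> measurable_complex (\bigcup_i F i).
Proof. by case: measurable_complexP => _ _; apply. Qed.

HB.instance Definition _ := @isMeasurable.Build default_measure_display R[i]
  measurable_complex measurable_complex0 measurable_complexC
  measurable_complex_bigcup.

End complex_measurable.

Definition measure_mx_display : measure_display -> measure_display.
Proof. exact. Qed.

Section mx_measurable.
Context {d} {T : measurableType d}.
Variables m n : nat.

Definition mx_cylinders : set (set 'M[T]_(m, n)) :=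
  \bigcup_(ij in [set: 'I_m * 'I_n])
    preimage_set_system setT (fun A : 'M[T]_(m, n) => A ij.1 ij.2) measurable.

Let mx_set0 : <<s mx_cylinders >> set0.
Proof. exact: sigma_algebra0. Qed.

Let mx_setC A : <<s mx_cylinders >> A -> <<s mx_cylinders >> (~` A).
Proof. exact: sigma_algebraC. Qed.

Let mx_bigcup (F : (set 'M[T]_(m, n))^nat) :
  (forall i, <<s mx_cylinders >> (F i)) -> <<s mx_cylinders >> (\bigcup_i F i).
Proof. exact: sigma_algebra_bigcup. Qed.

HB.instance Definition _ := @isMeasurable.Build (measure_mx_display d)
  'M[T]_(m, n) <<s mx_cylinders >> mx_set0 mx_setC mx_bigcup.

End mx_measurable.

Section mx_measurable_fun.
Context {d d'} {T : measurableType d} {U : measurableType d'}.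
Variables m n : nat.

Lemma measurable_mx_coord (i : 'I_m) (j : 'I_n) :
  measurable_fun setT (fun A : 'M[T]_(m, n) => A i j).
Proof.
move=> _ Y mY; apply: sub_sigma_algebra.
by exists (i, j) => //; exists Y.
Qed.

Lemma measurable_fun_mx (f : U -> 'M[T]_(m, n)) :
  (forall i j, measurable_fun setT (fun u => f u i j)) -> measurable_fun setT f.
Proof.
move=> mf; apply: (@measurability _ _ _ _ _ _ (@mx_cylinders d T m n)) => //.
move=> _ [_ [[i j] _ [Y mY <-]] <-].
rewrite (_ : _ `&` _ = setT `&` (fun u => f u i j) @^-1` Y); first exact: mf.
by rewrite !setTI.
Qed.

Lemma measurable_fun_complex (R : realType) (f : U -> R[i]) :
  measurable_fun setT (fun u => complex.Re (f u) : measurableTypeR R) ->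
  measurable_fun setT (fun u => complex.Im (f u) : measurableTypeR R) ->
  measurable_fun setT f.
Proof.
move=> mRe mIm _ _ [Y mY <-]; rewrite !setTI -comp_preimage.
rewrite -[X in measurable X]setTI.
exact: (measurable_fun_pair mRe mIm).
Qed.

End mx_measurable_fun.

Section pushforward_facts.
Context d d' (T : measurableType d) (U : measurableType d') (R : realType).
Variables (mu : {measure set T -> \bar R}) (f : T -> U).
Hypothesis mf : measurable_fun setT f.

Lemma pushforward0 : pushforward mu f set0 = 0%E.
Proof. exact: measure0. Qed.

Lemma pushforward_ge0 A : (0 <= pushforward mu f A)%E.
Proof. exact: measure_ge0. Qed.

Lemma pushforward_sigma_additive : semi_sigma_additive (pushforward mu f).
Proof. exact: measure_semi_sigma_additive. Qed.

End pushforward_facts.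

Section pushforward_sigma_finite.
Context d d' (T : measurableType d) (U : measurableType d') (R : realType).
Variables (mu : {measure set T -> \bar R}) (f : T -> U) (g : U -> T).
Hypothesis mu_fin : sigma_finite setT mu.
Hypotheses (fgK : cancel f g) (mg : measurable_fun setT g).

Lemma pushforward_sigma_finite : sigma_finite setT (pushforward mu f).
Proof.
have [F FT Foo] := mu_fin.
exists (fun i => g @^-1` F i).
  by rewrite -preimage_bigcup -FT preimage_setT.
move=> i; have [mF Fioo] := Foo i; split.
  by rewrite -[X in measurable X]setTI; exact: mg.
rewrite /pushforward -comp_preimage.
by rewrite (_ : g \o f = id)//; apply/funext => x /=; exact: fgK.
Qed.

End pushforward_sigma_finite.

(* Canonical structure inference does not find this for [m1 \x m2]. *)
Lemma product_measure_sigma_finite d1 d2 (T1 : measurableType d1)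
    (T2 : measurableType d2) (R : realType)
    (m1 : {sigma_finite_measure set T1 -> \bar R})
    (m2 : {sigma_finite_measure set T2 -> \bar R}) :
  sigma_finite setT (m1 \x m2)%E.
Proof.
have /sigma_finiteP[F [TF ndF Foo]] := sigma_finiteT m1.
have /sigma_finiteP[G [TG ndG Goo]] := sigma_finiteT m2.
exists (fun n => F n `*` G n).
  rewrite -setXTT TF TG predeqE => -[x y]; split.
    move=> [/= [n _ Fnx] [k _ Gky]]; exists (maxn n k) => //; split.
    - by move: x Fnx; exact/subsetPset/ndF/leq_maxl.
    - by move: y Gky; exact/subsetPset/ndG/leq_maxr.
  by move=> [n _ []/= ? ?]; split; exists n.
move=> k; have [? ?] := Foo k; have [? ?] := Goo k.
split; first exact: measurableX.
by rewrite product_measure1E// lte_mul_pinfty// ge0_fin_numE.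
Qed.

Section tuple_measure.
Context d (T : measurableType d) (R : realType).
Variable mu : {sigma_finite_measure set T -> \bar R}.

Definition tuple_cons k (xt : T * k.-tuple T) : k.+1.-tuple T :=
  [tuple of xt.1 :: xt.2].

Lemma measurable_tuple_cons k : measurable_fun setT (@tuple_cons k).
Proof. exact: measurable_cons. Qed.

Definition tuple_uncons k (t : k.+1.-tuple T) : T * k.-tuple T :=
  (thead t, [tuple of behead t]).

Lemma measurable_tuple_uncons k : measurable_fun setT (@tuple_uncons k).
Proof.
apply: measurable_fun_pair; first exact: measurable_tnth.
exact: measurable_behead.
Qed.

Lemma tuple_consK k : cancel (@tuple_cons k) (@tuple_uncons k).
Proof. by case=> x t; rewrite /tuple_uncons theadE; congr pair; exact: val_inj. Qed.

Section cons.
Variables (k : nat) (nu : {sigma_finite_measure set (k.-tuple T) -> \bar R}).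

Definition cons_measure : set (k.+1.-tuple T) -> \bar R :=
  pushforward (mu \x nu)%E (@tuple_cons k).

HB.instance Definition _ := isMeasure.Build _ _ _ cons_measure
  (pushforward0 _ (@measurable_tuple_cons k))
  (pushforward_ge0 _ (@measurable_tuple_cons k))
  (@pushforward_sigma_additive _ _ _ _ _ (mu \x nu)%E
     _ (@measurable_tuple_cons k)).

Let cons_measure_sigma_finite : sigma_finite setT cons_measure.
Proof.
apply: (pushforward_sigma_finite _ (@tuple_consK k) (@measurable_tuple_uncons k)).
exact: product_measure_sigma_finite.
Qed.

HB.instance Definition _ := Measure_isSigmaFinite.Build _ _ _ cons_measure
  cons_measure_sigma_finite.

End cons.

(* The k-fold product of mu. *)
Fixpoint tuple_measure k : {sigma_finite_measure set (k.-tuple T) -> \bar R} :=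
  if k is k'.+1 then cons_measure (tuple_measure k') else dirac [tuple].

End tuple_measure.

Section lebesgue_mx.
Variable R : realType.
Local Notation mR := (measurableTypeR R).

Section real.
Variables m n : nat.

Let lebesgue_tuple : {sigma_finite_measure set ((m * n).-tuple mR) -> \bar R} :=
  tuple_measure (@lebesgue_measure R) (m * n).

Definition mx_of_tuple (t : (m * n).-tuple mR) : 'M[mR]_(m, n) :=
  \matrix_(i, j) tnth t (mxvec_index i j).

Lemma measurable_mx_of_tuple : measurable_fun setT mx_of_tuple.
Proof.
apply: measurable_fun_mx => i j.
rewrite (_ : (fun t => _) = @tnth _ mR ^~ (mxvec_index i j)).
  exact: measurable_tnth.
by apply/funext => t; rewrite mxE.
Qed.

Definition lebesgue_mx : set 'M[mR]_(m, n) -> \bar R :=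
  pushforward lebesgue_tuple mx_of_tuple.

HB.instance Definition _ := isMeasure.Build _ _ _ lebesgue_mx
  (pushforward0 _ measurable_mx_of_tuple)
  (pushforward_ge0 _ measurable_mx_of_tuple)
  (@pushforward_sigma_additive _ _ _ _ _ lebesgue_tuple _
     measurable_mx_of_tuple).

Definition tuple_of_mx (A : 'M[mR]_(m, n)) : (m * n).-tuple mR :=
  [tuple (mxvec A) 0 k | k < m * n].

Lemma mx_of_tupleK : cancel mx_of_tuple tuple_of_mx.
Proof.
move=> t; apply: eq_from_tnth => k; rewrite tnth_mktuple.
by case/mxvec_indexP: k => i j; rewrite mxvecE mxE.
Qed.

Lemma measurable_tuple_of_mx : measurable_fun setT tuple_of_mx.
Proof.
apply/measurable_fun_tnthP => k.
case/mxvec_indexP: k => i j.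
rewrite (_ : _ \o _ = fun A : 'M[mR]_(m, n) => A i j).
  exact: measurable_mx_coord.
by apply/funext => A /=; rewrite tnth_mktuple mxvecE.
Qed.

Let lebesgue_mx_sigma_finite : sigma_finite setT lebesgue_mx.
Proof.
apply: (pushforward_sigma_finite _ mx_of_tupleK measurable_tuple_of_mx).
exact: sigma_finiteT.
Qed.

HB.instance Definition _ := Measure_isSigmaFinite.Build _ _ _ lebesgue_mx
  lebesgue_mx_sigma_finite.

End real.

Section complex.
Variables m n : nat.

Definition complex_mx (XY : 'M[mR]_(m, n) * 'M[mR]_(m, n)) : 'M[R[i]]_(m, n) :=
  \matrix_(i, j) (XY.1 i j +i* XY.2 i j).

Lemma measurable_complex_mx : measurable_fun setT complex_mx.
Proof.
apply: measurable_fun_mx => i j; apply: measurable_fun_complex.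
- rewrite (_ : (fun _ => _) = (fun A : 'M[mR]_(m, n) => A i j) \o fst).
    by apply: measurableT_comp => //; exact: measurable_mx_coord.
  by apply/funext => u /=; rewrite mxE.
- rewrite (_ : (fun _ => _) = (fun A : 'M[mR]_(m, n) => A i j) \o snd).
    by apply: measurableT_comp => //; exact: measurable_mx_coord.
  by apply/funext => u /=; rewrite mxE.
Qed.

(* Lebesgue measure on 'M[R[i]]_(m, n), identified with R^(2mn) through the
   real and imaginary parts of the entries. *)
Definition lebesgue_mxC : set 'M[R[i]]_(m, n) -> \bar R :=
  pushforward (@lebesgue_mx m n \x @lebesgue_mx m n)%E complex_mx.

HB.instance Definition _ := isMeasure.Build _ _ _ lebesgue_mxC
  (pushforward0 _ measurable_complex_mx)
  (pushforward_ge0 _ measurable_complex_mx)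
  (@pushforward_sigma_additive _ _ _ _ _ (@lebesgue_mx m n \x @lebesgue_mx m n)%E
     _ measurable_complex_mx).

End complex.

Section hermitian.
Variable p : nat.

(* The p^2 entries of a real matrix X are the free coordinates of a Hermitian
   matrix V: V_ii = X_ii and, for i < j, Re V_ij = X_ij and Im V_ij = X_ji. *)
Definition herm_mx (X : 'M[mR]_p) : 'M[R[i]]_p :=
  \matrix_(i, j) if (i < j)%N then X i j +i* X j i
                 else if (j < i)%N then X j i -i* X i j
                 else X i i +i* 0.

Lemma herm_mx_hermsym (X : 'M[mR]_p) : herm_mx X \is hermsymmx.
Proof.
apply/is_hermitianmxP; rewrite expr0 scale1r; apply/matrixP => i j.
rewrite !mxE; case: (ltngtP i j) => ij.
- by apply/eqP; rewrite eq_complex /= opprK !eqxx.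
- by apply/eqP; rewrite eq_complex /= !eqxx.
- by apply/eqP; rewrite eq_complex /= oppr0 (val_inj ij) !eqxx.
Qed.

Lemma measurable_herm_mx : measurable_fun setT herm_mx.
Proof.
have mX i j : measurable_fun setT (fun X : 'M[mR]_p => X i j : mR).
  exact: measurable_mx_coord.
apply: measurable_fun_mx => i j.
under eq_fun do rewrite mxE.
case: (ltngtP i j) => ij; apply: measurable_fun_complex => /=.
- exact: mX.
- exact: mX.
- exact: mX.
- by apply: measurable_funN; exact: mX.
- exact: mX.
- exact: measurable_cst.
Qed.

(* The volume prod_i dV_ii prod_(i<j) dRe V_ij dIm V_ij, as a measure on
   'M[R[i]]_p carried by the Hermitian matrices. *)
Definition lebesgue_herm : set 'M[R[i]]_p -> \bar R :=
  pushforward (@lebesgue_mx p p) herm_mx.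

HB.instance Definition _ := isMeasure.Build _ _ _ lebesgue_herm
  (pushforward0 _ measurable_herm_mx)
  (pushforward_ge0 _ measurable_herm_mx)
  (@pushforward_sigma_additive _ _ _ _ _ (@lebesgue_mx p p)
     _ measurable_herm_mx).

End hermitian.
End lebesgue_mx.

Definition has_density d d' (Omega : measurableType d) (T : measurableType d')
    (R : realType) (P : probability Omega R) (X : Omega -> T)
    (mu : set T -> \bar R) (f : T -> R) : Prop :=
  [/\ measurable_fun setT X, measurable_fun setT f, forall x, 0 <= f x &
      forall A, measurable A -> P (X @^-1` A) = (\int[mu]_(x in A) (f x)%:E)%E].

Section hermitian_order.
Variables (R : realType) (p : nat).
Implicit Types A B : 'M[R[i]]_p.

(* In R[i], [0 <= z] means that z is real and nonnegative. *)
Definition psdmx A : Prop :=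
  A \is hermsymmx /\ forall v : 'cV[R[i]]_p, 0 <= (v ^t* *m A *m v) 0 0.

Definition loewner_le A B : Prop := psdmx (B - A).

(* Used only on matrices whose determinant is real. *)
Definition rdet A : R := complex.Re (\det A).

End hermitian_order.

Definition Gamma (R : realType) (a : R) : R :=
  \int[lebesgue_measure]_(t in `]0%R, +oo[) (t `^ (a - 1) * expR (- t)).

Definition multiGamma (R : realType) (p : nat) (a : R) : R :=
  pi ^+ (p * p.-1)./2 * \prod_(1 <= i < p.+1) Gamma (a - i%:R + 1).

Section fisher.
Variable R : realType.

(* G is the n x p matrix whose i-th column is the partial derivative of x with
   respect to the i-th parameter, taken on real and imaginary parts. *)
Definition is_mean_jacobian n p (x : 'cV[R]_p -> 'cV[R[i]]_n) (theta : 'cV[R]_p)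
    (G : 'M[R[i]]_(n, p)) : Prop :=
  forall (k : 'I_n) (i : 'I_p),
    is_derive theta (delta_mx i 0) (fun t => complex.Re (x t k 0))
      (complex.Re (G k i)) /\
    is_derive theta (delta_mx i 0) (fun t => complex.Im (x t k 0))
      (complex.Im (G k i)).

Definition fisher n p (sigma2 : R) (G : 'M[R[i]]_(n, p)) : 'M[R[i]]_p :=
  (sigma2^-1)%:C *: (G ^t* *m G).

(* Orthogonal projection onto the column space of Phi^H when Phi has full row
   rank; [invmx] is the identity on singular matrices. *)
Definition row_proj m n (Phi : 'M[R[i]]_(m, n)) : 'M[R[i]]_n :=
  Phi ^t* *m invmx (Phi *m Phi ^t*) *m Phi.

Definition compressed_fisher m n p (sigma2 : R) (G : 'M[R[i]]_(n, p))
    (Phi : 'M[R[i]]_(m, n)) : 'M[R[i]]_p :=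
  (sigma2^-1)%:C *: (G ^t* *m row_proj Phi *m G).

Definition c5 (n m p : nat) : R :=
  multiGamma p n%:R / (multiGamma p m%:R * multiGamma p (n%:R - m%:R)).

Definition fisher_density (n m p : nat) (J V : 'M[R[i]]_p) : R :=
  if `[< loewner_le 0 V /\ loewner_le V J >] then
    c5 n m p * rdet J ^ (p%:Z - n%:Z) * rdet V ^ (m%:Z - p%:Z)
      * rdet (J - V) ^ (n%:Z - m%:Z - p%:Z)
  else 0.

Definition inv_fisher_density (n m p : nat) (J K : 'M[R[i]]_p) : R :=
  if `[< loewner_le (invmx J) K >] then
    c5 n m p * rdet J ^ (p%:Z - n%:Z) * rdet K ^ (- n%:Z)
      * rdet (J *m K - 1%:M) ^ (n%:Z - m%:Z - p%:Z)
  else 0.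

End fisher.

(* Main.v *)
(* Let X be an n x p standard complex Gaussian matrix independent of Phi, and
   T_X the Cholesky factor of X^* X, so that X T_X^-1 has orthonormal columns.
   As the law of Phi is invariant under right multiplication by unitary
   matrices, the law of Y^* P_Phi Y is the same for every Y with orthonormal
   columns, and Y may be replaced by X T_X^-1. With Phi fixed instead, a unitary
   change of variable in X turns P_Phi into the projection on the first m
   coordinates. Writing X = [X1; X2], the matrix becomes the congruence of
   V = X1^* X1 by T_X^-1, where V and X^* X - V = X2^* X2 are independent Wishart
   matrices: this gives the matrix beta density. Congruence by the Cholesky
   factor of J yields the general case, and the Jacobian |K|^(-2p) of inversion
   on Hermitian matrices gives the density of the inverse.

   The Wishart push-forward is obtained by induction on the number of columns.
   The Jacobians are not computed by differentiation: the constants of the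
   linear changes of variable come from uniqueness of Haar measure and from
   Gaussian and Wishart integrals, and that of inversion from the inversion
   invariance of the Haar measure of GL_p(C). *)
Require Import Defs.
From HB Require Import structures.
From mathcomp Require Import all_boot all_order all_algebra.
From mathcomp Require Import all_classical all_reals all_analysis.
From mathcomp Require Import measurable_realfun complex ring lra.
Set Implicit Arguments.
Unset Strict Implicit.
Unset Printing Implicit Defensive.
Import Order.TTheory GRing.Theory Num.Theory.
Import numFieldNormedType.Exports.
Local Open Scope classical_set_scope.
Local Open Scope ring_scope.
Local Open Scope complex_scope.
Local Open Scope sesquilinear_scope.

(** Laws are handled as identities between integrals of an arbitrary nonnegative measurable [h],
    with values in [\bar R]; densities appear only at the end, with [h] an indicator. Integrability
    is then at stake only when a constant is divided out: it must be known to be finite and nonzero,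
    which is why explicit test functions (Gaussians, [etr], [b]) recur. The Gaussian average over X
    stands in for Haar measure on the unitary group. It asks for a normalisation of X that is
    measurable and depends on X^H X alone; an explicit Cholesky recursion provides both. The Wishart
    weights live on the open cone of positive definite matrices, where everything is invertible and
    factors, whereas the densities of the theorem live on closed order intervals and [invmx] has a
    default value on singular matrices. The two pictures agree off zero sets of determinants, which
    are shown to be null. The push-forward of Lebesgue measure on m x p matrices by X^H X has
    constant pi^(mp) over the multivariate Gamma of m; [c5] is the product of these constants for m
    and n - m, divided by the one for n. *)

Local Notation meas f := (measurable_fun setT f).

(** * Measurability of matrix functions *)

Section complex_measurability.
Context {R : realType} {d} {U : measurableType d}.
Implicit Types f g : U -> R[i].

Lemma measurable_Re : meas (@complex.Re R : R[i] -> R).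
Proof.
move=> _ Y mY; exists (Y `*` setT); first by apply: measurableX.
by rewrite setTI setTI; apply/seteqP; split => z //= [].
Qed.

Lemma measurable_Im : meas (@complex.Im R : R[i] -> R).
Proof.
move=> _ Y mY; exists (setT `*` Y); first by apply: measurableX.
by rewrite setTI setTI; apply/seteqP; split => z //= [].
Qed.

Lemma measurable_funRe f : meas f ->
  meas (fun u => complex.Re (f u)).
Proof. exact: measurableT_comp measurable_Re. Qed.

Lemma measurable_funIm f : meas f ->
  meas (fun u => complex.Im (f u)).
Proof. exact: measurableT_comp measurable_Im. Qed.

Lemma measurable_funRC (f : U -> R) : meas f ->
  meas (fun u => (f u)%:C).
Proof. by move=> mf; apply: measurable_fun_complex. Qed.

Lemma measurable_fun_Complex (a b : U -> R) f :
  (forall u, f u = a u +i* b u) -> meas a -> meas b ->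
  meas f.
Proof.
move=> fE ma mb; apply: measurable_fun_complex.
- by under eq_fun do rewrite fE.
- by under eq_fun do rewrite fE.
Qed.

Lemma measurable_funCD f g : meas f -> meas g ->
  meas (fun u => f u + g u).
Proof.
move=> mf mg; apply: (@measurable_fun_Complex
    (fun u => complex.Re (f u) + complex.Re (g u))
    (fun u => complex.Im (f u) + complex.Im (g u))).
- by move=> u; case: (f u) => ? ?; case: (g u).
- by apply: measurable_funD; exact: measurable_funRe.
- by apply: measurable_funD; exact: measurable_funIm.
Qed.

Lemma measurable_funCN f : meas f ->
  meas (fun u => - f u).
Proof.
move=> mf; apply: (@measurable_fun_Complex
    (fun u => - complex.Re (f u)) (fun u => - complex.Im (f u))).
- by move=> u; case: (f u).
- by apply: measurableT_comp => //; exact: measurable_funRe.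
- by apply: measurableT_comp => //; exact: measurable_funIm.
Qed.

Lemma measurable_funCM f g : meas f -> meas g ->
  meas (fun u => f u * g u).
Proof.
move=> mf mg; apply: (@measurable_fun_Complex
    (fun u => complex.Re (f u) * complex.Re (g u) - complex.Im (f u) * complex.Im (g u))
    (fun u => complex.Re (f u) * complex.Im (g u) + complex.Im (f u) * complex.Re (g u))).
- by move=> u; case: (f u) => ? ?; case: (g u).
- by apply: measurable_funB; apply: measurable_funM;
    do ?[exact: measurable_funRe|exact: measurable_funIm].
- by apply: measurable_funD; apply: measurable_funM;
    do ?[exact: measurable_funRe|exact: measurable_funIm].
Qed.

Lemma measurable_fun_conj f : meas f ->
  meas (fun u => (f u)^*%R).
Proof.
move=> mf; apply: (@measurable_fun_Complex
    (fun u => complex.Re (f u)) (fun u => - complex.Im (f u))).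
- by move=> u; case: (f u).
- exact: measurable_funRe.
- by apply: measurableT_comp => //; exact: measurable_funIm.
Qed.

(** Real powers with a fixed exponent are measurable, and u^-1 is u times the real power (u^2)^(-1),
    also at u = 0, where both sides are 0. *)
Lemma measurable_funV (f : U -> R) : meas f ->
  meas (fun u => (f u)^-1).
Proof.
move=> mf.
rewrite (_ : (fun _ => _) = (fun u => f u * ((f u ^+ 2) `^ (-1)))); last first.
  apply/funext => u; rewrite powR_inv1 ?sqr_ge0//.
  have [->|fu0] := eqVneq (f u) 0; first by rewrite invr0 mul0r.
  by rewrite expr2 invfM mulrA divff// mul1r.
apply: measurable_funM => //.
apply: (@measurableT_comp _ _ _ _ _ _ (@powR R ^~ (-1))) => //.
exact: measurable_funX.
Qed.

Lemma measurable_funCV f : meas f ->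
  meas (fun u => (f u)^-1).
Proof.
move=> mf.
have mn : meas
    (fun u => (complex.Re (f u) ^+ 2 + complex.Im (f u) ^+ 2)^-1).
  apply: measurable_funV; apply: measurable_funD; apply: measurable_funX.
    exact: measurable_funRe.
  exact: measurable_funIm.
apply: (@measurable_fun_Complex
    (fun u => complex.Re (f u) * (complex.Re (f u) ^+ 2 + complex.Im (f u) ^+ 2)^-1)
    (fun u => - (complex.Im (f u) * (complex.Re (f u) ^+ 2 + complex.Im (f u) ^+ 2)^-1))).
- by move=> u; case: (f u).
- by apply: measurable_funM => //; exact: measurable_funRe.
- apply: measurableT_comp => //.
  by apply: measurable_funM => //; exact: measurable_funIm.
Qed.

Lemma measurable_funC_sum I (s : seq I) (h : I -> U -> R[i]) :
  (forall i, meas (h i)) ->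
  meas (fun u => \sum_(i <- s) h i u).
Proof.
move=> mh; elim: s => [|i s ih].
  by under eq_fun do rewrite big_nil; exact: measurable_cst.
by under eq_fun do rewrite big_cons; exact: measurable_funCD.
Qed.

Lemma measurable_funC_prod I (s : seq I) (h : I -> U -> R[i]) :
  (forall i, meas (h i)) ->
  meas (fun u => \prod_(i <- s) h i u).
Proof.
move=> mh; elim: s => [|i s ih].
  by under eq_fun do rewrite big_nil; exact: measurable_cst.
by under eq_fun do rewrite big_cons; exact: measurable_funCM.
Qed.

Lemma measurable_fun_eqC f g : meas f -> meas g ->
  meas (fun u => f u == g u).
Proof.
move=> mf mg.
rewrite (_ : (fun _ => _) = (fun u => (complex.Re (f u) == complex.Re (g u))
    && (complex.Im (f u) == complex.Im (g u)))); last first.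
  by apply/funext => u; rewrite eq_complex.
apply: measurable_and; apply: measurable_fun_eqr;
  do ?[exact: measurable_funRe|exact: measurable_funIm].
Qed.

End complex_measurability.

Section mx_entry.
Context {d} {U : measurableType d} {d'} {T : measurableType d'}.
Variables m n : nat.
Implicit Types A : U -> 'M[T]_(m, n).

Lemma measurable_fun_entry A i j : meas A ->
  meas (fun u => A u i j).
Proof.
move=> mA.
apply: (@measurableT_comp _ _ _ _ _ _ (fun X : 'M[T]_(m, n) => X i j)) => //.
exact: measurable_mx_coord.
Qed.

End mx_entry.

Section mx_measurability.
Context {d} {U : measurableType d} {d'} {T : measurableType d'}.
Variables m n : nat.
Implicit Types A : U -> 'M[T]_(m, n).

Lemma measurable_fun_trmx A : meas A ->
  meas (fun u => (A u)^T).
Proof.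
move=> mA; apply: measurable_fun_mx => i j; under eq_fun do rewrite mxE.
exact: measurable_fun_entry.
Qed.

Lemma measurable_fun_row_mx k A (B : U -> 'M[T]_(m, k)) :
  meas A -> meas B ->
  meas (fun u => row_mx (A u) (B u)).
Proof.
move=> mA mB; apply: measurable_fun_mx => i j.
by case: (split_ordP j) => j' ->; under eq_fun do rewrite ?row_mxEl ?row_mxEr;
  exact: measurable_fun_entry.
Qed.

Lemma measurable_fun_col_mx k A (B : U -> 'M[T]_(k, n)) :
  meas A -> meas B ->
  meas (fun u => col_mx (A u) (B u)).
Proof.
move=> mA mB; apply: measurable_fun_mx => i j.
by case: (split_ordP i) => i' ->; under eq_fun do rewrite ?col_mxEu ?col_mxEd;
  exact: measurable_fun_entry.
Qed.

End mx_measurability.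

Section block_measurability.
Context {d} {U : measurableType d} {d'} {T : measurableType d'}.
Variables m1 m2 n1 n2 : nat.

Lemma measurable_fun_rsubmx (A : U -> 'M[T]_(m1, n1 + n2)) :
  meas A -> meas (fun u => rsubmx (A u)).
Proof.
move=> mA; apply: measurable_fun_mx => i j; under eq_fun do rewrite mxE.
exact: measurable_fun_entry.
Qed.

Lemma measurable_fun_usubmx (A : U -> 'M[T]_(m1 + m2, n1)) :
  meas A -> meas (fun u => usubmx (A u)).
Proof.
move=> mA; apply: measurable_fun_mx => i j; under eq_fun do rewrite mxE.
exact: measurable_fun_entry.
Qed.

Lemma measurable_fun_dsubmx (A : U -> 'M[T]_(m1 + m2, n1)) :
  meas A -> meas (fun u => dsubmx (A u)).
Proof.
move=> mA; apply: measurable_fun_mx => i j; under eq_fun do rewrite mxE.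
exact: measurable_fun_entry.
Qed.

Lemma measurable_fun_block_mx (A : U -> 'M[T]_(m1, n1))
    (B : U -> 'M[T]_(m1, n2)) (C : U -> 'M[T]_(m2, n1))
    (D : U -> 'M[T]_(m2, n2)) :
  meas A -> meas B ->
  meas C -> meas D ->
  meas (fun u => block_mx (A u) (B u) (C u) (D u)).
Proof.
by move=> mA mB mC mD; apply: measurable_fun_col_mx;
  apply: measurable_fun_row_mx.
Qed.

End block_measurability.

Section mxC_measurability.
Context {R : realType} {d} {U : measurableType d}.
Local Notation C := R[i].

Lemma measurable_fun_addmx m n (A B : U -> 'M[C]_(m, n)) :
  meas A -> meas B ->
  meas (fun u => A u + B u).
Proof.
move=> mA mB; apply: measurable_fun_mx => i j; under eq_fun do rewrite mxE.
by apply: measurable_funCD; exact: measurable_fun_entry.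
Qed.

Lemma measurable_fun_oppmx m n (A : U -> 'M[C]_(m, n)) :
  meas A -> meas (fun u => - A u).
Proof.
move=> mA; apply: measurable_fun_mx => i j; under eq_fun do rewrite mxE.
by apply: measurable_funCN; exact: measurable_fun_entry.
Qed.

Lemma measurable_fun_scalemx m n (a : U -> C) (A : U -> 'M[C]_(m, n)) :
  meas a -> meas A ->
  meas (fun u => a u *: A u).
Proof.
move=> ma mA; apply: measurable_fun_mx => i j; under eq_fun do rewrite mxE.
by apply: measurable_funCM => //; exact: measurable_fun_entry.
Qed.

Lemma measurable_fun_scalar_mx n (a : U -> C) : meas a ->
  meas (fun u => (a u)%:M : 'M[C]_n).
Proof.
move=> ma; apply: measurable_fun_mx => i j; under eq_fun do rewrite mxE.
by case: (i == j) => //=; exact: measurable_cst.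
Qed.

Lemma measurable_fun_mulmx m n p (A : U -> 'M[C]_(m, n)) (B : U -> 'M[C]_(n, p)) :
  meas A -> meas B ->
  meas (fun u => A u *m B u).
Proof.
move=> mA mB; apply: measurable_fun_mx => i j; under eq_fun do rewrite mxE.
apply: measurable_funC_sum => k.
by apply: measurable_funCM; exact: measurable_fun_entry.
Qed.

Lemma measurable_fun_conjmx m n (A : U -> 'M[C]_(m, n)) :
  meas A -> meas (fun u => map_mx Num.conj (A u)).
Proof.
move=> mA; apply: measurable_fun_mx => i j; under eq_fun do rewrite mxE.
by apply: measurable_fun_conj; exact: measurable_fun_entry.
Qed.

Lemma measurable_fun_adjmx m n (A : U -> 'M[C]_(m, n)) :
  meas A -> meas (fun u => (A u) ^t* ).
Proof.
by move=> mA; apply: measurable_fun_conjmx; exact: measurable_fun_trmx.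
Qed.

Lemma measurable_fun_det n (A : U -> 'M[C]_n) :
  meas A -> meas (fun u => \det (A u)).
Proof.
move=> mA; rewrite /determinant; apply: measurable_funC_sum => s.
apply: measurable_funCM; first exact: measurable_cst.
by apply: measurable_funC_prod => i; exact: measurable_fun_entry.
Qed.

Lemma measurable_fun_rdet n (A : U -> 'M[C]_n) :
  meas A -> meas (fun u => rdet (A u)).
Proof. by move=> mA; apply: measurable_funRe; exact: measurable_fun_det. Qed.

Lemma measurable_fun_mxtrace n (A : U -> 'M[C]_n) :
  meas A -> meas (fun u => \tr (A u)).
Proof.
move=> mA; rewrite /mxtrace; apply: measurable_funC_sum => i.
exact: measurable_fun_entry.
Qed.

Lemma measurable_fun_adjugate n (A : U -> 'M[C]_n) :
  meas A -> meas (fun u => \adj (A u)).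
Proof.
move=> mA; apply: measurable_fun_mx => i j; under eq_fun do rewrite mxE.
apply: measurable_funCM; first exact: measurable_cst.
apply: measurable_fun_det; apply: measurable_fun_mx => k l.
by under eq_fun do rewrite !mxE; exact: measurable_fun_entry.
Qed.

(** Cramer's formula on the measurable set of invertible matrices, the identity elsewhere. *)
Lemma measurable_fun_invmx n (A : U -> 'M[C]_n) :
  meas A -> meas (fun u => invmx (A u)).
Proof.
move=> mA; rewrite /invmx.
under eq_fun do rewrite unitmxE unitfE.
apply: measurable_fun_ifT => //.
  apply: measurable_neg; apply: measurable_fun_eqC; last exact: measurable_cst.
  exact: measurable_fun_det.
apply: measurable_fun_scalemx; last exact: measurable_fun_adjugate.
by apply: measurable_funCV; exact: measurable_fun_det.
Qed.

Lemma measurable_fun_eqmx m n (A B : U -> 'M[C]_(m, n)) :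
  meas A -> meas B ->
  meas (fun u => A u == B u).
Proof.
move=> mA mB.
(* Equality of matrices becomes the vanishing of a single real function, a sum of nonnegative
   terms. *)
rewrite (_ : (fun _ => _) = (fun u => \sum_i \sum_j
    (`|complex.Re (A u i j) - complex.Re (B u i j)| +
     `|complex.Im (A u i j) - complex.Im (B u i j)|) == 0)); last first.
  apply/funext => u; apply/eqP/eqP => [->|/eqP].
    by rewrite big1// => i _; rewrite big1// => j _; rewrite !subrr normr0 addr0.
  rewrite psumr_eq0; last by move=> i _; apply: sumr_ge0 => j _; exact: addr_ge0.
  move=> /allP s0; apply/matrixP => i j; apply/eqP.
  have := s0 i; rewrite mem_index_enum => /(_ isT).
  rewrite psumr_eq0/=; last by move=> k _; exact: addr_ge0.
  move=> /allP/(_ j); rewrite mem_index_enum => /(_ isT)/=.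
  by rewrite paddr_eq0// !normr_eq0 !subr_eq0 eq_complex.
apply: measurable_fun_eqr; last exact: measurable_cst.
apply: measurable_sum => i; apply: measurable_sum => j.
apply: measurable_funD; apply: measurableT_comp => //; apply: measurable_funB.
- by apply: measurable_funRe; exact: measurable_fun_entry.
- by apply: measurable_funRe; exact: measurable_fun_entry.
- by apply: measurable_funIm; exact: measurable_fun_entry.
- by apply: measurable_funIm; exact: measurable_fun_entry.
Qed.

End mxC_measurability.

Lemma measurable_fun_pair_fst d1 d2 d3 (U : measurableType d1)
    (T1 : measurableType d2) (T2 : measurableType d3) (f : U -> T1 * T2) :
  meas f -> meas (fun u => (f u).1).
Proof. exact: measurableT_comp. Qed.

Lemma measurable_fun_pair_snd d1 d2 d3 (U : measurableType d1)
    (T1 : measurableType d2) (T2 : measurableType d3) (f : U -> T1 * T2) :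
  meas f -> meas (fun u => (f u).2).
Proof. exact: measurableT_comp. Qed.

(** * Tonelli's theorem and image measures *)

Section tonelli.
Context d1 d2 (T1 : measurableType d1) (T2 : measurableType d2) (R : realType).
Variables (m1 : {sigma_finite_measure set T1 -> \bar R})
  (m2 : {sigma_finite_measure set T2 -> \bar R}).
Variable f : T1 -> T2 -> \bar R.
Hypotheses (mf : meas (fun z : T1 * T2 => f z.1 z.2))
  (f0 : forall x y, (0 <= f x y)%E).

Lemma integral_swap :
  (\int[m1]_x \int[m2]_y f x y = \int[m2]_y \int[m1]_x f x y)%E.
Proof. exact: (fubini_tonelli (fun z => f z.1 z.2)). Qed.

Lemma measurable_integral_snd :
  meas (fun x => \int[m2]_y f x y)%E.
Proof. exact: (measurable_fun_fubini_tonelli_F (fun z => f z.1 z.2)). Qed.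

Lemma measurable_integral_fst :
  meas (fun y => \int[m1]_x f x y)%E.
Proof. exact: (measurable_fun_fubini_tonelli_G (fun z => f z.1 z.2)). Qed.

End tonelli.

Section image_measure.
Context d d' (T : measurableType d) (U : measurableType d') (R : realType).
Variables (mu : {measure set T -> \bar R}) (f : T -> U).
Hypothesis mf : meas f.

(* Unlike [pushforward], this carries the measurability proof, so that the
   measure structure is found by canonical inference. *)
Definition image_measure of meas f : set U -> \bar R :=
  pushforward mu f.

HB.instance Definition _ := isMeasure.Build _ _ _ (image_measure mf)
  (pushforward0 _ mf) (pushforward_ge0 _ mf)
  (@pushforward_sigma_additive _ _ _ _ _ mu _ mf).

Lemma ge0_integral_image (g : U -> \bar R) :
  meas g -> (forall x, 0 <= g x)%E ->
  (\int[image_measure mf]_x g x = \int[mu]_x g (f x))%E.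
Proof. by move=> mg g0; rewrite ge0_integral_pushforward. Qed.

End image_measure.

Lemma ge0_integral_measure_eq d (T : measurableType d) (R : realType)
    (m1 m2 : {measure set T -> \bar R}) (g : T -> \bar R) :
  (forall A, measurable A -> m1 A = m2 A) -> (\int[m1]_x g x = \int[m2]_x g x)%E.
Proof. by move=> m12; apply: eq_measure_integral => A mA _; exact: m12. Qed.

(** * Lebesgue measure on the line and on tuples *)

Section lebesgue1.
Variable R : realType.
Local Notation mR := (measurableTypeR R).
Local Notation mu := (@lebesgue_measure R).

Lemma lebesgue_measureD (c : R) (A : set R) : measurable A ->
  mu ((fun x => x + c) @^-1` A) = mu A.
Proof.
move=> mA; apply/esym.
have mD : meas (fun x : mR => x + c : mR).
  by apply: measurable_funD => //; exact: measurable_cst.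
apply: (lebesgue_measure_unique (mu := image_measure mu mD)) => //.
move=> _ [[a b]] _ <-/=.
rewrite /image_measure /pushforward (_ : _ @^-1` _ = `]a - c, b - c]%classic).
  rewrite !lebesgue_measure_itv/= !lte_fin ltrD2r -!EFinD.
  by rewrite opprD opprK addrACA addNr addr0.
by apply/seteqP; split => x /=; rewrite !in_itv/= ltrBlDr lerBrDr.
Qed.

(** The image of Lebesgue measure under multiplication by r, multiplied by r, gives half-open
    intervals their length, so it is Lebesgue measure again. *)
Lemma ge0_integral_scale (r : R) (f : R -> \bar R) : 0 < r ->
  meas f -> (forall x, 0 <= f x)%E ->
  (\int[mu]_x f (r * x)%R = (r^-1)%:E * \int[mu]_x f x)%E.
Proof.
move=> r0 mf f0.
have mM : meas (fun x : mR => r * x : mR).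
  by apply: measurable_funM => //; exact: measurable_cst.
pose nu := mscale (NngNum (ltW r0)) (image_measure mu mM).
have munu A : measurable A -> mu A = nu A.
  apply: lebesgue_measure_unique => _ [[a b]] _ <-/=.
  rewrite /nu /mscale/= /image_measure /pushforward.
  rewrite (_ : _ @^-1` _ = `]a / r, b / r]%classic); last first.
    by apply/seteqP; split => x /=; rewrite !in_itv/= ltr_pdivrMr// ler_pdivlMr// mulrC.
  rewrite !lebesgue_measure_itv/= !lte_fin ltr_pM2r ?invr_gt0//.
  case: ifP => ab; last by rewrite mule0.
  by rewrite -!EFinD -EFinM -mulrBl mulrCA divff ?gt_eqF// mulr1.
have -> : (\int[mu]_x f x = \int[nu]_x f x)%E.
  exact: ge0_integral_measure_eq.
rewrite ge0_integral_mscale// ge0_integral_image//= muleA -EFinM.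
by rewrite mulVf ?gt_eqF// mul1e.
Qed.

End lebesgue1.

Section integral_tuple.
Context d (T : measurableType d) (R : realType).
Variable mu : {sigma_finite_measure set T -> \bar R}.

Lemma integral_tuple_prod k (phi : 'I_k -> T -> R) :
  (forall i, meas (phi i)) -> (forall i x, (0 <= phi i x)%R) ->
  (\int[tuple_measure mu k]_t (\prod_i phi i (tnth t i))%:E =
   \prod_i \int[mu]_x (phi i x)%:E)%E.
Proof.
elim: k phi => [|k ih] phi mphi phi0.
  rewrite big_ord0 /=; under eq_integral do rewrite big_ord0.
  by rewrite integral_cst//= diracT mule1.
have mpr (l : nat) (psi : 'I_l -> T -> R) : (forall i, meas (psi i)) ->
    meas (fun t : l.-tuple T => \prod_i psi i (tnth t i)).
  move=> mpsi; apply: measurable_prod => i _.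
  by apply: measurableT_comp => //; exact: measurable_tnth.
rewrite big_ord_recl/= ge0_integral_pushforward//=; last 3 first.
- exact: measurable_tuple_cons.
- by apply/measurable_EFinP; exact: mpr.
- by move=> t _; rewrite lee_fin prodr_ge0.
under eq_integral => z _.
  rewrite big_ord_recl tnth0.
  under eq_bigr do rewrite tnthS.
  over.
rewrite fubini_tonelli1//=; last 2 first.
- apply/measurable_EFinP; apply: measurable_funM; first exact: measurableT_comp.
  have m2 := mpr _ (fun i => phi (lift ord0 i)) (fun i => mphi _).
  exact: (measurableT_comp m2 measurable_snd).
- by move=> z; rewrite lee_fin mulr_ge0// prodr_ge0.
rewrite /fubini_F/= -(ih (fun i => phi (lift ord0 i)))//.
under eq_integral => x _.
  under eq_integral do rewrite EFinM.
  rewrite ge0_integralZl//; last 3 first.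
  - by apply/measurable_EFinP; exact: (mpr _ (fun i => phi (lift ord0 i))).
  - by move=> t _; rewrite lee_fin prodr_ge0.
  - by rewrite lee_fin.
  over.
rewrite ge0_integralZr//.
- exact/measurable_EFinP.
- by move=> x _; rewrite lee_fin.
- by apply: integral_ge0 => t _; rewrite lee_fin prodr_ge0.
Qed.

End integral_tuple.

(** * Lebesgue measure on real and complex matrices *)

Section lebesgue_mx_box.
Variable R : realType.
Local Notation mR := (measurableTypeR R).
Local Notation mu := (@lebesgue_measure R).

Lemma integral_lebesgue_mx_prod m n (phi : 'I_m -> 'I_n -> mR -> R) :
  (forall i j, meas (phi i j)) -> (forall i j x, 0 <= phi i j x) ->
  (\int[@lebesgue_mx R m n]_X (\prod_i \prod_j phi i j (X i j))%:E =
   \prod_i \prod_j \int[mu]_x (phi i j x)%:E)%E.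
Proof.
move=> mphi phi0.
have mE (i : 'I_m) (j : 'I_n) : meas (fun X : 'M[mR]_(m, n) => phi i j (X i j)).
  have mX : meas (fun X : 'M[mR]_(m, n) => X i j).
    exact: measurable_mx_coord.
  exact: (measurableT_comp (mphi i j) mX).
rewrite ge0_integral_pushforward//=; last 3 first.
- exact: measurable_mx_of_tuple.
- apply/measurable_EFinP; apply: measurable_prod => i _.
  by apply: measurable_prod => j _.
- by move=> X _; rewrite lee_fin; apply: prodr_ge0 => i _; exact: prodr_ge0.
(* [psi] is [phi] reindexed along the inverse of [mxvec_index], to match the flat product over all
   coordinates. *)
pose psi k := let ij := (enum_val (cast_ord (esym (mxvec_cast m n)) k)) : 'I_m * 'I_n in phi ij.1 ij.2.
have psiE i j : psi (mxvec_index i j) = phi i j.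
  by rewrite /psi /mxvec_index cast_ordK enum_rankK.
have prodE (V : Type) (x : V) (op : Monoid.com_law x) (F : 'I_(m * n) -> V) :
    \big[op/x]_k F k = \big[op/x]_i \big[op/x]_j F (mxvec_index i j).
  rewrite pair_bigA/= (reindex (fun ij : 'I_m * 'I_n => mxvec_index ij.1 ij.2))//=.
  exists (fun k => enum_val (cast_ord (esym (mxvec_cast m n)) k)) => [[i j] _|k _].
    by rewrite /mxvec_index cast_ordK enum_rankK.
  by case/mxvec_indexP: k => i j; rewrite /mxvec_index cast_ordK enum_rankK.
transitivity (\int[tuple_measure mu (m * n)]_t (\prod_k psi k (tnth t k))%:E)%E.
  apply: eq_integral => t _; congr EFin.
  rewrite prodE; apply: eq_bigr => i _; apply: eq_bigr => j _.
  by rewrite mxE psiE.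
rewrite integral_tuple_prod//; last 2 first.
- by move=> k; exact: mphi.
- by move=> k x; exact: phi0.
by rewrite prodE; under eq_bigr do under eq_bigr do rewrite psiE.
Qed.

(** Sides are arbitrary measurable sets rather than intervals, so that preimages of boxes under
    entrywise maps are again boxes. *)
Definition mx_box m n (B : 'I_m -> 'I_n -> set mR) : set 'M[mR]_(m, n) :=
  [set X | forall i j, B i j (X i j)].

Lemma measurable_mx_box m n (B : 'I_m -> 'I_n -> set mR) :
  (forall i j, measurable (B i j)) -> measurable (mx_box B).
Proof.
move=> mB.
rewrite (_ : mx_box B = \bigcap_i \bigcap_j (fun X : 'M[mR]_(m, n) => X i j) @^-1` B i j).
  apply: fin_bigcap_measurable => [|i _]; first exact: finite_finset.
  apply: fin_bigcap_measurable => [|j _]; first exact: finite_finset.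
  have mX : meas (fun X : 'M[mR]_(m, n) => X i j).
    exact: measurable_mx_coord.
  by rewrite -[X in measurable X]setTI; apply: mX.
by apply/seteqP; split => X /= H; [move=> i _ j _|move=> i j]; exact: H.
Qed.

Lemma lebesgue_mx_box m n (B : 'I_m -> 'I_n -> set mR) :
  (forall i j, measurable (B i j)) ->
  lebesgue_mx (mx_box B) = (\prod_i \prod_j mu (B i j))%E.
Proof.
move=> mB.
have := @integral_lebesgue_mx_prod m n (fun i j => \1_(B i j)).
under [RHS]eq_bigr do under eq_bigr do rewrite integral_indic ?setIT//.
move=> <- //=.
rewrite -[X in lebesgue_mx X](setIT (mx_box B)) -integral_indic//; last exact: measurable_mx_box.
apply: eq_integral => X _; congr EFin; rewrite indicE.
case: (boolP (X \in mx_box B)) => [/set_mem|/negP] XB.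
  rewrite big1// => i _; rewrite big1// => j _; rewrite indicE mem_set//; exact: (XB i j).
apply/esym/eqP; apply: contra_notT XB => X0; apply/mem_set => i j.
apply: contrapT => XB; move: X0.
by rewrite (bigD1 i)//= (bigD1 j)//= indicE memNset// !mul0r eqxx.
Qed.

(** Boxes are stable under intersection, generate the sigma-algebra and include the cubes of side
    [-k, k], which exhaust the space with finite measure. Rearrangements of real coordinates are
    justified by comparing an image measure with [lebesgue_mx] on boxes. *)
Lemma lebesgue_mx_unique m n (nu : {measure set 'M[mR]_(m, n) -> \bar R}) :
  (forall B : 'I_m -> 'I_n -> set mR, (forall i j, measurable (B i j)) ->
    nu (mx_box B) = (\prod_i \prod_j mu (B i j))%E) ->
  forall A, measurable A -> lebesgue_mx A = nu A.
Proof.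
move=> nuB.
pose G : set (set 'M[mR]_(m, n)) :=
  [set mx_box B | B in [set B | forall i j, measurable (B i j)]].
pose g k : set 'M[mR]_(m, n) := mx_box (fun _ _ => `[- k%:R, k%:R]%classic).
apply: (measure_unique G g).
- apply/seteqP; split.
    apply: smallest_sub; first exact: smallest_sigma_algebra.
    move=> _ [[i j] _ [Y mY <-]]; apply: sub_sigma_algebra.
    exists (fun i' j' => if (i', j') == (i, j) then Y else setT).
      by move=> i' j'; case: ifP.
    rewrite setTI; apply/seteqP; split => X /=.
      by move=> /(_ i j); rewrite eqxx.
    by move=> XY i' j'; case: ifPn => // /eqP[-> ->].
  apply: smallest_sub; first exact: sigma_algebra_measurable.
  by move=> _ [B mB <-]; exact: measurable_mx_box.
- move=> _ _ [B mB <-] [B' mB' <-]; exists (fun i j => B i j `&` B' i j).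
    by move=> i j; exact: measurableI.
  by apply/seteqP; split => X /= => [H|[H H'] i j]; split => // i j; case: (H i j).
- by move=> k; exists (fun _ _ => `[- k%:R, k%:R]%classic).
- apply/seteqP; split => // X _.
  pose M := \sum_i \sum_j `|X i j|.
  exists (Num.bound M) => // i j /=; rewrite in_itv/= -ler_norml.
  have XM : `|X i j| <= M.
    rewrite /M (bigD1 i)//= (bigD1 j)//= -addrA lerDl addr_ge0//.
      exact: sumr_ge0.
    by apply: sumr_ge0 => ? _; exact: sumr_ge0.
  apply: (le_trans XM); apply: ltW; apply: archi_boundP.
  by apply: sumr_ge0 => ? _; exact: sumr_ge0.
- by move=> _ [B mB <-]; exact: etrans (lebesgue_mx_box mB) (esym (nuB _ mB)).
- move=> k.
  have /= e := @lebesgue_mx_box m n (fun _ _ => `[- k%:R, k%:R]%classic)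
    (fun _ _ => measurable_itv _).
  suff : (\prod_(i < m) \prod_(j < n) mu (`[(- k%:R)%R, k%:R%R]%classic : set R) < +oo)%E.
    by rewrite -e.
  rewrite lebesgue_measure_itv/= lte_fin -EFinD; case: ifP => _.
    by under eq_bigr do rewrite prodEFin; rewrite prodEFin ltry.
  by under eq_bigr do rewrite prodEFin; rewrite prodEFin ltry.
Qed.
End lebesgue_mx_box.

Section lebesgue_mx_maps.
Variable R : realType.
Local Notation mR := (measurableTypeR R).
Local Notation mu := (@lebesgue_measure R).

Lemma integral_lebesgue_mx_row m n1 n2 (f : 'M[mR]_(m, n1 + n2) -> \bar R) :
  meas f -> (forall X, 0 <= f X)%E ->
  (\int[@lebesgue_mx R m (n1 + n2)]_X f X =
   \int[@lebesgue_mx R m n1]_A \int[@lebesgue_mx R m n2]_B f (row_mx A B))%E.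
Proof.
move=> mf f0.
have mr : meas
    (fun AB : 'M[mR]_(m, n1) * 'M[mR]_(m, n2) => row_mx AB.1 AB.2).
  exact: measurable_fun_row_mx.
pose nu := image_measure (@lebesgue_mx R m n1 \x @lebesgue_mx R m n2)%E mr.
rewrite (ge0_integral_measure_eq (m2 := nu)); last first.
  apply: lebesgue_mx_unique => B mB; rewrite /nu/= /image_measure /pushforward.
  rewrite (_ : _ @^-1` _ = mx_box (fun i j => B i (lshift n2 j)) `*`
      mx_box (fun i j => B i (rshift n1 j))); last first.
    apply/seteqP; split => -[X Y]/=.
      move=> XY; split=> i j.
        by have := XY i (lshift n2 j); rewrite row_mxEl.
      by have := XY i (rshift n1 j); rewrite row_mxEr.
    move=> [XB YB] i j; case: (split_ordP j) => k ->.
      by rewrite row_mxEl; exact: XB.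
    by rewrite row_mxEr; exact: YB.
  rewrite product_measure1E; [|exact: measurable_mx_box..].
  rewrite [X in (X * _)%E]lebesgue_mx_box// [X in (_ * X)%E]lebesgue_mx_box//.
  rewrite -big_split/=; apply: eq_bigr => i _.
  by rewrite big_split_ord.
rewrite ge0_integral_image// fubini_tonelli1//=.
exact: (measurableT_comp mf mr).
Qed.

Lemma integral_lebesgue_mx_tr m n (f : 'M[mR]_(n, m) -> \bar R) :
  meas f -> (forall X, 0 <= f X)%E ->
  (\int[@lebesgue_mx R n m]_X f X = \int[@lebesgue_mx R m n]_X f X^T)%E.
Proof.
move=> mf f0.
have mr : meas (fun X : 'M[mR]_(m, n) => X^T).
  exact: measurable_fun_trmx.
rewrite (ge0_integral_measure_eq (m2 := image_measure (@lebesgue_mx R m n) mr)).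
  by rewrite ge0_integral_image.
apply: lebesgue_mx_unique => B mB; rewrite /= /image_measure /pushforward.
rewrite (_ : _ @^-1` _ = mx_box (fun i j => B j i)); last first.
  by apply/seteqP; split => X /= XB i j; have := XB j i; rewrite mxE.
by rewrite lebesgue_mx_box// exchange_big.
Qed.

(** The preimage of a box is the box of the preimages of its sides, and each [phi i j] preserves
    Lebesgue measure. Sign changes and translations are the intended instances. *)
Lemma integral_lebesgue_mx_entrywise m n (phi : 'I_m -> 'I_n -> mR -> mR)
    (f : 'M[mR]_(m, n) -> \bar R) :
  (forall i j, meas (phi i j)) ->
  (forall i j B, measurable B -> mu (phi i j @^-1` B) = mu B) ->
  meas f -> (forall X, 0 <= f X)%E ->
  (\int[@lebesgue_mx R m n]_X f X =
   \int[@lebesgue_mx R m n]_X f (\matrix_(i, j) phi i j (X i j)))%E.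
Proof.
move=> mphi phimu mf f0.
have mr : meas
    (fun X : 'M[mR]_(m, n) => \matrix_(i, j) phi i j (X i j)).
  apply: measurable_fun_mx => i j; under eq_fun do rewrite mxE.
  have mX : meas (fun X : 'M[mR]_(m, n) => X i j).
    exact: measurable_mx_coord.
  exact: (measurableT_comp (mphi i j) mX).
rewrite (ge0_integral_measure_eq (m2 := image_measure (@lebesgue_mx R m n) mr)).
  by rewrite ge0_integral_image.
apply: lebesgue_mx_unique => B mB; rewrite /= /image_measure /pushforward.
rewrite (_ : _ @^-1` _ = mx_box (fun i j => phi i j @^-1` B i j)); last first.
  by apply/seteqP; split => X /= XB i j; have := XB i j; rewrite mxE.
rewrite lebesgue_mx_box//.
  by apply: eq_bigr => i _; apply: eq_bigr => j _; exact: phimu.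
by move=> i j; rewrite -[X in measurable X]setTI; exact: mphi.
Qed.

Lemma integral_lebesgue_mx_col m1 m2 n (f : 'M[mR]_(m1 + m2, n) -> \bar R) :
  meas f -> (forall X, 0 <= f X)%E ->
  (\int[@lebesgue_mx R (m1 + m2) n]_X f X =
   \int[@lebesgue_mx R m1 n]_A \int[@lebesgue_mx R m2 n]_B f (col_mx A B))%E.
Proof.
move=> mf f0.
have mT k l : meas (fun X : 'M[mR]_(k, l) => X^T).
  exact: measurable_fun_trmx.
rewrite integral_lebesgue_mx_tr// integral_lebesgue_mx_row//; last first.
  exact: (measurableT_comp mf (mT _ _)).
rewrite [RHS]integral_lebesgue_mx_tr//; last 2 first.
- apply: measurable_integral_snd => //.
  apply: measurableT_comp => //; exact: measurable_fun_col_mx.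
- by move=> X; exact: integral_ge0.
apply: eq_integral => A _; rewrite [RHS]integral_lebesgue_mx_tr//.
  by apply: eq_integral => B _; rewrite tr_row_mx.
apply: (measurableT_comp mf); apply: measurable_fun_col_mx => //.
Qed.

End lebesgue_mx_maps.

Section lebesgue_mxC_maps.
Variable R : realType.
Local Notation mR := (measurableTypeR R).
Local Notation mu := (@lebesgue_measure R).
Local Notation C := R[i].
Local Notation lamR m n := (@lebesgue_mx R m n).
Local Notation lam m n := (@lebesgue_mxC R m n).

Let reim_mx m n (Z : 'M[C]_(m, n)) : 'M[mR]_(m, n) * 'M[mR]_(m, n) :=
  (map_mx (@complex.Re R) Z, map_mx (@complex.Im R) Z).

Let measurable_reim_mx m n : meas (@reim_mx m n).
Proof.
apply: measurable_fun_pair; apply: measurable_fun_mx => i j;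
  under eq_fun do rewrite mxE.
- by apply: measurable_funRe; exact: measurable_mx_coord.
- by apply: measurable_funIm; exact: measurable_mx_coord.
Qed.

Let complex_mxK m n : cancel (@complex_mx R m n) (@reim_mx m n).
Proof. by case=> X Y; congr pair; apply/matrixP => i j; rewrite !mxE. Qed.

Let lebesgue_mxC_sigma_finite m n : sigma_finite setT (@lebesgue_mxC R m n).
Proof.
apply: (pushforward_sigma_finite _ (@complex_mxK m n) (@measurable_reim_mx m n)).
exact: product_measure_sigma_finite.
Qed.

HB.instance Definition _ m n := Measure_isSigmaFinite.Build _ _ _
  (@lebesgue_mxC R m n) (@lebesgue_mxC_sigma_finite m n).

Lemma measurable_complex_mx_pair m n : meas (fun XY : 'M[mR]_(m, n) * 'M[mR]_(m, n) =>
  complex_mx (XY.1, XY.2)).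
Proof. by under eq_fun do rewrite -surjective_pairing; exact: measurable_complex_mx. Qed.

Lemma integral_lebesgue_mxC m n (f : 'M[C]_(m, n) -> \bar R) :
  meas f -> (forall Z, 0 <= f Z)%E ->
  (\int[lam m n]_Z f Z =
   \int[lamR m n]_X \int[lamR m n]_Y f (complex_mx (X, Y)))%E.
Proof.
move=> mf f0; rewrite ge0_integral_pushforward//=; last exact: measurable_complex_mx.
rewrite fubini_tonelli1//=.
exact: (measurableT_comp mf (@measurable_complex_mx R m n)).
Qed.

Lemma integral_lebesgue_mxC_row m n1 n2 (f : 'M[C]_(m, n1 + n2) -> \bar R) :
  meas f -> (forall Z, 0 <= f Z)%E ->
  (\int[lam m (n1 + n2)]_Z f Z =
   \int[lam m n1]_A \int[lam m n2]_B f (row_mx A B))%E.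
Proof.
move=> mf f0.
have mrow (d : measure_display) (U : measurableType d)
    (A : U -> 'M[C]_(m, n1)) (B : U -> 'M[C]_(m, n2)) :
    meas A -> meas B ->
    meas (fun u => f (row_mx (A u) (B u))).
  by move=> mA mB; exact: (measurableT_comp mf (measurable_fun_row_mx mA mB)).
have mc (k l : nat) (d : measure_display) (U : measurableType d)
    (A B : U -> 'M[mR]_(k, l)) :
    meas A -> meas B ->
    meas (fun u => complex_mx (A u, B u)).
  move=> mA mB; apply: (measurableT_comp (@measurable_complex_mx R k l)).
  exact: measurable_fun_pair.
have rowE (A1 B1 : 'M[mR]_(m, n1)) (A2 B2 : 'M[mR]_(m, n2)) :
    complex_mx (row_mx A1 A2, row_mx B1 B2) =
    row_mx (complex_mx (A1, B1)) (complex_mx (A2, B2)).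
  apply/matrixP => i j; rewrite !mxE.
  by case: (split_ordP j) => k _; rewrite !mxE.
rewrite integral_lebesgue_mxC// integral_lebesgue_mx_row//; last 2 first.
- apply: measurable_integral_snd => //.
  exact: (measurableT_comp mf (@measurable_complex_mx_pair _ _)).
- by move=> X; exact: integral_ge0.
rewrite [RHS]integral_lebesgue_mxC//; last 2 first.
- by apply: measurable_integral_snd => //; exact: mrow.
- by move=> X; exact: integral_ge0.
apply: eq_integral => X1 _.
transitivity (\int[lamR m n2]_X2 \int[lamR m n1]_Y1 \int[lamR m n2]_Y2
    f (row_mx (complex_mx (X1, Y1)) (complex_mx (X2, Y2))))%E.
  apply: eq_integral => X2 _; rewrite integral_lebesgue_mx_row; last 2 first.
  - by apply: (measurableT_comp mf); apply: mc; [exact: measurable_cst|].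
  - by move=> Y; exact: f0.
  by apply: eq_integral => Y1 _; apply: eq_integral => Y2 _; rewrite rowE.
(* Real parts are integrated before imaginary ones, in the order X1, X2, Y1, Y2; exchanging X2 and
   Y1 regroups the coordinates block by block. *)
rewrite integral_swap; last 2 first.
- apply: (@measurable_integral_snd _ _ _ _ _ _ (fun z Y2 =>
    f (row_mx (complex_mx (X1, z.2)) (complex_mx (z.1, Y2))))) => //.
  apply: mrow; apply: mc; do ?exact: measurable_cst;
    do ?[apply: measurable_fun_pair_fst|apply: measurable_fun_pair_snd] => //.
- by move=> X2 Y1; exact: integral_ge0.
apply: eq_integral => Y1 _; rewrite [RHS]integral_lebesgue_mxC//.
by apply: mrow => //; exact: measurable_cst.
Qed.

Lemma integral_lebesgue_mxC_tr m n (f : 'M[C]_(n, m) -> \bar R) :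
  meas f -> (forall Z, 0 <= f Z)%E ->
  (\int[lam n m]_Z f Z = \int[lam m n]_Z f Z^T)%E.
Proof.
move=> mf f0.
have trE (X Y : 'M[mR]_(m, n)) : complex_mx (X^T, Y^T) = (complex_mx (X, Y))^T.
  by apply/matrixP => i j; rewrite !mxE.
have mT k l : meas (fun X : 'M[C]_(k, l) => X^T).
  exact: measurable_fun_trmx.
have mTR k l : meas (fun X : 'M[mR]_(k, l) => X^T).
  exact: measurable_fun_trmx.
rewrite integral_lebesgue_mxC// integral_lebesgue_mx_tr; last 2 first.
- apply: measurable_integral_snd => //.
  exact: (measurableT_comp mf (@measurable_complex_mx_pair _ _)).
- by move=> X; exact: integral_ge0.
rewrite [RHS]integral_lebesgue_mxC//; last exact: (measurableT_comp mf (mT _ _)).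
apply: eq_integral => X _; rewrite integral_lebesgue_mx_tr; last 2 first.
- apply: (measurableT_comp mf); apply: (measurableT_comp (@measurable_complex_mx R _ _)).
  by apply: measurable_fun_pair => //; exact: measurable_cst.
- by move=> Y; exact: f0.
by apply: eq_integral => Y _; rewrite trE.
Qed.

Lemma integral_lebesgue_mxC_col m1 m2 n (f : 'M[C]_(m1 + m2, n) -> \bar R) :
  meas f -> (forall X, 0 <= f X)%E ->
  (\int[lam (m1 + m2) n]_X f X =
   \int[lam m1 n]_A \int[lam m2 n]_B f (col_mx A B))%E.
Proof.
move=> mf f0.
have mT k l : meas (fun X : 'M[C]_(k, l) => X^T).
  exact: measurable_fun_trmx.
rewrite integral_lebesgue_mxC_tr// integral_lebesgue_mxC_row//; last first.
  exact: (measurableT_comp mf (mT _ _)).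
rewrite [RHS]integral_lebesgue_mxC_tr; last 2 first.
- apply: measurable_integral_snd => //.
  apply: measurableT_comp => //; exact: measurable_fun_col_mx.
- by move=> X; exact: integral_ge0.
apply: eq_integral => A _; rewrite [RHS]integral_lebesgue_mxC_tr; last 2 first.
- apply: (measurableT_comp mf); apply: measurable_fun_col_mx => //.
- by move=> X; exact: f0.
by apply: eq_integral => B _; rewrite tr_row_mx.
Qed.

Lemma integral_lebesgue_mxC_conj m n (f : 'M[C]_(m, n) -> \bar R) :
  meas f -> (forall Z, 0 <= f Z)%E ->
  (\int[lam m n]_Z f Z = \int[lam m n]_Z f (map_mx Num.conj Z))%E.
Proof.
move=> mf f0.
have mc : meas (fun Z : 'M[C]_(m, n) => map_mx Num.conj Z).
  exact: measurable_fun_conjmx.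
rewrite (integral_lebesgue_mxC mf f0).
rewrite (@integral_lebesgue_mxC _ _ _ (measurableT_comp mf mc) (fun Z => f0 _)).
apply: eq_integral => X _.
rewrite (@integral_lebesgue_mx_entrywise _ _ _ (fun _ _ x => - x)); last 4 first.
- by move=> i j; exact: oppr_measurable.
- by move=> i j B mB; exact: lebesgue_measureN.
- apply: (measurableT_comp mf); apply: (measurableT_comp (@measurable_complex_mx R _ _)).
  by apply: measurable_fun_pair => //; exact: measurable_cst.
- by move=> Y; exact: f0.
apply: eq_integral => Y _; congr f; apply/matrixP => i j; rewrite !mxE.
by apply/eqP; rewrite eq_complex/= !eqxx.
Qed.

Lemma integral_lebesgue_mxC_adj m n (f : 'M[C]_(n, m) -> \bar R) :
  meas f -> (forall Z, 0 <= f Z)%E ->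
  (\int[lam n m]_Z f Z = \int[lam m n]_Z f (Z ^t* ))%E.
Proof.
have mc : meas (fun Z : 'M[C]_(n, m) => map_mx Num.conj Z).
  exact: measurable_fun_conjmx.
move=> mf f0; rewrite integral_lebesgue_mxC_conj// integral_lebesgue_mxC_tr//.
exact: (measurableT_comp mf mc).
Qed.

End lebesgue_mxC_maps.

(** * Translations and Gaussian integrals on complex matrices *)

Section lebesgue_mxC_gauss.
Variable R : realType.
Local Notation mR := (measurableTypeR R).
Local Notation mu := (@lebesgue_measure R).
Local Notation C := R[i].
Local Notation lamR m n := (@lebesgue_mx R m n).
Local Notation lam m n := (@lebesgue_mxC R m n).

Lemma integral_lebesgue_mxCD m n (A : 'M[C]_(m, n)) (f : 'M[C]_(m, n) -> \bar R) :
  meas f -> (forall Z, 0 <= f Z)%E ->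
  (\int[lam m n]_Z f Z = \int[lam m n]_Z f (Z + A)%R)%E.
Proof.
move=> mf f0.
have mD : meas (fun Z : 'M[C]_(m, n) => Z + A).
  by apply: measurable_fun_addmx => //; exact: measurable_cst.
rewrite (integral_lebesgue_mxC mf f0).
rewrite (@integral_lebesgue_mxC _ _ _ _ (measurableT_comp mf mD) (fun Z => f0 _)).
rewrite (@integral_lebesgue_mx_entrywise _ _ _
    (fun i j x => x + complex.Re (A i j))); last 4 first.
- by move=> i j; apply: measurable_funD => //; exact: measurable_cst.
- by move=> i j B mB; exact: lebesgue_measureD.
- apply: measurable_integral_snd => //.
  exact: (measurableT_comp mf (@measurable_complex_mx_pair R _ _)).
- by move=> X; exact: integral_ge0.
apply: eq_integral => X _.
rewrite (@integral_lebesgue_mx_entrywise _ _ _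
    (fun i j x => x + complex.Im (A i j))); last 4 first.
- by move=> i j; apply: measurable_funD => //; exact: measurable_cst.
- by move=> i j B mB; exact: lebesgue_measureD.
- apply: (measurableT_comp mf); apply: (measurableT_comp (@measurable_complex_mx R _ _)).
  by apply: measurable_fun_pair => //; exact: measurable_cst.
- by move=> Y; exact: f0.
apply: eq_integral => Y _; congr f; apply/matrixP => i j; rewrite !mxE.
by case: (A i j) => a b.
Qed.

Definition sqnorm m n (Z : 'M[C]_(m, n)) : R :=
  \sum_i \sum_j (complex.Re (Z i j) ^+ 2 + complex.Im (Z i j) ^+ 2).

Lemma measurable_sqnorm m n : meas (@sqnorm m n).
Proof.
apply: measurable_sum => i; apply: measurable_sum => j.
by apply: measurable_funD; apply: measurable_funX;
  [apply: measurable_funRe|apply: measurable_funIm]; exact: measurable_mx_coord.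
Qed.

(** The weight factors over the 2mn real coordinates, each contributing sqrt (pi / r); real and
    imaginary parts together give pi / r per entry. *)
Lemma integral_gauss_mxC m n (r : R) : 0 < r ->
  (\int[lam m n]_Z (expR (- (r * sqnorm Z)))%:E = ((pi / r) ^+ (m * n))%:E)%E.
Proof.
move=> r0; rewrite integral_lebesgue_mxC//; last first.
  apply/measurable_EFinP; apply: measurableT_comp => //.
  apply: measurableT_comp => //; apply: measurable_funM; first exact: measurable_cst.
  exact: measurable_sqnorm.
pose phi (x : mR) : R := expR (- (r * x ^+ 2)).
have mphi : meas phi.
  apply: measurableT_comp => //; apply: measurableT_comp => //.
  by apply: measurable_funM; [exact: measurable_cst|exact: exprn_measurable].
have intphi : (\int[mu]_x (phi x)%:E = (Num.sqrt (pi / r))%:E)%E.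
  have -> : Num.sqrt (pi / r) = (Num.sqrt r)^-1 * Num.sqrt pi.
    by rewrite sqrtrM ?pi_ge0// sqrtrV ?ltW// mulrC.
  have := @ge0_integral_scale R (Num.sqrt r) (fun x => (gauss_fun x)%:E).
  rewrite sqrtr_gt0 => /(_ r0); rewrite integralT_gauss -EFinM => <-.
  - apply: eq_integral => x _; rewrite /phi /gauss_fun exprMn sqr_sqrtr//.
    exact: ltW.
  - by apply/measurable_EFinP; exact: measurable_gauss_fun.
  - by move=> x; rewrite lee_fin gauss_fun_ge0.
have intR : (\int[lamR m n]_X (\prod_i \prod_j phi (X i j))%:E =
    (Num.sqrt (pi / r) ^+ (m * n))%:E)%E.
  rewrite (@integral_lebesgue_mx_prod R m n (fun _ _ => phi))//; last by move=> *; exact: expR_ge0.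
  under eq_bigr do under eq_bigr do rewrite intphi.
  under eq_bigr do rewrite prodEFin; rewrite prodEFin; congr EFin.
  rewrite (eq_bigr (fun=> Num.sqrt (pi / r) ^+ n)); last first.
    by move=> i _; rewrite prodr_const card_ord.
  by rewrite prodr_const card_ord -exprM mulnC.
have mprod : meas
    (fun X : 'M[mR]_(m, n) => \prod_i \prod_j phi (X i j)).
  apply: measurable_prod => i _; apply: measurable_prod => j _.
  have mX : meas (fun X : 'M[mR]_(m, n) => X i j).
    exact: measurable_mx_coord.
  exact: (measurableT_comp mphi mX).
have prod0 (X : 'M[mR]_(m, n)) : 0 <= \prod_i \prod_j phi (X i j).
  by apply: prodr_ge0 => i _; apply: prodr_ge0 => j _; exact: expR_ge0.
transitivity (\int[lamR m n]_X \int[lamR m n]_Y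
    ((\prod_i \prod_j phi (X i j))%:E * (\prod_i \prod_j phi (Y i j))%:E))%E.
  apply: eq_integral => X _; apply: eq_integral => Y _; rewrite -EFinM; congr EFin.
  rewrite -big_split/= /sqnorm mulr_sumr -sumrN expR_sum; apply: eq_bigr => i _.
  rewrite -big_split/= mulr_sumr -sumrN expR_sum; apply: eq_bigr => j _.
  by rewrite !mxE/= mulrDr opprD expRD.
under eq_integral => X _.
  rewrite ge0_integralZl//; last 3 first.
  - exact/measurable_EFinP.
  - by move=> Y _; rewrite lee_fin.
  - by rewrite lee_fin.
  over.
rewrite ge0_integralZr//; last 3 first.
- exact/measurable_EFinP.
- by move=> Y _; rewrite lee_fin.
- by apply: integral_ge0 => Y _; rewrite lee_fin.
rewrite intR -EFinM -exprMn -expr2 sqr_sqrtr// divr_ge0 ?pi_ge0//.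
exact: ltW.
Qed.

End lebesgue_mxC_gauss.

Lemma integral_prod_mul d1 d2 (T1 : measurableType d1) (T2 : measurableType d2)
    (R : realType) (m1 : {measure set T1 -> \bar R}) (m2 : {measure set T2 -> \bar R})
    (f : T1 -> \bar R) (g : T2 -> \bar R) :
  meas f -> meas g ->
  (forall x, 0 <= f x)%E -> (forall y, 0 <= g y)%E ->
  (\int[m1]_x \int[m2]_y (f x * g y) = (\int[m1]_x f x) * (\int[m2]_y g y))%E.
Proof.
move=> mf mg f0 g0.
under eq_integral => x _ do rewrite ge0_integralZl//.
by rewrite ge0_integralZr//; exact: integral_ge0.
Qed.

(** * Additive changes of variable and their constants *)

Section haar.
Variable R : realType.
Local Notation C := R[i].
Local Notation lam m n := (@lebesgue_mxC R m n).

(** Left unnormalised, with mass pi^(mn): the powers of pi in the Wishart constants come from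
    here. *)
Definition gaussmx m n (Z : 'M[C]_(m, n)) : R := expR (- sqnorm Z).

Lemma gaussmx_ge0 m n (Z : 'M[C]_(m, n)) : 0 <= gaussmx Z.
Proof. exact: expR_ge0. Qed.

Lemma measurable_gaussmx m n : meas (@gaussmx m n).
Proof.
apply: measurableT_comp => //; apply: measurableT_comp => //.
exact: measurable_sqnorm.
Qed.

Lemma integral_gaussmx m n :
  (\int[lam m n]_Z (gaussmx Z)%:E = (pi ^+ (m * n))%:E)%E.
Proof.
rewrite -[pi]divr1 -(@integral_gauss_mxC R m n 1 ltr01).
by apply: eq_integral => Z _; rewrite mul1r.
Qed.

Lemma gaussmxN m n (Z : 'M[C]_(m, n)) : gaussmx (- Z) = gaussmx Z.
Proof.
congr (expR (- _)); apply: eq_bigr => i _; apply: eq_bigr => j _; rewrite mxE.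
by case: (Z i j) => a b /=; rewrite !sqrrN.
Qed.

(* Uniqueness of Haar measure: the double integral of f(Lx) k(y - Lx), with k
   even, is computed in both orders. *)
Lemma integral_lebesgue_mxC_additive m n (L L' : 'M[C]_(m, n) -> 'M[C]_(m, n))
    (f : 'M[C]_(m, n) -> \bar R) :
  {morph L : X Y / X + Y} -> cancel L' L -> meas L ->
  meas f -> (forall Z, 0 <= f Z)%E ->
  (\int[lam m n]_Z f (L Z) =
   (pi ^- (m * n))%:E * (\int[lam m n]_Z (gaussmx (L Z))%:E) *
   \int[lam m n]_Z f Z)%E.
Proof.
move=> LD L'K mL mf f0.
set k := fun Z : 'M[C]_(m, n) => (gaussmx Z)%:E.
have mk : meas k by apply/measurable_EFinP; exact: measurable_gaussmx.
have k0 Z : (0 <= k Z)%E by rewrite lee_fin gaussmx_ge0.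
have mfL : meas (fun x => f (L x)) by exact: measurableT_comp.
have mkL : meas (fun x => k (L x)) by exact: measurableT_comp.
(* The Gaussian k has finite nonzero mass, so it can be divided out; the integral of k (L x) remains
   as the unknown Jacobian. *)
suff : ((\int[lam m n]_x f (L x)) * (\int[lam m n]_y k y) =
    (\int[lam m n]_x k (L x)) * \int[lam m n]_y f y)%E.
  rewrite /k integral_gaussmx => e.
  rewrite -muleA -e muleCA -EFinM mulVf ?mule1//.
  by rewrite expf_neq0// gt_eqF ?pi_gt0.
rewrite -integral_prod_mul//.
have mfst : meas (fun z : 'M[C]_(m, n) * 'M[C]_(m, n) => z.1) by exact: measurable_fst.
have msnd : meas (fun z : 'M[C]_(m, n) * 'M[C]_(m, n) => z.2) by exact: measurable_snd.
have mL1 := measurableT_comp mL mfst.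
transitivity (\int[lam m n]_x \int[lam m n]_y (f (L x) * k (y - L x)%R))%E.
  apply: eq_integral => x _.
  rewrite (@integral_lebesgue_mxCD _ _ _ (- L x) (fun y => f (L x) * k y)%E)//.
    by apply: emeasurable_funM => //; exact: measurable_cst.
  by move=> y; rewrite mule_ge0.
rewrite integral_swap; last 2 first.
- apply: emeasurable_funM; first exact: (measurableT_comp mf mL1).
  apply: (measurableT_comp mk); apply: measurable_fun_addmx => //.
  exact: measurable_fun_oppmx.
- by move=> x y; rewrite mule_ge0.
transitivity (\int[lam m n]_y \int[lam m n]_x (f (y + L x)%R * k (L x)))%E.
  apply: eq_integral => y _.
  (* Shifting x by L' y, where L (L' y) = y, turns y - L x into - L x and moves y into the argument
     of f. *)
  rewrite (@integral_lebesgue_mxCD _ _ _ (L' y)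
    (fun x => f (L x) * k (y - L x)%R)%E); last 2 first.
  - apply: emeasurable_funM; first exact: mfL.
    apply: (measurableT_comp mk); apply: measurable_fun_addmx => //.
    exact: measurable_fun_oppmx.
  - by move=> x; rewrite mule_ge0.
  apply: eq_integral => x _; rewrite LD L'K addrC; congr (_ * _)%E.
  by rewrite opprD addrA subrr add0r /k gaussmxN.
rewrite integral_swap; last 2 first.
- apply: emeasurable_funM; last exact: (measurableT_comp mkL msnd).
  apply: (measurableT_comp mf); apply: measurable_fun_addmx => //.
  exact: (measurableT_comp mL msnd).
- by move=> x y; rewrite mule_ge0.
under eq_integral => x _.
  rewrite ge0_integralZr//; last first.
    by apply: (measurableT_comp mf); apply: measurable_fun_addmx.
  have -> : (\int[lam m n]_y f (y + L x)%R = \int[lam m n]_y f y)%E.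
    by rewrite [RHS](@integral_lebesgue_mxCD _ _ _ (L x)).
  rewrite muleC.
  over.
rewrite ge0_integralZr//.
exact: integral_ge0.
Qed.

Lemma sqnormE m n (Z : 'M[C]_(m, n)) : sqnorm Z = complex.Re (\tr (Z ^t* *m Z)).
Proof.
rewrite /sqnorm exchange_big/= /mxtrace raddf_sum/=; apply: eq_bigr => i _.
rewrite mxE raddf_sum/=; apply: eq_bigr => j _; rewrite !mxE.
by case: (Z j i) => a b /=; rewrite mulNr opprK !expr2.
Qed.

Lemma gaussmx_unitaryl m n (U : 'M[C]_m) (Z : 'M[C]_(m, n)) :
  U \is unitarymx -> gaussmx (U *m Z) = gaussmx Z.
Proof.
move=> Uu; congr (expR (- _)); rewrite !sqnormE trmx_mul map_mxM.
have UU : U ^t* *m U = 1%:M by move: Uu; rewrite -trmxC_unitary => /unitarymxP; rewrite trmxCK.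
by rewrite mulmxA -(mulmxA _ _ U) UU mulmx1.
Qed.

(** The constant is 1 because the Gaussian weight is unitarily invariant. *)
Lemma integral_lebesgue_mxC_unitaryl m n (U : 'M[C]_m) (f : 'M[C]_(m, n) -> \bar R) :
  U \is unitarymx ->
  meas f -> (forall Z, 0 <= f Z)%E ->
  (\int[lam m n]_Z f (U *m Z) = \int[lam m n]_Z f Z)%E.
Proof.
move=> Uu mf f0.
have mU : meas (fun Z : 'M[C]_(m, n) => U *m Z).
  exact: measurable_fun_mulmx.
rewrite (@integral_lebesgue_mxC_additive m n (mulmx U) (mulmx (U ^t* )))//.
- under [X in (_ * X * _)%E]eq_integral do rewrite gaussmx_unitaryl//.
  rewrite integral_gaussmx -EFinM mulVf ?mul1e// expf_neq0//.
  by rewrite gt_eqF ?pi_gt0.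
- by move=> X Y; rewrite mulmxDr.
- by move=> X; rewrite mulmxA (unitarymxP Uu) mul1mx.
Qed.

Lemma integral_lebesgue_mxC_unitaryr m n (U : 'M[C]_n) (f : 'M[C]_(m, n) -> \bar R) :
  U \is unitarymx ->
  meas f -> (forall Z, 0 <= f Z)%E ->
  (\int[lam m n]_Z f (Z *m U) = \int[lam m n]_Z f Z)%E.
Proof.
move=> Uu mf f0.
have mU : meas (fun Z : 'M[C]_(m, n) => Z *m U).
  exact: measurable_fun_mulmx.
have mT k l : meas (fun X : 'M[C]_(k, l) => X^T).
  exact: measurable_fun_trmx.
rewrite integral_lebesgue_mxC_tr//; last exact: (measurableT_comp mf mU).
rewrite [RHS]integral_lebesgue_mxC_tr//.
rewrite -(@integral_lebesgue_mxC_unitaryl _ _ (U^T) (fun X => f X^T)).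
- by apply: eq_integral => X _; rewrite trmx_mul trmxK.
- by rewrite trmx_unitary.
- exact: (measurableT_comp mf (mT _ _)).
- by move=> X; exact: f0.
Qed.

(** The constant is the mass of the Gaussian of rate r^2 relative to pi^(mn): a factor r^-1 for each
    of the 2mn real coordinates. *)
Lemma integral_lebesgue_mxC_scale m n (r : R) (f : 'M[C]_(m, n) -> \bar R) :
  0 < r -> meas f -> (forall Z, 0 <= f Z)%E ->
  (\int[lam m n]_Z f (r%:C *: Z)%R = (r ^- (2 * (m * n)))%:E * \int[lam m n]_Z f Z)%E.
Proof.
move=> r0 mf f0.
have rC0 : r%:C != 0 by rewrite fmorph_eq0 gt_eqF.
rewrite (@integral_lebesgue_mxC_additive m n (GRing.scale r%:C) (GRing.scale (r%:C^-1)))//.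
- congr (_ * _)%E.
  rewrite (eq_integral (fun Z => (expR (- (r ^+ 2 * sqnorm Z)))%:E)); last first.
    move=> Z _; congr (expR (- _))%:E; rewrite /sqnorm mulr_sumr; apply: eq_bigr => i _.
    rewrite mulr_sumr; apply: eq_bigr => j _; rewrite mxE.
    case: (Z i j) => a b /=; rewrite !mul0r subr0 addr0 !exprMn mulrDr.
    by [].
  rewrite integral_gauss_mxC ?exprn_gt0// -EFinM; congr EFin.
  rewrite exprMn mulrA mulVf ?mul1r; last by rewrite expf_neq0// gt_eqF ?pi_gt0.
  by rewrite exprVn -exprM.
- by move=> X Y; rewrite scalerDr.
- by move=> X; rewrite scalerA divff// scale1r.
- exact: measurable_fun_scalemx.
Qed.

End haar.

(** * Positive definite Hermitian matrices *)

Section posdef.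
Variable R : realType.
Local Notation C := R[i].

Lemma conjC_real (r : R) : Num.conj (r%:C : C) = r%:C.
Proof. exact: conjc_real. Qed.

Lemma adjmxM m n p (A : 'M[C]_(m, n)) (B : 'M[C]_(n, p)) :
  (A *m B) ^t* = B ^t* *m A ^t*.
Proof. by rewrite trmx_mul map_mxM. Qed.

Lemma adjmxD m n (A B : 'M[C]_(m, n)) : (A + B) ^t* = A ^t* + B ^t*.
Proof. by rewrite linearD/= map_mxD. Qed.

Lemma adjmxN m n (A : 'M[C]_(m, n)) : (- A) ^t* = - A ^t*.
Proof. by rewrite linearN/= map_mxN. Qed.

Lemma adjmxZ m n (r : R) (A : 'M[C]_(m, n)) : (r%:C *: A) ^t* = r%:C *: A ^t*.
Proof.
by apply/matrixP => i j; rewrite !mxE rmorphM/= conjC_real.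
Qed.

Lemma adjmx1 n : (1%:M : 'M[C]_n) ^t* = 1%:M.
Proof. by rewrite trmx1 map_mx1. Qed.

Lemma adjmx0 m n : (0 : 'M[C]_(m, n)) ^t* = 0.
Proof. by rewrite trmx0 map_mx0. Qed.

Lemma adj_realmx1 n (t : R) : ((t%:C)%:M : 'M[C]_n) ^t* = (t%:C)%:M.
Proof. by rewrite tr_scalar_mx map_scalar_mx/= conjC_real. Qed.

Lemma adj_block_mx m1 m2 n1 n2 (A : 'M[C]_(m1, n1)) (B : 'M[C]_(m1, n2))
    (D : 'M[C]_(m2, n1)) (E : 'M[C]_(m2, n2)) :
  (block_mx A B D E) ^t* = block_mx (A ^t* ) (D ^t* ) (B ^t* ) (E ^t* ).
Proof. by rewrite tr_block_mx map_block_mx. Qed.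

Lemma adj_row_mx m n1 n2 (A : 'M[C]_(m, n1)) (B : 'M[C]_(m, n2)) :
  (row_mx A B) ^t* = col_mx (A ^t* ) (B ^t* ).
Proof. by rewrite tr_row_mx map_col_mx. Qed.

Lemma adj_col_mx m1 m2 n (A : 'M[C]_(m1, n)) (B : 'M[C]_(m2, n)) :
  (col_mx A B) ^t* = row_mx (A ^t* ) (B ^t* ).
Proof. by rewrite tr_col_mx map_row_mx. Qed.

Lemma adj_unitmx n (A : 'M[C]_n) : (A ^t* \in unitmx) = (A \in unitmx).
Proof. by rewrite map_unitmx unitmx_tr. Qed.

Lemma adj_invmx n (A : 'M[C]_n) : (invmx A) ^t* = invmx (A ^t* ).
Proof. by rewrite trmx_inv map_invmx. Qed.

Lemma det_adjmx n (A : 'M[C]_n) : \det (A ^t* ) = (\det A)^*%R.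
Proof. by rewrite det_map_mx det_tr. Qed.

Lemma hermE n (A : 'M[C]_n) : A \is hermsymmx <-> A ^t* = A.
Proof.
split=> [/is_hermitianmxP|AA]; first by rewrite expr0 scale1r.
by apply/is_hermitianmxP; rewrite expr0 scale1r AA.
Qed.

Lemma rank_adjmx m n (A : 'M[C]_(m, n)) : \rank (A ^t* ) = \rank A.
Proof. by rewrite mxrank_map mxrank_tr. Qed.

(* QR decomposition of A^*. *)
Lemma row_free_unitary k l (A : 'M[C]_(k, k + l)) : \rank A = k ->
  exists S : 'M[C]_k, exists U : 'M[C]_(k + l),
    [/\ S \in unitmx, U \is unitarymx & A = S *m usubmx U].
Proof.
move=> Ak; pose U := schmidt (col_mx A (0 : 'M[C]_(l, k + l))).
have AU : (A <= usubmx U)%MS.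
  apply/row_subP => i.
  have := row_schmidt_sub (col_mx A (0 : 'M[C]_(l, k + l))) (lshift l i).
  have -> : row (lshift l i) (col_mx A (0 : 'M[C]_(l, k + l))) = row i A.
    by apply/rowP => j; rewrite mxE col_mxEu mxE.
  move=> /submx_trans; apply; apply/sumsmx_subP => j ji.
  have jk : (j < k)%N by apply: leq_ltn_trans ji _ => /=; exact: ltn_ord.
  rewrite genmxE (_ : row j _ = row (Ordinal jk) (usubmx U)) ?row_sub//.
  by apply/rowP => j'; rewrite !mxE; congr (schmidt _ _ _); apply: val_inj.
have /submxP[S AE] := AU.
exists S, U; split => //; last exact: schmidt_unitarymx.
rewrite -row_free_unit -row_leq_rank -{1}Ak AE; exact: mxrankM_maxl.
Qed.

Definition posdef n (A : 'M[C]_n) : Prop := A ^t* = A /\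
  forall v : 'cV[C]_n, v != 0 -> 0 < (v ^t* *m A *m v) 0 0.

Lemma posdef_psd n (A : 'M[C]_n) : posdef A -> psdmx A.
Proof.
move=> [Ah A0]; split; first exact/hermE.
move=> v; have [->|v0] := eqVneq v 0; first by rewrite mulmx0 mxE.
exact/ltW/A0.
Qed.

Lemma posdef_congr n (T A : 'M[C]_n) : T \in unitmx ->
  posdef (T ^t* *m A *m T) <-> posdef A.
Proof.
move=> Tu.
have key (S B : 'M[C]_n) : S \in unitmx -> posdef B -> posdef (S ^t* *m B *m S).
  move=> Su [Bh B0]; split; first by rewrite !adjmxM trmxCK Bh mulmxA.
  move=> v v0; rewrite (_ : _ *m v = (S *m v) ^t* *m B *m (S *m v)); last first.
    by rewrite adjmxM !mulmxA.
  apply: B0; apply: contra_neq v0 => Sv0.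
  by rewrite -(mulKmx Su v) Sv0 mulmx0.
split=> [pA|]; last exact: key.
have := key (invmx T) _ _ pA; rewrite unitmx_inv => /(_ Tu).
rewrite !mulmxA -adjmxM (mulmxV Tu) adjmx1 mul1mx -mulmxA.
by rewrite (mulmxV Tu) mulmx1.
Qed.

Lemma psd_congr m n (T : 'M[C]_(m, n)) (A : 'M[C]_m) :
  psdmx A -> psdmx (T ^t* *m A *m T).
Proof.
move=> [/hermE Ah A0]; split; first by apply/hermE; rewrite !adjmxM trmxCK Ah mulmxA.
move=> v; rewrite (_ : _ *m v = (T *m v) ^t* *m A *m (T *m v)) ?A0//.
by rewrite adjmxM !mulmxA.
Qed.

Lemma cVnorm_ge0 n (v : 'cV[C]_n) : 0 <= (v ^t* *m v) 0 0.
Proof.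
rewrite mxE; apply: sumr_ge0 => i _; rewrite !mxE mulrC; exact: mulcJ_ge0.
Qed.

Lemma cVnorm_gt0 n (v : 'cV[C]_n) : v != 0 -> 0 < (v ^t* *m v) 0 0.
Proof.
move=> v0; rewrite lt_neqAle cVnorm_ge0 andbT eq_sym; apply: contra_neq v0.
rewrite mxE => /eqP; rewrite psumr_eq0; last first.
  by move=> i _; rewrite !mxE mulrC; exact: mulcJ_ge0.
move=> /allP v0; apply/colP => i; rewrite mxE.
have := v0 i; rewrite mem_index_enum => /(_ isT)/=.
by rewrite !mxE mulf_eq0 conjc_eq0 orbb => /eqP.
Qed.

Lemma posdef1 n : posdef (1%:M : 'M[C]_n).
Proof.
split; first exact: adjmx1.
by move=> v v0; rewrite mulmx1; exact: cVnorm_gt0.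
Qed.

Lemma posdef_gram n (T : 'M[C]_n) : T \in unitmx -> posdef (T ^t* *m T).
Proof.
move=> Tu; rewrite -[X in X *m T]mulmx1; apply/posdef_congr => //.
exact: posdef1.
Qed.

Lemma psdmx_gram m n (X : 'M[C]_(m, n)) : psdmx (X ^t* *m X).
Proof.
rewrite -[X in X *m _]mulmx1; apply: psd_congr; exact/posdef_psd/posdef1.
Qed.

Lemma posdefDl n (A B : 'M[C]_n) : posdef A -> psdmx B -> posdef (A + B).
Proof.
move=> [Ah A0] [/hermE Bh B0]; split; first by rewrite adjmxD Ah Bh.
by move=> v v0; rewrite mulmxDr mulmxDl mxE ltr_wpDr// A0.
Qed.

(** Schur complement of the pivot t in the bordered Hermitian matrix [hblock t w D]. *)
Definition schur n (t : R) (w : 'rV[C]_n) (D : 'M[C]_n) : 'M[C]_n :=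
  D - (t^-1)%:C *: (w ^t* *m w).

Definition hblock n (t : R) (w : 'rV[C]_n) (D : 'M[C]_n) : 'M[C]_(1 + n) :=
  block_mx (t%:C)%:M w (w ^t* ) D.

(** Unipotent factor whose congruence clears the border of [hblock t w D]. *)
Definition ushear n (t : R) (w : 'rV[C]_n) : 'M[C]_(1 + n) :=
  block_mx 1%:M ((t^-1)%:C *: w) 0 1%:M.

Lemma det_ushear n t (w : 'rV[C]_n) : \det (ushear t w) = 1.
Proof. by rewrite det_ublock !det1 mulr1. Qed.

Lemma ushear_unit n t (w : 'rV[C]_n) : ushear t w \in unitmx.
Proof. by rewrite unitmxE det_ushear unitr1. Qed.

(** One step of the LDL factorisation, from which determinants and definiteness of bordered matrices
    are read off. *)
Lemma hblock_ldl n t (w : 'rV[C]_n) D : t != 0 -> hblock t w D =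
  (ushear t w) ^t* *m block_mx (t%:C)%:M 0 0 (schur t w D) *m ushear t w.
Proof.
move=> t0; rewrite adj_block_mx !adjmx1 adjmx0 !mulmx_block.
have tt : t%:C * (t^-1)%:C = 1 by rewrite -rmorphM divff.
rewrite !mul1mx !mulmx1 !mul0mx !mulmx0 !addr0 !add0r adjmxZ.
rewrite mul_scalar_mx mul_mx_scalar !scalerA tt !scale1r.
by rewrite -scalemxAr /schur addrC subrK.
Qed.

Lemma det_hblock n t (w : 'rV[C]_n) D : t != 0 ->
  \det (hblock t w D) = t%:C * \det (schur t w D).
Proof.
move=> t0; rewrite hblock_ldl// !det_mulmx det_adjmx det_ushear rmorph1 mul1r mulr1.
by rewrite det_ublock det_scalar expr1.
Qed.

Lemma herm_hblock n (W : 'M[C]_(1 + n)) : W ^t* = W ->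
  W = hblock (complex.Re (W 0 0)) (ursubmx W) (drsubmx W).
Proof.
move=> Wh; rewrite -[LHS]submxK /hblock.
congr block_mx.
- apply/matrixP => i j; rewrite !ord1 !mxE/= lshift0.
  have : (W ^t* ) 0 0 = W 0 0 by rewrite Wh.
  rewrite !mxE/=; case: (W 0 0) => a b [] /eqP.
  by rewrite -subr_eq0 -opprD oppr_eq0 -mulr2n mulrn_eq0/= => /eqP ->; rewrite mulr1n.
- by apply/matrixP => i j; rewrite -{1}Wh !mxE.
Qed.

Lemma schur_adj n t (w : 'rV[C]_n) D : (schur t w D) ^t* = schur t w (D ^t* ).
Proof. by rewrite /schur adjmxD adjmxN adjmxZ adjmxM trmxCK. Qed.

Lemma hblock_adj n t (w : 'rV[C]_n) D : (hblock t w D) ^t* = hblock t w (D ^t* ).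
Proof. by rewrite adj_block_mx adj_realmx1 trmxCK. Qed.

(** Positivity of t comes from testing on the first basis vector; congruence by the shear then
    reduces both directions to a block diagonal matrix. *)
Lemma posdef_hblock n t (w : 'rV[C]_n) D :
  posdef (hblock t w D) <-> 0 < t /\ posdef (schur t w D).
Proof.
have diagE a (S : 'M[C]_n) (x : 'cV[C]_1) (u : 'cV[C]_n) :
    ((col_mx x u) ^t* *m block_mx (a%:C)%:M 0 0 S *m col_mx x u) 0 0 =
    a%:C * (x ^t* *m x) 0 0 + (u ^t* *m S *m u) 0 0.
  rewrite adj_col_mx mul_row_block !mulmx0 addr0 add0r mul_row_col mxE.
  by rewrite mul_mx_scalar -scalemxAl [in LHS]mxE.
split=> [pW|[t0 [Sh S0]]].
- have t0 : 0 < t.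
    have [_ /(_ (col_mx 1%:M 0))] := pW.
    have -> : ((col_mx 1%:M 0) ^t* *m hblock t w D *m col_mx 1%:M 0) 0 0 = t%:C :> C.
      rewrite adj_col_mx adjmx1 adjmx0 mul_row_block !mul0mx !mul1mx !addr0.
      by rewrite mul_row_col mulmx0 mulmx1 addr0 mxE.
    rewrite ltcR; apply.
    rewrite col_mx_eq0 negb_and; apply/orP; left; apply/eqP => /matrixP/(_ 0 0).
    by rewrite !mxE/= => /eqP; rewrite oner_eq0.
  move: pW; rewrite hblock_ldl ?gt_eqF// => /(posdef_congr _ (ushear_unit _ _)).
  move=> [Bh B0]; split=> //; split.
    by move: Bh; rewrite adj_block_mx => /eq_block_mx[].
  move=> v v0; have := B0 (col_mx 0 v).
  rewrite diagE mulmx0 mxE mulr0 add0r; apply.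
  by rewrite col_mx_eq0 negb_and v0 orbT.
- rewrite hblock_ldl ?gt_eqF//; apply/posdef_congr; first exact: ushear_unit.
  split; first by rewrite adj_block_mx !adjmx0 adj_realmx1 Sh.
  move=> v; rewrite -[v]vsubmxK diagE col_mx_eq0 negb_and.
  have xge0 : 0 <= t%:C * ((usubmx v) ^t* *m usubmx v) 0 0.
    by rewrite mulr_ge0 ?cVnorm_ge0// ler0c ltW.
  have [u0|u0 _] := eqVneq (dsubmx v) 0.
    rewrite orbF => x0; rewrite u0 mulmx0 [X in _ + X]mxE addr0 mulr_gt0//.
      by rewrite ltcR.
    exact: cVnorm_gt0.
  by rewrite ltr_wpDl// S0.
Qed.

(** Upper triangular T with T^H T = A when A is positive definite. It is given by an explicit
    recursion on pivots rather than by choice, so that measurability in A follows by the same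
    recursion. *)
Fixpoint cholesky n : 'M[C]_n -> 'M[C]_n :=
  match n with
  | 0 => id
  | n'.+1 => fun A : 'M[C]_(1 + n') =>
    let t := complex.Re (A 0 0) in let w := ursubmx A in
    block_mx ((Num.sqrt t)%:C)%:M (((Num.sqrt t)^-1)%:C *: w)
      0 (cholesky (schur t w (drsubmx A)))
  end.

Lemma choleskyP n (A : 'M[C]_n) : posdef A ->
  cholesky A \in unitmx /\ (cholesky A) ^t* *m cholesky A = A.
Proof.
elim: n A => [A _|n ih A pA].
  by rewrite /= unitmxE det_mx00 unitr1; split=> //; apply/matrixP => -[].
have Ah := proj1 pA; have AE := @herm_hblock n A Ah.
have := pA; rewrite {1}AE => /posdef_hblock; set t := complex.Re _.
set w := ursubmx _; set D := drsubmx _ => -[t0 pS].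
have [Tu TT] := ih _ pS; have s0 : Num.sqrt t != 0 by rewrite gt_eqF// sqrtr_gt0.
have ss : Num.sqrt t * (Num.sqrt t)^-1 = 1 by rewrite divff.
pose T : 'M[C]_(1 + n) := block_mx ((Num.sqrt t)%:C)%:M
  (((Num.sqrt t)^-1)%:C *: w) 0 (cholesky (schur t w D)).
suff : T \in unitmx /\ T ^t* *m T = (A : 'M[C]_(1 + n)) by [].
split.
  rewrite unitmxE det_ublock det_scalar expr1 unitrM -unitmxE Tu andbT unitfE.
  by rewrite fmorph_eq0.
rewrite [RHS]AE adj_block_mx adj_realmx1 adjmx0 mulmx_block adjmxZ.
rewrite !mulmx0 !mul0mx !addr0 -scalar_mxM -rmorphM -expr2 sqr_sqrtr ?ltW//.
rewrite mul_scalar_mx mul_mx_scalar !scalerA -!rmorphM ss scale1r.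
rewrite -scalemxAl -scalemxAr scalerA -rmorphM -expr2 exprVn sqr_sqrtr ?ltW//.
by rewrite TT /schur addrC subrK scale1r.
Qed.

Lemma posdef_factor n (A : 'M[C]_n) : posdef A ->
  exists2 T : 'M[C]_n, T \in unitmx & A = T ^t* *m T.
Proof. by move=> /choleskyP[Tu TT]; exists (cholesky A). Qed.

Lemma det_gram n (T : 'M[C]_n) : \det (T ^t* *m T) = `|\det T| ^+ 2.
Proof. by rewrite det_mulmx det_adjmx mulrC normCK. Qed.

Lemma posdef_unit n (A : 'M[C]_n) : posdef A -> A \in unitmx.
Proof.
by move=> /posdef_factor[T Tu ->]; rewrite unitmx_mul adj_unitmx Tu.
Qed.

Lemma posdef_det_gt0 n (A : 'M[C]_n) : posdef A -> 0 < \det A.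
Proof.
move=> /posdef_factor[T Tu ->]; rewrite det_gram exprn_gt0// normr_gt0.
by rewrite -unitfE -unitmxE.
Qed.

Lemma gt0_rdet n (A : 'M[C]_n) : 0 < \det A -> 0 < rdet A.
Proof. by rewrite /rdet ltcE => /andP[]. Qed.

Lemma ge0_detE n (A : 'M[C]_n) : 0 <= \det A -> \det A = (rdet A)%:C.
Proof. by rewrite /rdet => /ger0_Im; case: (\det A) => a b /= ->. Qed.

Lemma posdef_rdet_gt0 n (A : 'M[C]_n) : posdef A -> 0 < rdet A.
Proof. by move=> /posdef_det_gt0/gt0_rdet. Qed.

Lemma posdef_detE n (A : 'M[C]_n) : posdef A -> \det A = (rdet A)%:C.
Proof. by move=> /posdef_det_gt0/ltW/ge0_detE. Qed.

(* With a null vector v of the form and z = Av, positivity at v - s z for all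
   s > 0 forces z = 0. *)
Lemma psd_unit_posdef n (A : 'M[C]_n) : psdmx A -> A \in unitmx -> posdef A.
Proof.
move=> [/hermE Ah A0] Au; split=> // v v0; rewrite lt_neqAle A0 andbT eq_sym.
apply/negP => /eqP vAv; move/negP: v0; apply; apply/eqP.
pose z := A *m v.
have absurd_bound (a b : R) : 0 < a -> 0 <= b ->
    (forall s, 0 < s -> 2 * a <= s * b) -> false.
  (* s = 1 gives b > 0, then s = a / b gives 2 a <= a. *)
  move=> a0 b0 key; have := key 1 ltr01; rewrite mul1r => ab.
  have {}b0 : 0 < b by lra.
  by have := key (a / b); rewrite divr_gt0// divfK ?gt_eqF// => /(_ isT); lra.
suff z0 : z = 0 by rewrite -(mulKmx Au v) -/z z0 mulmx0.
apply/eqP/contraT => /cVnorm_gt0; set N := (_ 0 0) => N0.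
pose Q := (z ^t* *m A *m z) 0 0.
have Q0 : 0 <= Q by exact: A0.
have NE : N = (complex.Re N)%:C by rewrite (RRe_real (gtr0_real N0)).
have QE : Q = (complex.Re Q)%:C by rewrite (RRe_real (ger0_real Q0)).
have {N0}a0 : 0 < complex.Re N by move: N0; rewrite NE ltcR.
have {Q0}b0 : 0 <= complex.Re Q by move: Q0; rewrite QE lecR.
have key (s : R) : 0 < s -> 2 * complex.Re N <= s * complex.Re Q.
  move=> s0; have := A0 (v - s%:C *: z).
  (* As v^H A v = 0 and z = A v, the form at v - s z is s (s Q - 2 N); dividing by s gives the
     bound. *)
  have -> : ((v - s%:C *: z) ^t* *m A *m (v - s%:C *: z)) 0 0 =
      s%:C * (s%:C * Q - 2 * N).
    have e1 : v ^t* *m A *m v = 0 by apply/matrixP => i j; rewrite !ord1 vAv mxE.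
    have e2 : v ^t* *m A = z ^t* by rewrite adjmxM Ah.
    have e3 : z ^t* *m A *m v = z ^t* *m z by rewrite -mulmxA.
    rewrite adjmxD adjmxN adjmxZ !mulmxBl !mulmxBr e1 -!scalemxAl -!scalemxAr.
    rewrite e2 e3 sub0r; rewrite -/z.
    rewrite /N /Q; move: (z ^t* *m z) (z ^t* *m A *m z) => X Y; rewrite !mxE.
    by ring.
  rewrite NE QE -(rmorph_nat (real_complex R)) -!rmorphM -rmorphB -rmorphM lecR.
  by rewrite (pmulr_rge0 _ s0) subr_ge0.
exact: (absurd_bound _ _ a0 b0 key).
Qed.

End posdef.

Section posdef_theory.
Variable R : realType.
Local Notation C := R[i].

Lemma psd_det_ge0 n (A : 'M[C]_n) : psdmx A -> 0 <= \det A.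
Proof.
move=> A0; have [Au|] := boolP (A \in unitmx).
  exact: (ltW (posdef_det_gt0 (psd_unit_posdef A0 Au))).
by rewrite unitmxE unitfE negbK => /eqP ->.
Qed.

Lemma psd_rdet_ge0 n (A : 'M[C]_n) : psdmx A -> 0 <= rdet A.
Proof. by move=> /psd_det_ge0 /[dup] /ge0_detE -> ; rewrite lecR. Qed.

Lemma posdef_inv n (A : 'M[C]_n) : posdef A -> posdef (invmx A).
Proof.
move=> pA; have Au := posdef_unit pA; have [Ah _] := pA.
have -> : invmx A = (invmx A) ^t* *m A *m invmx A.
  by rewrite adj_invmx Ah (mulVmx Au) mul1mx.
by apply/posdef_congr => //; rewrite unitmx_inv.
Qed.

Lemma det_gramE n (T : 'M[C]_n) : \det (T ^t* *m T) = (rdet (T ^t* *m T))%:C.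
Proof. by apply: ge0_detE; apply: psd_det_ge0; exact: psdmx_gram. Qed.

Lemma rdet_congr n (T A : 'M[C]_n) :
  rdet (T ^t* *m A *m T) = rdet (T ^t* *m T) * rdet A.
Proof.
have -> : rdet (T ^t* *m A *m T) = complex.Re ((rdet (T ^t* *m T))%:C * \det A).
  by rewrite -det_gramE /rdet !det_mulmx mulrAC.
by rewrite [in RHS]/rdet; case: (\det A) => a b /=; rewrite mul0r subr0.
Qed.

Lemma rdet_inv n (A : 'M[C]_n) : posdef A -> rdet (invmx A) = (rdet A)^-1.
Proof.
by move=> pA; rewrite /rdet det_inv (posdef_detE pA) -fmorphV.
Qed.

(** Completing the square with w = J^-1 v: the form of K - J^-1 at v is the sum of the form of K^-1
    at K v - w and the form of J - K^-1 at w. Exchanging J and K gives the converse implication. *)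
Lemma psd_sub_inv n (J K : 'M[C]_n) : posdef J -> posdef K ->
  psdmx (J - invmx K) -> psdmx (K - invmx J).
Proof.
move=> pJ pK [_ JK]; have Ju := posdef_unit pJ; have Ku := posdef_unit pK.
have [Jh _] := pJ; have [Kh _] := pK.
have Jih : (invmx J) ^t* = invmx J by rewrite adj_invmx Jh.
have Kih : (invmx K) ^t* = invmx K by rewrite adj_invmx Kh.
split; first by apply/hermE; rewrite adjmxD adjmxN Kh Jih.
move=> v; pose w := invmx J *m v.
have -> : v ^t* *m (K - invmx J) *m v =
    (K *m v - w) ^t* *m invmx K *m (K *m v - w) + w ^t* *m (J - invmx K) *m w.
  have wE : w ^t* = v ^t* *m invmx J by rewrite adjmxM Jih.
  have e1 : (K *m v - w) ^t* *m invmx K = v ^t* - w ^t* *m invmx K.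
    rewrite adjmxD adjmxN adjmxM Kh mulmxBl; congr (_ - _).
    by rewrite -mulmxA (mulmxV Ku) mulmx1.
  have e2 : w ^t* *m (J - invmx K) *m w = v ^t* *m w - w ^t* *m invmx K *m w.
    have wJ : w ^t* *m J = v ^t* by rewrite wE -mulmxA (mulVmx Ju) mulmx1.
    by rewrite mulmxBr wJ mulmxBl.
  have e3 : (v ^t* - w ^t* *m invmx K) *m (K *m v - w) =
      v ^t* *m K *m v - v ^t* *m w - (w ^t* *m v - w ^t* *m invmx K *m w).
    rewrite mulmxBl (mulmxBr (v ^t* )) (mulmxBr (w ^t* *m _)); congr (_ - _ - (_ - _)).
      by rewrite mulmxA.
    by rewrite -mulmxA (mulKmx Ku).
  have e4 : v ^t* *m (K - invmx J) *m v = v ^t* *m K *m v - w ^t* *m v.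
    by rewrite mulmxBr mulmxBl wE.
  rewrite e1 e2 e3 e4.
  move: (v ^t* *m K *m v) (v ^t* *m w) (w ^t* *m v) (w ^t* *m invmx K *m w).
  by move=> a b c d; apply/matrixP => i j; rewrite !mxE; ring.
rewrite mxE addr_ge0 ?JK//.
by have [_] := posdef_psd (posdef_inv pK); apply.
Qed.

Lemma posdef_realmx n (r : R) : 0 < r -> posdef ((r%:C)%:M : 'M[C]_n).
Proof.
move=> r0; split; first exact: adj_realmx1.
move=> v v0; rewrite mul_mx_scalar -scalemxAl mxE mulr_gt0 ?ltcR//.
exact: cVnorm_gt0.
Qed.

(** Trades a condition on all vectors for countably many conditions on pivots, which makes the
    supports of the densities measurable. The converse lets k tend to infinity. *)
Lemma psd_posdefP n (A : 'M[C]_n) : psdmx A <->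
  forall k : nat, posdef (A + ((k.+1%:R^-1 : R)%:C)%:M).
Proof.
split=> [A0 k|H].
  rewrite addrC; apply: posdefDl => //; apply: posdef_realmx.
  by rewrite invr_gt0 ltr0n.
split.
  apply/hermE; have [+ _] := H 0%N; rewrite adjmxD adj_realmx1.
  by move/addIr.
move=> v.
have key k : 0 <= (v ^t* *m A *m v) 0 0 + (k.+1%:R^-1 : R)%:C * (v ^t* *m v) 0 0.
  have [_] := posdef_psd (H k); move=> /(_ v).
  by rewrite mulmxDr mulmxDl mxE mul_mx_scalar -scalemxAl [X in _ + X]mxE.
have N0 := cVnorm_ge0 v.
have NE : (v ^t* *m v) 0 0 = (complex.Re ((v ^t* *m v) 0 0))%:C.
  by rewrite (RRe_real (ger0_real N0)).
move: N0 key; rewrite NE; move: (complex.Re _) => N; case: (_ 0 0) => a b.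
rewrite lecR => N0 key.
have {}key k : 0 <= a + k.+1%:R^-1 * N /\ b = 0.
  by move: (key k); rewrite -rmorphM lecE/= addr0 => /andP[/eqP -> ->].
have b0 := (key 0%N).2; rewrite b0 lecR leNgt; apply/negP => a0.
have [k Hk] : exists k : nat, N / - a < k%:R.
  by exists (Num.bound (N / - a)); rewrite archi_boundP// divr_ge0// oppr_ge0 ltW.
have := (key k).1; rewrite leNgt => /negP; apply.
rewrite -ltrBrDl sub0r mulrC ltr_pdivrMr ?ltr0n//.
move: Hk; rewrite ltr_pdivrMr ?oppr_gt0// => /lt_le_trans; apply.
by rewrite mulrC ler_pM2l ?oppr_gt0// ler_nat.
Qed.

(** All pivots met in successive Schur complements are positive; with Hermitian symmetry this
    decides [posdef] by finitely many measurable tests. *)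
Fixpoint posdef_rec n : 'M[C]_n -> bool :=
  match n with
  | 0 => fun=> true
  | n'.+1 => fun A : 'M[C]_(1 + n') =>
    let t := complex.Re (A 0 0) in
    (0 < t) && posdef_rec (schur t (ursubmx A) (drsubmx A))
  end.

Definition posdefb n (A : 'M[C]_n) : bool := (A ^t* == A) && posdef_rec A.

Lemma posdefbP n (A : 'M[C]_n) : reflect (posdef A) (posdefb A).
Proof.
apply: (iffP andP) => [[/eqP Ah]|pA].
- elim: n A Ah => [A Ah _|n ih A Ah /= /andP[t0 pS]].
    by split=> // v; rewrite (_ : v = 0) ?eqxx//; apply/matrixP => -[].
  rewrite (@herm_hblock R n A Ah); apply/posdef_hblock; split=> //.
  apply: ih => //; rewrite schur_adj; congr schur.
  by have := @herm_hblock R n A Ah; rewrite -{1}Ah {1}(@herm_hblock R n A Ah)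
    hblock_adj => /eq_block_mx[_ _ _].
- split; first by apply/eqP; case: pA.
  elim: n A pA => [//|n ih A pA]; have [Ah _] := pA.
  move: pA; rewrite {1}(@herm_hblock R n A Ah) => /posdef_hblock[t0 pS].
  by rewrite /= t0/=; exact: ih.
Qed.

Lemma usubmx_unitary k l (U : 'M[C]_(k + l)) :
  U \is unitarymx -> usubmx U *m (usubmx U) ^t* = 1%:M.
Proof.
move=> /unitarymxP; rewrite -{1 2}[U]vsubmxK adj_col_mx mul_col_row.
by rewrite scalar_mx_block => /eq_block_mx[].
Qed.

(** X^H has full row rank, so X^H = S E with S invertible and E the first rows of a unitary matrix.
    As S S^H = T^H T, the matrix S^H T^-1 is unitary, and it corrects the first block. *)
Lemma gram_unitary k l (X : 'M[C]_(k + l, k)) (T : 'M[C]_k) :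
  T \in unitmx -> X ^t* *m X = T ^t* *m T ->
  exists2 W : 'M[C]_(k + l), W \is unitarymx & X = W *m col_mx T 0.
Proof.
move=> Tu XT.
have rX : \rank (X ^t* ) = k.
  apply/eqP; rewrite eqn_leq rank_leq_row/= rank_adjmx.
  have : \rank (X ^t* *m X) = k.
    by rewrite XT mxrank_unit// unitmx_mul adj_unitmx Tu.
  by move=> {1}<-; exact: mxrankM_maxr.
have [S [U [Su Uu XE]]] := row_free_unitary rX.
have VV := usubmx_unitary Uu.
have SS : S *m S ^t* = T ^t* *m T.
  have -> : S *m S ^t* = (S *m usubmx U) *m (S *m usubmx U) ^t*.
    by rewrite adjmxM mulmxA -(mulmxA S) VV mulmx1.
  by rewrite -XE trmxCK XT.
pose V := S ^t* *m invmx T.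
have Vu : V \is unitarymx.
  rewrite -trmxC_unitary; apply/unitarymxP; rewrite trmxCK adjmxM trmxCK adj_invmx.
  rewrite mulmxA -(mulmxA _ S) SS mulmxA mulVmx ?adj_unitmx// mul1mx.
  exact: mulmxV.
have Bu : block_mx V 0 0 (1%:M : 'M[C]_l) \is unitarymx.
  apply/unitarymxP; rewrite adj_block_mx !adjmx0 adjmx1 mulmx_block.
  rewrite !mulmx0 !mul0mx !addr0 add0r (unitarymxP Vu) mulmx1.
  by rewrite -scalar_mx_block.
exists (U ^t* *m block_mx V 0 0 1%:M).
  apply: mul_unitarymx Bu; by rewrite trmxC_unitary.
rewrite -mulmxA mul_block_col !mul0mx !mulmx0 !addr0 -(mulmxA _ (invmx T)).
rewrite (mulVmx Tu) mulmx1 -[X in X = _]trmxCK XE adjmxM.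
by rewrite -{2}[U]vsubmxK adj_col_mx mul_row_col mulmx0 addr0.
Qed.

Lemma gramC_row_free k l (Phi : 'M[C]_(k, k + l)) :
  Phi *m Phi ^t* \in unitmx -> \rank Phi = k.
Proof.
move=> PP; apply/eqP; rewrite eqn_leq rank_leq_row/= -{1}(mxrank_unit PP).
exact: mxrankM_maxl.
Qed.

(** Write Phi = S E with S invertible and E the first k rows of a unitary U; S cancels in the
    projection, which becomes E^H E. *)
Lemma row_proj_unitary k l (Phi : 'M[C]_(k, k + l)) :
  Phi *m Phi ^t* \in unitmx ->
  exists2 U : 'M[C]_(k + l), U \is unitarymx &
    forall p (X : 'M[C]_(k + l, p)), X ^t* *m row_proj Phi *m X =
      (usubmx (U *m X)) ^t* *m usubmx (U *m X).
Proof.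
move=> /gramC_row_free/row_free_unitary[S [U [Su Uu PE]]]; exists U => // p X.
have VV := usubmx_unitary Uu.
have PP : row_proj Phi = (usubmx U) ^t* *m usubmx U.
  have Sau : S ^t* \in unitmx by rewrite adj_unitmx.
  have e : Phi *m Phi ^t* = S *m S ^t*.
    by rewrite PE adjmxM mulmxA -(mulmxA S) VV mulmx1.
  have ei : invmx (S *m S ^t* ) = invmx (S ^t* ) *m invmx S.
    have SSu : S *m S ^t* \in unitmx by rewrite unitmx_mul Su Sau.
    have SS1 : S *m S ^t* *m (invmx (S ^t* ) *m invmx S) = 1%:M.
      by rewrite mulmxA -(mulmxA S) (mulmxV Sau) mulmx1 (mulmxV Su).
    by rewrite -(mulKmx SSu (invmx (S ^t* ) *m invmx S)) SS1 mulmx1.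
  rewrite /row_proj e ei PE adjmxM !mulmxA -(mulmxA _ (S ^t* )) (mulmxV Sau).
  by rewrite mulmx1 -(mulmxA _ (invmx S)) (mulVmx Su) mulmx1.
have UX : usubmx (U *m X) = usubmx U *m X.
  by rewrite -{1}[U]vsubmxK mul_col_mx col_mxKu.
by rewrite PP UX adjmxM !mulmxA.
Qed.

Lemma row_proj_unitaryr m n (Phi : 'M[C]_(m, n)) (U : 'M[C]_n) :
  U \is unitarymx -> row_proj (Phi *m U) = U ^t* *m row_proj Phi *m U.
Proof.
move=> Uu; rewrite /row_proj adjmxM !mulmxA -(mulmxA Phi U) (unitarymxP Uu).
by rewrite mulmx1.
Qed.

End posdef_theory.

(** * Measurability of the Cholesky factor and of the positive cones *)

Section posdef_measurability.
Context {R : realType} {d} {U : measurableType d}.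
Local Notation C := R[i].

Lemma measurable_fun_schur n (t : U -> R) (w : U -> 'rV[C]_n) (D : U -> 'M[C]_n) :
  meas t -> meas w -> meas D ->
  meas (fun u => schur (t u) (w u) (D u)).
Proof.
move=> mt mw mD; apply: measurable_fun_addmx => //.
apply: measurable_fun_oppmx; apply: measurable_fun_scalemx.
  by apply: measurable_funRC; exact: measurable_funV.
by apply: measurable_fun_mulmx => //; exact: measurable_fun_adjmx.
Qed.

Lemma measurable_fun_ursubmx n1 n2 m1 m2 (A : U -> 'M[C]_(m1 + m2, n1 + n2)) :
  meas A -> meas (fun u => ursubmx (A u)).
Proof.
by move=> mA; apply: measurable_fun_rsubmx; exact: measurable_fun_usubmx.
Qed.

Lemma measurable_fun_drsubmx n1 n2 m1 m2 (A : U -> 'M[C]_(m1 + m2, n1 + n2)) :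
  meas A -> meas (fun u => drsubmx (A u)).
Proof.
by move=> mA; apply: measurable_fun_rsubmx; exact: measurable_fun_dsubmx.
Qed.

Lemma measurable_fun_cholesky n (A : U -> 'M[C]_n) :
  meas A -> meas (fun u => cholesky (A u)).
Proof.
elim: n A => [//|n ih A mA].
have mt : meas (fun u => complex.Re (A u 0 0)).
  by apply: measurable_funRe; exact: measurable_fun_entry.
have ms : meas (fun u => Num.sqrt (complex.Re (A u 0 0))).
  have : meas (@Num.sqrt R).
    by apply: continuous_measurable_fun; exact: sqrt_continuous.
  by move=> /measurableT_comp; exact.
apply: (@measurable_fun_block_mx _ _ _ _ 1 n 1 n).
- by apply: measurable_fun_scalar_mx; exact: measurable_funRC.
- apply: measurable_fun_scalemx; last exact: measurable_fun_ursubmx.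
  by apply: measurable_funRC; exact: measurable_funV.
- exact: measurable_cst.
- apply: ih; apply: measurable_fun_schur => //; first exact: measurable_fun_ursubmx.
  exact: measurable_fun_drsubmx.
Qed.

Lemma measurable_fun_posdefb n (A : U -> 'M[C]_n) :
  meas A -> meas (fun u => posdefb (A u)).
Proof.
move=> mA; apply: measurable_and.
  by apply: measurable_fun_eqmx => //; exact: measurable_fun_adjmx.
elim: n A mA => [A mA|n ih A mA]; first exact: measurable_cst.
have mt : meas (fun u => complex.Re (A u 0 0)).
  by apply: measurable_funRe; exact: measurable_fun_entry.
apply: measurable_and; first by apply: measurable_fun_ltr => //; exact: measurable_cst.
apply: ih; apply: measurable_fun_schur => //; first exact: measurable_fun_ursubmx.
exact: measurable_fun_drsubmx.
Qed.

Lemma measurable_fun_psd n (A : U -> 'M[C]_n) :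
  meas A -> meas (fun u => `[< psdmx (A u) >]).
Proof.
move=> mA; apply: (@measurable_fun_bool _ _ _ _ true).
rewrite setTI (_ : _ @^-1` _ = \bigcap_k
    (fun u => posdefb (A u + ((k.+1%:R^-1 : R)%:C)%:M)) @^-1` [set true]).
  apply: bigcap_measurableType => k _; rewrite -[X in measurable X]setTI.
  apply: measurable_fun_posdefb => //; apply: measurable_fun_addmx => //.
apply/seteqP; split => u /=.
  by move=> /asboolP/psd_posdefP H k _; exact/posdefbP.
move=> H; apply/asboolP/psd_posdefP => k; exact/posdefbP/H.
Qed.

End posdef_measurability.

(** * Volume on Hermitian matrices *)

Section lebesgue_herm_theory.
Variable R : realType.
Local Notation mR := (measurableTypeR R).
Local Notation mu := (@lebesgue_measure R).
Local Notation C := R[i].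
Local Notation lamR m n := (@lebesgue_mx R m n).
Local Notation lam m n := (@lebesgue_mxC R m n).
Local Notation lamH p := (@lebesgue_herm R p).

Definition herm_coords p (V : 'M[C]_p) : 'M[mR]_p :=
  \matrix_(i, j) if (i <= j)%N then complex.Re (V i j) else complex.Im (V j i).

Lemma measurable_herm_coords p : meas (@herm_coords p).
Proof.
apply: measurable_fun_mx => i j; under eq_fun do rewrite mxE.
case: (leqP i j) => _; [apply: measurable_funRe|apply: measurable_funIm];
  exact: measurable_mx_coord.
Qed.

Lemma herm_mxK p : cancel (@herm_mx R p) (@herm_coords p).
Proof.
move=> X; apply/matrixP => i j; rewrite !mxE.
by case: (ltngtP i j) => //= /val_inj ->.
Qed.

Lemma herm_coordsK p (V : 'M[C]_p) : V ^t* = V -> herm_mx (herm_coords V) = V.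
Proof.
move=> Vh; apply/matrixP => i j; rewrite !mxE leqnn.
have Vij k l : V k l = (V l k)^*%R by rewrite -[in LHS]Vh !mxE.
case: (ltngtP i j) => [ij|ij|/val_inj ->].
- by case: (V i j).
- by rewrite (Vij i j); case: (V j i).
- apply/eqP; rewrite eq_complex/= eqxx/=.
  have := Vij j j; case: (V j j) => a b [] /eqP.
  by rewrite -subr_eq0 opprK -mulr2n mulrn_eq0/= eq_sym.
Qed.

Lemma herm_mxD p (X Y : 'M[mR]_p) : herm_mx (X + Y) = herm_mx X + herm_mx Y.
Proof.
apply/matrixP => i j; rewrite !mxE.
case: (ltngtP i j) => ij; apply/eqP; rewrite eq_complex/= ?addr0 ?opprD ?eqxx//.
Qed.

Let lebesgue_herm_sigma_finite p : sigma_finite setT (@lebesgue_herm R p).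
Proof.
apply: (pushforward_sigma_finite _ (@herm_mxK p) (@measurable_herm_coords p)).
exact: sigma_finiteT.
Qed.

HB.instance Definition _ p := Measure_isSigmaFinite.Build _ _ _
  (@lebesgue_herm R p) (@lebesgue_herm_sigma_finite p).

Lemma integral_lebesgue_herm p (f : 'M[C]_p -> \bar R) :
  meas f -> (forall V, 0 <= f V)%E ->
  (\int[lamH p]_V f V = \int[lamR p p]_X f (herm_mx X))%E.
Proof.
by move=> mf f0; rewrite ge0_integral_pushforward//=; exact: measurable_herm_mx.
Qed.

(** Adding a Hermitian matrix is a translation of the free coordinates. *)
Lemma integral_lebesgue_hermD p (A : 'M[C]_p) (f : 'M[C]_p -> \bar R) :
  A ^t* = A -> meas f -> (forall V, 0 <= f V)%E ->
  (\int[lamH p]_V f V = \int[lamH p]_V f (V + A)%R)%E.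
Proof.
move=> Ah mf f0.
have mD : meas (fun V : 'M[C]_p => V + A).
  exact: measurable_fun_addmx.
rewrite integral_lebesgue_herm//.
rewrite (integral_lebesgue_herm (f := fun V => f (V + A)))//; last first.
  exact: (measurableT_comp mf mD).
rewrite (@integral_lebesgue_mx_entrywise _ _ _
    (fun i j x => x + herm_coords A i j)); last 4 first.
- by move=> i j; apply: measurable_funD => //; exact: measurable_cst.
- by move=> i j B mB; exact: lebesgue_measureD.
- exact: (measurableT_comp mf (@measurable_herm_mx R p)).
- by move=> X; exact: f0.
apply: eq_integral => X _; congr f; rewrite -[in RHS](herm_coordsK Ah) -herm_mxD.
by congr herm_mx; apply/matrixP => i j; rewrite !mxE.
Qed.

Lemma integral_lebesgue_mx11 (f : mR -> \bar R) :
  meas f -> (forall x, 0 <= f x)%E ->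
  (\int[lamR 1 1]_X f (X 0%R 0%R) = \int[mu]_x f x)%E.
Proof.
move=> mf f0.
have mc : meas (fun x : mR => const_mx x : 'M[mR]_(1, 1)).
  apply: measurable_fun_mx => i j; under eq_fun do rewrite mxE.
  exact: measurable_id.
have mX : meas (fun X : 'M[mR]_(1, 1) => X 0 0).
  exact: measurable_mx_coord.
rewrite (ge0_integral_measure_eq (m2 := image_measure mu mc)).
  rewrite ge0_integral_image//; last exact: (measurableT_comp mf mX).
  by apply: eq_integral => x _; rewrite mxE.
apply: lebesgue_mx_unique => B mB; rewrite /= /image_measure /pushforward.
rewrite (_ : _ @^-1` _ = B 0 0) ?big_ord1//.
apply/seteqP; split => x /=; first by move=> /(_ 0 0); rewrite mxE.
by move=> Bx i j; rewrite !ord1 mxE.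
Qed.

Lemma herm_mx_block p (t : 'M[mR]_(1, 1)) (a : 'M[mR]_(1, p)) (b : 'M[mR]_(p, 1))
    (D : 'M[mR]_p) :
  @herm_mx R (1 + p) (col_mx (row_mx t a) (row_mx b D)) =
  hblock (t 0 0) (complex_mx (a, b^T)) (herm_mx D).
Proof.
apply/matrixP => i j; rewrite mxE.
case: (split_ordP i) => i' ->; case: (split_ordP j) => j' ->;
  rewrite ?block_mxEul ?block_mxEur ?block_mxEdl ?block_mxEdr.
- by rewrite !ord1 ltnn !mxE/= mulr1n.
- by rewrite /= !ord1 !mxE.
- by rewrite /= !ord1 !mxE.
- by rewrite /= !ltn_add2l [in RHS]mxE.
Qed.

(** In the coordinate matrix of V the first row holds t and the real parts of w, the rest of the
    first column the imaginary parts of w, and the remaining block the coordinates of D. *)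
Lemma integral_lebesgue_herm_hblock p (f : 'M[C]_(1 + p) -> \bar R) :
  meas f -> (forall V, 0 <= f V)%E ->
  (\int[lamH (1 + p)]_V f V =
   \int[mu]_t \int[lam 1 p]_w \int[lamH p]_D f (hblock t w D))%E.
Proof.
move=> mf f0.
have mh d (U : measurableType d) (t : U -> mR) (w : U -> 'rV[C]_p) (D : U -> 'M[C]_p) :
  meas t -> meas w -> meas D ->
  meas (fun u => f (hblock (t u) (w u) (D u))).
  move=> mt mw mD; apply: (measurableT_comp mf); apply: measurable_fun_block_mx => //.
    by apply: measurable_fun_scalar_mx; exact: measurable_funRC.
  exact: measurable_fun_adjmx.
rewrite integral_lebesgue_herm//.
have mfh := measurableT_comp mf (@measurable_herm_mx R (1 + p)).
rewrite integral_lebesgue_mx_col//.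
rewrite integral_lebesgue_mx_row; last 2 first.
- apply: measurable_integral_snd => //.
  by apply: (measurableT_comp mfh); exact: measurable_fun_col_mx.
- by move=> X; exact: integral_ge0.
have mX : meas (fun X : 'M[mR]_(1, 1) => X 0 0).
  exact: measurable_mx_coord.
have mF : meas
    (fun z : mR * 'rV[C]_p => \int[lamH p]_D f (hblock z.1 z.2 D))%E.
  apply: (@measurable_integral_snd _ _ _ _ _ _
    (fun (z : mR * 'rV[C]_p) D => f (hblock z.1 z.2 D))) => //.
  apply: mh; last exact: measurable_snd.
    exact: (measurableT_comp measurable_fst measurable_fst).
  exact: (measurableT_comp measurable_snd measurable_fst).
have F0 t w : (0 <= \int[lamH p]_D f (hblock t w D))%E by exact: integral_ge0.
rewrite -(@integral_lebesgue_mx11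
  (fun t => \int[lam 1 p]_w \int[lamH p]_D f (hblock t w D))%E); last 2 first.
- exact: (@measurable_integral_snd _ _ _ _ _ _
    (fun t w => \int[lamH p]_D f (hblock t w D))%E).
- by move=> t; exact: integral_ge0.
apply: eq_integral => t _.
have mFt : meas
    (fun w : 'rV[C]_p => \int[lamH p]_D f (hblock (t 0%R 0%R) w D))%E.
  apply: (@measurable_integral_snd _ _ _ _ _ _
    (fun (w : 'rV[C]_p) D => f (hblock (t 0%R 0%R) w D))) => //.
  by apply: mh; [exact: measurable_cst|exact: measurable_fst|exact: measurable_snd].
rewrite (@integral_lebesgue_mxC _ _ _
  (fun w => \int[lamH p]_D f (hblock (t 0%R 0%R) w D))%E) //.
apply: eq_integral => a _.
rewrite integral_lebesgue_mx_row; last 2 first.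
- by apply: (measurableT_comp mfh); apply: measurable_fun_col_mx.
- by move=> X; exact: f0.
rewrite integral_lebesgue_mx_tr; last 2 first.
- apply: (@measurable_integral_snd _ _ _ _ _ _ (fun b D =>
    f (@herm_mx R (1 + p) (col_mx (row_mx t a) (row_mx b D))))) => //.
  apply: (measurableT_comp mfh); apply: measurable_fun_col_mx => //.
  exact: measurable_fun_row_mx.
- by move=> X; exact: integral_ge0.
apply: eq_integral => b _.
rewrite integral_lebesgue_herm//; last first.
  by apply: mh; [exact: measurable_cst|exact: measurable_cst|exact: measurable_id].
by apply: eq_integral => D _; rewrite herm_mx_block trmxK.
Qed.

(* Both orders of integration of 1[det (V + t I) = 0] exp(-t^2): for fixed V
   only finitely many t contribute. *)
Lemma lebesgue_herm_det0 p : lamH p [set V | \det V = 0] = 0%E.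
Proof.
pose f (V : 'M[C]_p) : R := if \det V == 0 then 1 else 0.
have f0 V : 0 <= f V by rewrite /f; case: ifP.
have mf : meas f.
  apply: measurable_fun_ifT; [|exact: measurable_cst|exact: measurable_cst].
  apply: measurable_fun_eqC; last exact: measurable_cst.
  exact: measurable_fun_det.
have mD0 : measurable [set V : 'M[C]_p | \det V = 0].
  rewrite (_ : [set _ | _] = setT `&` f @^-1` [set 1]); first exact: mf.
  rewrite setTI; apply/seteqP; split => V /=; rewrite /f; first by move=> ->; rewrite eqxx.
  by case: eqP => // _ /eqP; rewrite eq_sym oner_eq0.
have -> : lamH p [set V | \det V = 0] = (\int[lamH p]_V (f V)%:E)%E.
  rewrite -[X in lamH p X]setIT -integral_indic//.
  apply: eq_integral => V _; rewrite indicE /f; congr EFin.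
  case: eqP => dV; first by rewrite mem_set.
  by rewrite memNset.
pose g (t : mR) : R := gauss_fun t.
have mg : meas g by exact: measurable_gauss_fun.
have g0 t : 0 <= g t by exact: gauss_fun_ge0.
have mVt : meas (fun z : mR * 'M[C]_p => z.2 + (z.1%:C)%:M).
  apply: measurable_fun_addmx; first exact: measurable_snd.
  by apply: measurable_fun_scalar_mx; apply: measurable_funRC; exact: measurable_fst.
have : (\int[mu]_t \int[lamH p]_V ((g t)%:E * (f (V + (t%:C)%:M))%:E) = 0)%E.
  rewrite integral_swap; last 2 first.
  - apply: emeasurable_funM; apply/measurable_EFinP.
      exact: (measurableT_comp mg measurable_fst).
    exact: (measurableT_comp mf mVt).
  - by move=> t V; rewrite mule_ge0// lee_fin.
  apply: integral0_eq => V _.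
  (* det (V + t I) is the value at t of a monic polynomial, so it vanishes for finitely many t
     only. *)
  pose q := char_poly (- V).
  have q0 : q != 0 by rewrite monic_neq0// char_poly_monic.
  have [rs qE] := closed_field_poly_normal q.
  have detq t : \det (V + (t%:C)%:M) = q.[t%:C].
    rewrite /q /char_poly -horner_evalE -det_map_mx; congr (\det _).
    apply/matrixP => i j; rewrite !mxE/= horner_evalE !hornerE /= hornerMn hornerX.
    by rewrite opprK addrC.
  have neg0 : mu [set t | \det (V + (t%:C)%:M) = 0] = 0%E.
    apply: countable_lebesgue_measure0; apply: finite_set_countable.
    apply: (@sub_finite_set _ _ [set complex.Re r | r in [set` rs]]); last first.
      by apply: finite_image; exact: finite_seq.
    move=> t /=; rewrite detq qE hornerZ => /eqP.
    rewrite mulf_eq0 lead_coef_eq0 (negbTE q0)/= -rootE root_prod_XsubC => trs.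
    by exists t%:C.
  apply/eqP; rewrite eq_le integral_ge0 ?andbT; last first.
    by move=> t _; rewrite mule_ge0// lee_fin.
  have mft : meas (fun t : mR => f (V + (t%:C)%:M)).
    apply: (measurableT_comp mf); apply: measurable_fun_addmx => //.
    by apply: measurable_fun_scalar_mx; apply: measurable_funRC; exact: measurable_id.
  have mN : measurable [set t : mR | \det (V + (t%:C)%:M) = 0].
    rewrite (_ : [set _ | _] =
        setT `&` (fun t : mR => f (V + (t%:C)%:M)) @^-1` [set 1]); first exact: mft.
    rewrite setTI; apply/seteqP; split => t /=; rewrite /f; first by move=> ->; rewrite eqxx.
    by case: eqP => // _ /eqP; rewrite eq_sym oner_eq0.
  apply: (@le_trans _ _ (\int[mu]_t (\1_[set t : mR | \det (V + (t%:C)%:M) = 0] t)%:E)%E).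
    apply: ge0_le_integral => //.
    - by move=> t _; rewrite mule_ge0// lee_fin.
    - by apply: emeasurable_funM; exact/measurable_EFinP.
    - by apply/measurable_EFinP; exact: measurable_indic.
    - move=> t _; rewrite -EFinM lee_fin indicE /f; case: eqP => dV.
        by rewrite mem_set// mulr1; exact: gauss_fun_le1.
      by rewrite mulr0.
  rewrite integral_indic// setIT le_eqVlt; apply/orP; left; apply/eqP; exact: neg0.
(* By translation invariance the V-integral does not depend on t, so the double integral is the
   Gaussian integral times the measure sought. *)
have intV (t : mR) : (\int[lamH p]_V ((g t)%:E * (f (V + (t%:C)%:M))%:E) =
    (g t)%:E * \int[lamH p]_V (f V)%:E)%E.
  have mfE : meas (fun V => (f V)%:E) by exact/measurable_EFinP.
  have th : ((t%:C)%:M : 'M[C]_p) ^t* = (t%:C)%:M by exact: adj_realmx1.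
  have mD : meas (fun V : 'M[C]_p => V + (t%:C)%:M).
    exact: measurable_fun_addmx.
  have mfD : meas (fun V : 'M[C]_p => (f (V + (t%:C)%:M))%:E).
    exact: (measurableT_comp mfE mD).
  rewrite ge0_integralZl; [|exact: measurableT|exact: mfD|
    by move=> V _; rewrite lee_fin|by rewrite lee_fin].
  by rewrite [in RHS](@integral_lebesgue_hermD _ _ (fun V => (f V)%:E) th).
under eq_integral => t _ do rewrite intV.
rewrite ge0_integralZr//; last 3 first.
- exact/measurable_EFinP.
- by move=> t _; rewrite lee_fin.
- by apply: integral_ge0 => V _; rewrite lee_fin.
rewrite integralT_gauss => /eqP; rewrite mule_eq0 => /orP[|/eqP//].
by rewrite eqe sqrtr_eq0 leNgt pi_gt0.
Qed.

End lebesgue_herm_theory.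

(** Serves to discard zero columns, singular Gram matrices and singular Hermitian matrices. *)
Lemma ge0_integral_eq_off d (T : measurableType d) (R : realType)
    (mu : {measure set T -> \bar R}) (N : set T) (f g : T -> \bar R) :
  measurable N -> mu N = 0%E ->
  meas f -> meas g ->
  (forall x, 0 <= f x)%E -> (forall x, 0 <= g x)%E ->
  (forall x, ~ N x -> f x = g x) -> (\int[mu]_x f x = \int[mu]_x g x)%E.
Proof.
move=> mN N0 mf mg f0 g0 fg; apply: ge0_ae_eq_integral => //.
exists N; split => // x /= /not_implyP[_ fgx].
by apply: contrapT => /fg.
Qed.

(** * Wishart integrals *)

Section radial.
Variable R : realType.
Local Notation mR := (measurableTypeR R).
Local Notation mu := (@lebesgue_measure R).
Local Notation C := R[i].
Local Notation lam m n := (@lebesgue_mxC R m n).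

Lemma sqnormZ m n (r : R) (Z : 'M[C]_(m, n)) :
  sqnorm (r%:C *: Z) = r ^+ 2 * sqnorm Z.
Proof.
rewrite /sqnorm mulr_sumr; apply: eq_bigr => i _.
rewrite mulr_sumr; apply: eq_bigr => j _; rewrite mxE.
by case: (Z i j) => a b /=; rewrite !mul0r subr0 addr0 !exprMn mulrDr.
Qed.

Lemma sqnorm_ge0 m n (Z : 'M[C]_(m, n)) : 0 <= sqnorm Z.
Proof.
by apply: sumr_ge0 => i _; apply: sumr_ge0 => j _; rewrite addr_ge0 ?sqr_ge0.
Qed.

(** The indicator of the origin is invariant under Z -> 2 Z, whereas this change of variable
    multiplies its integral by 2^-(2mn). The integral is finite, being dominated by the Gaussian
    one, so it is 0. *)
Lemma integral_sqnorm0 m n : (0 < m * n)%N ->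
  (\int[lam m n]_Z (if sqnorm Z == 0 then 1 else 0 : R)%:E = 0)%E.
Proof.
move=> mn0; set z := fun Z : 'M[C]_(m, n) => if sqnorm Z == 0 then 1 else 0 : R.
have z0 Z : 0 <= z Z by rewrite /z; case: ifP.
have mz : meas z.
  apply: measurable_fun_ifT; [|exact: measurable_cst|exact: measurable_cst].
  by apply: measurable_fun_eqr; [exact: measurable_sqnorm|exact: measurable_cst].
have mzE : meas (fun Z => (z Z)%:E) by exact/measurable_EFinP.
have zE0 Z : (0 <= (z Z)%:E)%E by rewrite lee_fin.
have := @integral_lebesgue_mxC_scale R m n 2 (fun Z => (z Z)%:E) (ltr0n _ 2) mzE zE0.
have -> : (\int[lam m n]_Z (z (2%:C *: Z))%:E = \int[lam m n]_Z (z Z)%:E)%E.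
  apply: eq_integral => Z _; rewrite /z sqnormZ mulf_eq0.
  by rewrite expf_eq0/= pnatr_eq0.
have : (\int[lam m n]_Z (z Z)%:E < +oo)%E.
  apply: (@le_lt_trans _ _ (\int[lam m n]_Z (gaussmx Z)%:E)%E).
    apply: ge0_le_integral => //.
    - by apply/measurable_EFinP; exact: measurable_gaussmx.
    - move=> Z _; rewrite lee_fin /z /gaussmx; case: ifP => [/eqP ->|_].
        by rewrite oppr0 expR0.
      exact: expR_ge0.
  by rewrite integral_gaussmx ltry.
have : (0 <= \int[lam m n]_Z (z Z)%:E)%E by exact: integral_ge0.
case: (integral _ _ _) => [c| |]// c0 _ [] /eqP.
rewrite -subr_eq0 -{1}[c]mul1r -mulrBl mulf_eq0 => /orP[|/eqP -> //].
rewrite subr_eq0 => /eqP/esym/eqP; rewrite invr_eq1.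
have mn20 : (0 < 2 * (m * n))%N by rewrite muln_gt0 mn0.
by rewrite pexpr_eq1 ?ler0n// gt_eqF// ltr1n.
Qed.

Lemma measurable_sqnorm0 m n : measurable [set Z : 'M[C]_(m, n) | sqnorm Z = 0].
Proof.
by have := @measurable_sqnorm R m n measurableT _ (measurable_set1 0); rewrite setTI.
Qed.

Lemma lebesgue_mxC_sqnorm0 m n : (0 < m * n)%N ->
  lam m n [set Z | sqnorm Z = 0] = 0%E.
Proof.
move=> mn0; rewrite -(integral_sqnorm0 mn0) -[X in lam m n X]setIT.
rewrite -integral_indic//; last exact: measurable_sqnorm0.
apply: eq_integral => Z _; rewrite indicE; congr EFin.
by case: eqP => Z0; [rewrite mem_set|rewrite memNset].
Qed.

(** * Polar integration of functions of the squared norm *)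

Section radial_main.
Variable k : nat.
Let m := k.+1.
Let rho (t : mR) : R := if 0 < t then t ^+ k else 0.
Let tau (phi : mR -> \bar R) := (\int[mu]_t (phi t * (rho t)%:E))%E.
Let theta (phi : mR -> \bar R) := (\int[lam m 1]_x phi (sqnorm x))%E.
Let omega (x : 'M[C]_(m, 1)) : R := sqnorm x ^+ m * gaussmx x.
(** Inverse Gamma weight: the profile in s / |x|^2 left after x is rescaled by sqrt s. Its mass,
    Gamma (k + 1), is found by testing on an exponential instead of substituting 1 / u. *)
Let kap (u : mR) : R := if 0 < u then u^-1 ^+ k.+2 * expR (- u^-1) else 0.

Let mrho : meas rho.
Proof.
apply: measurable_fun_ifT; [|exact: exprn_measurable|exact: measurable_cst].
by apply: measurable_fun_ltr => //; exact: measurable_cst.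
Qed.

Let mkap : meas kap.
Proof.
apply: measurable_fun_ifT; [| |exact: measurable_cst].
  by apply: measurable_fun_ltr => //; exact: measurable_cst.
have mV : meas (fun u : mR => u^-1) by exact: measurable_funV.
apply: measurable_funM; first exact: measurable_funX.
by apply: measurableT_comp => //; exact: measurableT_comp.
Qed.

Let rho0 t : 0 <= rho t.
Proof. by rewrite /rho; case: ifP => // t0; rewrite exprn_ge0// ltW. Qed.

Let kap0 t : 0 <= kap t.
Proof.
rewrite /kap; case: ifP => // t0.
by rewrite mulr_ge0 ?expR_ge0// exprn_ge0// invr_ge0 ltW.
Qed.

Let momega : meas omega.
Proof.
apply: measurable_funM; last exact: measurable_gaussmx.
by apply: measurable_funX; exact: measurable_sqnorm.
Qed.

Let omega0 x : 0 <= omega x.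
Proof. by rewrite mulr_ge0 ?gaussmx_ge0// exprn_ge0// sqnorm_ge0. Qed.

(** The power s^k in [rho] accounts for k factors a^-1, the change of variable for the last one. *)
Let tau_scale (phi : mR -> \bar R) (a : R) : 0 < a ->
  meas phi -> (forall x, 0 <= phi x)%E ->
  (\int[mu]_s (phi (s * a)%R * (rho s)%:E) = (a^-1 ^+ m)%:E * tau phi)%E.
Proof.
move=> a0 mphi phi0.
have mphir : meas (fun s => (phi s * (rho s)%:E)%E).
  by apply: emeasurable_funM => //; exact/measurable_EFinP.
have e : (\int[mu]_s ((a^-1 ^+ k)%:E * (phi s * (rho s)%:E)) =
    (a^-1 ^+ k)%:E * tau phi)%E.
  rewrite ge0_integralZl//.
  - by move=> s _; rewrite mule_ge0// lee_fin.
  - by rewrite lee_fin exprn_ge0// invr_ge0 ltW.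
have := @ge0_integral_scale R a (fun s => ((a^-1 ^+ k)%:E * (phi s * (rho s)%:E))%E) a0.
rewrite e muleA -EFinM -exprS => <-.
- apply: eq_integral => s _; rewrite muleCA -EFinM mulrC; congr (_ * _%:E)%E.
  rewrite /rho pmulr_rgt0//; case: ifP => _; last by rewrite mulr0.
  by rewrite exprMn mulrA -exprMn mulVf ?gt_eqF// expr1n mul1r.
- by apply: emeasurable_funM => //; exact: measurable_cst.
- move=> s; rewrite mule_ge0// ?mule_ge0// lee_fin//.
  by rewrite exprn_ge0// invr_ge0 ltW.
Qed.

Let radial_const : (0 <= \int[mu]_s (kap s)%:E)%E.
Proof. by apply: integral_ge0 => s _; rewrite lee_fin. Qed.

(* Both sides compute the double integral of
   phi(s |x|^2) |x|^(2m) exp(-|x|^2) rho(s). *)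
Let radial_kap (phi : mR -> \bar R) :
  meas phi -> (forall x, 0 <= phi x)%E ->
  (theta phi * \int[mu]_s (kap s)%:E = (pi ^+ m)%:E * tau phi)%E.
Proof.
move=> mphi phi0.
have msq := @measurable_sqnorm R m 1.
have m1 : meas (fun z : 'M[C]_(m, 1) * mR => sqnorm z.1).
  exact: (measurableT_comp msq measurable_fst).
have mint : meas (fun z : 'M[C]_(m, 1) * mR =>
    (phi (z.2 * sqnorm z.1)%R * (rho z.2)%:E * (omega z.1)%:E)%E).
  apply: emeasurable_funM; last first.
    by apply/measurable_EFinP; exact: (measurableT_comp momega measurable_fst).
  apply: emeasurable_funM; last first.
    by apply/measurable_EFinP; exact: (measurableT_comp mrho measurable_snd).
  have mm : meas (fun z : 'M[C]_(m, 1) * mR => z.2 * sqnorm z.1).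
    by apply: measurable_funM => //; exact: measurable_snd.
  exact: (measurableT_comp mphi mm).
have N0 := lebesgue_mxC_sqnorm0 (isT : (0 < m * 1)%N).
have tau0 : (0 <= tau phi)%E.
  by apply: integral_ge0 => s _; rewrite mule_ge0// lee_fin.
have mphis : meas (fun x : 'M[C]_(m, 1) => phi (sqnorm x)).
  exact: (measurableT_comp mphi msq).
transitivity (\int[mu]_s \int[lam m 1]_x
    (phi (s * sqnorm x)%R * (rho s)%:E * (omega x)%:E))%E; last first.
  rewrite -integral_swap//; last first.
    by move=> x s; rewrite mule_ge0// ?mule_ge0// lee_fin.
  have mg : meas (fun x : 'M[C]_(m, 1) => ((gaussmx x)%:E * tau phi)%E).
    apply: emeasurable_funM => //; apply/measurable_EFinP.
    exact: measurable_gaussmx.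
  (* Off x = 0 the s-integral yields |x|^(-2m) [tau phi], and the factor |x|^(2m) of [omega] cancels
     the power. *)
  rewrite (ge0_integral_eq_off (g := fun x => ((gaussmx x)%:E * tau phi)%E)
    (@measurable_sqnorm0 m 1) N0).
  - rewrite ge0_integralZr//.
    + by rewrite integral_gaussmx muln1.
    + by apply/measurable_EFinP; exact: measurable_gaussmx.
    + by move=> x _; rewrite lee_fin gaussmx_ge0.
  - apply: (@measurable_integral_snd _ _ _ _ _ _ (fun (x : 'M[C]_(m, 1)) (s : mR) =>
      phi (s * sqnorm x)%R * (rho s)%:E * (omega x)%:E)%E mint) => x s.
    by rewrite mule_ge0// ?mule_ge0// lee_fin.
  - exact: mg.
  - by move=> x; apply: integral_ge0 => s _; rewrite mule_ge0// ?mule_ge0// lee_fin.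
  - by move=> x; rewrite mule_ge0// lee_fin gaussmx_ge0.
  move=> x /eqP x0; have a0 : 0 < sqnorm x by rewrite lt_neqAle eq_sym x0 sqnorm_ge0.
  rewrite ge0_integralZr//; last 3 first.
  - apply: emeasurable_funM; last exact/measurable_EFinP.
    by apply: (measurableT_comp mphi); apply: measurable_funM => //; exact: measurable_cst.
  - by move=> s _; rewrite mule_ge0// lee_fin.
  - by rewrite lee_fin.
  rewrite tau_scale// muleAC -EFinM; congr (_%:E * _)%E.
  by rewrite /omega mulrA -exprMn mulVf ?gt_eqF// expr1n mul1r.
have mk2 : meas (fun z : mR * 'M[C]_(m, 1) =>
    (phi (sqnorm z.2) * ((sqnorm z.2)^-1 * kap (z.1 * (sqnorm z.2)^-1))%:E)%E).
  have ms2 : meas (fun z : mR * 'M[C]_(m, 1) => sqnorm z.2).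
    exact: (measurableT_comp msq measurable_snd).
  apply: emeasurable_funM; first exact: (measurableT_comp mphi ms2).
  apply/measurable_EFinP; apply: measurable_funM; first exact: measurable_funV.
  apply: (measurableT_comp mkap); apply: measurable_funM; first exact: measurable_fst.
  exact: measurable_funV.
have k20 (s : mR) (x : 'M[C]_(m, 1)) : (0 <= phi (sqnorm x) * ((sqnorm x)^-1 * kap (s * (sqnorm x)^-1))%:E)%E.
  by rewrite mule_ge0// lee_fin mulr_ge0// invr_ge0 sqnorm_ge0.
transitivity (\int[mu]_s \int[lam m 1]_x (phi (sqnorm x) *
    ((sqnorm x)^-1 * kap (s * (sqnorm x)^-1))%:E))%E; last first.
  apply: eq_integral => s _; apply/esym.
  have [s0|s0] := ltP 0 s; last first.
    transitivity (0%E : \bar R); [|apply/esym]; apply: integral0_eq => x _.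
      by rewrite /rho ltNge s0/= mule0 mul0e.
    rewrite /kap ltNge mulr_le0_ge0 ?invr_ge0 ?sqnorm_ge0//=.
    by rewrite mulr0 mule0.
  (* Scaling x by sqrt s turns s |x|^2 into |x|^2 at the cost of s^-m, of which [rho] absorbs all
     but s^-1. *)
  pose r := Num.sqrt s; have r0 : 0 < r by rewrite sqrtr_gt0.
  have rs : r ^+ 2 = s by rewrite sqr_sqrtr// ltW.
  pose h (x : 'M[C]_(m, 1)) := (phi (sqnorm x) *
    (rho s * ((sqnorm x / s) ^+ m * expR (- (sqnorm x / s))))%:E)%E.
  have mxs : meas (fun x : 'M[C]_(m, 1) => sqnorm x / s).
    by apply: measurable_funM => //; exact: measurable_cst.
  have mh : meas h.
    apply: emeasurable_funM => //; apply/measurable_EFinP.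
    apply: measurable_funM; first exact: measurable_cst.
    apply: measurable_funM; first exact: measurable_funX.
    by apply: measurableT_comp => //; exact: measurableT_comp.
  have h0 x : (0 <= h x)%E.
    rewrite mule_ge0// lee_fin mulr_ge0// mulr_ge0 ?expR_ge0// exprn_ge0//.
    by rewrite divr_ge0 ?sqnorm_ge0// ltW.
  transitivity (\int[lam m 1]_x h (r%:C *: x)%R)%E.
    apply: eq_integral => x _; rewrite /h sqnormZ rs -muleA -EFinM.
    by congr (_ * (_ * _)%:E)%E; rewrite mulrAC divff ?gt_eqF// mul1r.
  rewrite (integral_lebesgue_mxC_scale r0 mh h0) -ge0_integralZl//; last first.
    by rewrite lee_fin invr_ge0 exprn_ge0// ltW.
  apply: eq_integral => x _; rewrite /h muleCA -EFinM; congr (_ * _%:E)%E.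
  rewrite muln1 exprM rs /rho s0.
  have [->|x0] := eqVneq (sqnorm x) 0.
    by rewrite mul0r expr0n/= mul0r !mulr0 invr0 mul0r.
  have a0 : 0 < sqnorm x by rewrite lt_neqAle eq_sym x0 sqnorm_ge0.
  have sne : s != 0 by rewrite gt_eqF.
  have e1 : (s ^+ m)^-1 * s ^+ k = s^-1.
    by rewrite /m exprS invfM -mulrA mulVf ?mulr1// expf_neq0.
  rewrite /kap divr_gt0// invf_div (exprS _ k.+1) !mulrA e1.
  by rewrite mulVf// mul1r.
rewrite integral_swap//.
have mt : meas
    (fun x : 'M[C]_(m, 1) => (phi (sqnorm x) * \int[mu]_s (kap s)%:E)%E).
  exact: emeasurable_funM.
rewrite [RHS](ge0_integral_eq_off
  (g := fun x => (phi (sqnorm x) * \int[mu]_s (kap s)%:E)%E)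
  (@measurable_sqnorm0 m 1) N0).
- by rewrite ge0_integralZr.
- exact: (@measurable_integral_fst _ _ _ _ _ _ (fun (s : mR) (x : 'M[C]_(m, 1)) =>
    phi (sqnorm x) * ((sqnorm x)^-1 * kap (s * (sqnorm x)^-1))%:E)%E mk2 k20).
- exact: mt.
- by move=> x; apply: integral_ge0 => s _; exact: k20.
- by move=> x; rewrite mule_ge0.
move=> x /eqP x0; have a0 : 0 < sqnorm x by rewrite lt_neqAle eq_sym x0 sqnorm_ge0.
have mks : meas (fun s : mR => (kap (s * (sqnorm x)^-1))%:E).
  apply/measurable_EFinP; apply: (measurableT_comp mkap).
  by apply: measurable_funM => //; exact: measurable_cst.
rewrite ge0_integralZl//; last 2 first.
- by apply/measurable_EFinP; apply: measurable_funM => //; exact/measurable_EFinP.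
- by move=> s _; rewrite lee_fin mulr_ge0// invr_ge0 ltW.
congr (_ * _)%E.
under eq_integral do rewrite EFinM.
rewrite ge0_integralZl//; last 2 first.
- by move=> s _; rewrite lee_fin.
- by rewrite lee_fin invr_ge0 ltW.
have mkE : meas (fun s : mR => (kap s)%:E) by exact/measurable_EFinP.
have kE0 s : (0 <= (kap s)%:E)%E by rewrite lee_fin.
have xV0 : 0 < (sqnorm x)^-1 by rewrite invr_gt0.
have := ge0_integral_scale xV0 mkE kE0.
under eq_integral do rewrite mulrC.
by move=> ->; rewrite muleA -EFinM invrK mulVf ?gt_eqF// mul1e.
Qed.

Let tau_Gamma : (tau (fun t => (expR (- t))%:E) =
  \int[mu]_(t in `]0%R, +oo[) (t `^ (m%:R - 1) * expR (- t))%:E)%E.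
Proof.
rewrite [RHS]integral_mkcond; apply: eq_integral => t _; rewrite patchE.
case: ifPn => [/set_mem|/negP tN].
  rewrite /= in_itv/= andbT => t0; rewrite -EFinM /rho t0 mulrC.
  by rewrite -natr1 addrK powR_mulrn// ltW.
rewrite /rho; case: ifPn => [t0|_]; last by rewrite mule0.
by exfalso; apply: tN; apply/mem_set; rewrite /= in_itv/= t0.
Qed.

(** At phi (t) = exp (- t) the integral [theta phi] is the Gaussian mass pi^m, which cancels in
    [radial_kap]. *)
Let tau_gauss : (tau (fun t => (expR (- t))%:E) = \int[mu]_s (kap s)%:E)%E.
Proof.
have pim0 : pi ^+ m != 0 :> R by rewrite expf_neq0// gt_eqF ?pi_gt0.
have mE : meas (fun t : mR => (expR (- t))%:E).
  by apply/measurable_EFinP; apply: measurableT_comp.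
have E0 (t : mR) : (0 <= (expR (- t))%:E)%E by rewrite lee_fin expR_ge0.
have := radial_kap mE E0.
rewrite (_ : theta _ = (pi ^+ m)%:E); last by rewrite /theta integral_gaussmx muln1.
by move=> /(congr1 (fun z => ((pi ^+ m)^-1)%:E * z)%E); rewrite !muleA -!EFinM mulVf// !mul1e.
Qed.

(** [Gamma] is the real value of an extended integral and would be 0 if that integral were infinite,
    so finiteness and positivity are proved together. For phi equal to t^-k on the interval from 0
    to 1, [tau phi] is 1; the mass of [kap] times a nonnegative number is then pi^m, so it is
    neither 0 nor infinite. *)
Lemma Gamma_natP : 0 < Gamma (k.+1%:R : R) /\ (\int[mu]_s (kap s)%:E = (Gamma (k.+1%:R : R))%:E)%E.
Proof.
have GE : Gamma (k.+1%:R : R) = fine (\int[mu]_s (kap s)%:E)%E.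
  by rewrite -tau_gauss tau_Gamma.
pose phi (t : mR) : \bar R := (if (0 < t < 1) then t^-1 ^+ k else 0)%:E.
have phi0 t : (0 <= phi t)%E.
  rewrite lee_fin; case: ifP => // /andP[t0 _].
  by rewrite exprn_ge0// invr_ge0 ltW.
have mphi : meas phi.
  apply/measurable_EFinP; apply: measurable_fun_ifT; last exact: measurable_cst.
    by apply: measurable_and; apply: measurable_fun_ltr => //; exact: measurable_cst.
  by apply: measurable_funX; exact: measurable_funV.
have tauphi : (tau phi = 1)%E.
  transitivity (\int[mu]_t (\1_`]0%R, 1%R[%classic t)%:E)%E.
    apply: eq_integral => t _; rewrite /phi /rho -EFinM indicE; congr EFin.
    have [t01|t01] := boolP (0 < t < 1).
      rewrite mem_set/= ?in_itv//; have /andP[t0 _] := t01.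
      by rewrite t0 -exprMn mulVf ?expr1n// gt_eqF.
    rewrite memNset ?mul0r//= in_itv/=; exact/negP.
  rewrite integral_indic// setIT.
  by have := lebesgue_measure_itv `](0 : R), 1[; rewrite /= lte_fin ltr01 -EFinD subr0.
have := radial_kap mphi phi0; rewrite tauphi mule1.
have theta0 : (0 <= theta phi)%E by apply: integral_ge0 => x _.
have pim0 : 0 < pi ^+ m :> R by rewrite exprn_gt0// pi_gt0.
have := radial_const.
move: GE; case: (integral _ _ _) => [c| |]//= -> c0.
- move=> e; split => //; rewrite lt_neqAle -lee_fin c0 andbT.
  apply/eqP => cE; move: e; rewrite -cE mule0 => -[] /eqP.
  by rewrite eq_sym gt_eqF.
- have [->|t0] := eqVneq (theta phi) 0%E.
    by rewrite mul0e => -[] /eqP; rewrite eq_sym gt_eqF.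
  by rewrite gt0_muley ?lt_neqAle 1?eq_sym ?t0.
Qed.

Lemma integral_sqnorm (phi : mR -> \bar R) :
  meas phi -> (forall x, 0 <= phi x)%E ->
  (\int[lam k.+1 1]_x phi (sqnorm x) = (pi ^+ k.+1 / Gamma (k.+1%:R : R))%:E *
    \int[mu]_t (phi t * (if 0 < t then t ^+ k else 0)%R%:E))%E.
Proof.
move=> mphi phi0; have [G0 GE] := Gamma_natP.
have := radial_kap mphi phi0; rewrite GE mulrC EFinM -muleA => <-.
by rewrite muleCA -EFinM mulVf ?mule1// gt_eqF.
Qed.

End radial_main.
End radial.

(** * Push-forward of Lebesgue measure by the Gram map *)

Section wishart.
Variable R : realType.
Local Notation mR := (measurableTypeR R).
Local Notation mu := (@lebesgue_measure R).
Local Notation C := R[i].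
Local Notation lam m n := (@lebesgue_mxC R m n).
Local Notation lamH p := (@lebesgue_herm R p).

(** The factor of index i is the radial constant in C^(m-i), where a column lives once i earlier
    ones have been split off. The product is pi^(mp) over the multivariate Gamma of m, see
    [multiGamma_wishart]. *)
Definition wishart_const m p : R :=
  \prod_(i < p) (pi ^+ (m - i) / Gamma ((m - i)%N%:R)).

(** Zero off the open cone, so that multiplying weights adds exponents, and k = 0 gives the
    indicator of the cone. *)
Definition wishart_weight k p (W : 'M[C]_p) : R :=
  if posdefb W then rdet W ^+ k else 0.

Lemma wishart_weight_ge0 k p (W : 'M[C]_p) : 0 <= wishart_weight k W.
Proof.
rewrite /wishart_weight; case: posdefbP => // /posdef_rdet_gt0 W0.
by rewrite exprn_ge0// ltW.
Qed.

Lemma measurable_wishart_weight k p : meas (@wishart_weight k p).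
Proof.
apply: measurable_fun_ifT; last exact: measurable_cst.
  exact: measurable_fun_posdefb.
by apply: measurable_funX; exact: measurable_fun_rdet.
Qed.

Lemma wishart_weight_hblock k p t (w : 'rV[C]_p) (D : 'M[C]_p) :
  @wishart_weight k (1 + p) (hblock t w D) =
  if 0 < t then t ^+ k * wishart_weight k (schur t w D) else 0.
Proof.
rewrite /wishart_weight; have [t0|t0] := ltP 0 t; last first.
  case: posdefbP => // /posdef_hblock[]; rewrite ltNge t0//.
have -> : @posdefb R (1 + p) (hblock t w D) = posdefb (schur t w D).
  by apply/posdefbP/posdefbP => [/posdef_hblock[]//|pS]; exact/posdef_hblock.
case: posdefbP => [pS|_]; last by rewrite mulr0.
rewrite /rdet (det_hblock _ _ (lt0r_neq0 t0)) (posdef_detE pS) -rmorphM -exprMn.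
by [].
Qed.

Lemma gram_col m (x : 'M[C]_(m, 1)) : x ^t* *m x = ((sqnorm x)%:C)%:M.
Proof.
apply/matrixP => i j; rewrite !ord1 [in RHS]mxE eqxx mulr1n sqnormE /mxtrace big_ord1.
by rewrite (RRe_real (ger0_real (cVnorm_ge0 x))).
Qed.

Lemma gram_row_mx m p (x : 'M[C]_(m, 1)) (Y : 'M[C]_(m, p)) :
  (row_mx x Y) ^t* *m row_mx x Y = hblock (sqnorm x) (x ^t* *m Y) (Y ^t* *m Y).
Proof.
rewrite adj_row_mx mul_col_row /hblock; congr block_mx.
  exact: gram_col.
by rewrite adjmxM trmxCK.
Qed.

Lemma measurable_fun_hblock d (U : measurableType d) p (t : U -> mR)
    (w : U -> 'rV[C]_p) (D : U -> 'M[C]_p) :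
  meas t -> meas w -> meas D ->
  meas (fun u => hblock (t u) (w u) (D u)).
Proof.
move=> mt mw mD; apply: measurable_fun_block_mx => //.
  by apply: measurable_fun_scalar_mx; exact: measurable_funRC.
exact: measurable_fun_adjmx.
Qed.

Lemma measurable_fun_gram d (U : measurableType d) m p (X : U -> 'M[C]_(m, p)) :
  meas X -> meas (fun u => (X u) ^t* *m X u).
Proof. by move=> mX; apply: measurable_fun_mulmx => //; exact: measurable_fun_adjmx. Qed.

(* The inner integral depends on the first column x only through |x|^2, since a
   unitary change of variables sends x to a multiple of the first basis vector. *)
Lemma integral_gram_column k p (f : 'M[C]_(1 + p) -> \bar R) (x : 'M[C]_(k.+1, 1)) :
  meas f -> (forall V, 0 <= f V)%E -> sqnorm x != 0 ->
  (\int[lam k.+1 p]_Y f ((row_mx x Y) ^t* *m row_mx x Y) =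
   \int[lam 1 p]_y \int[lam k p]_Z f (hblock (sqnorm x)
     ((Num.sqrt (sqnorm x))%:C *: y) (y ^t* *m y + Z ^t* *m Z)))%E.
Proof.
move=> mf f0 x0; set t := sqnorm x; set s := Num.sqrt t.
have t0 : 0 < t by rewrite lt_neqAle eq_sym x0 sqnorm_ge0.
have s0 : s != 0 by rewrite gt_eqF// sqrtr_gt0.
pose T : 'M[C]_1 := (s%:C)%:M.
have Tu : T \in unitmx by rewrite unitmxE det_scalar expr1 unitfE fmorph_eq0.
have xT : x ^t* *m x = T ^t* *m T.
  by rewrite adj_realmx1 -scalar_mxM -rmorphM -expr2 sqr_sqrtr ?ltW// gram_col.
have [U Uu xE] := @gram_unitary R 1 k x T Tu xT.
pose g (Z : 'M[C]_(1 + k, p)) : \bar R :=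
  f (hblock t (s%:C *: usubmx Z) (Z ^t* *m Z)).
have mg : meas g.
  apply: (measurableT_comp mf); apply: measurable_fun_hblock.
  - exact: measurable_cst.
  - apply: measurable_fun_scalemx; first exact: measurable_cst.
    exact: measurable_fun_usubmx.
  - exact: measurable_fun_gram.
have g0 Z : (0 <= g Z)%E by exact: f0.
have UU : U ^t* \is unitarymx by rewrite trmxC_unitary.
(* As x is U applied to s times the first basis vector, x^H Y is s times the first row of U^H Y,
   while Y^H Y is unchanged. *)
transitivity (\int[lam (1 + k) p]_Y g (U ^t* *m Y))%E.
  apply: eq_integral => Y _; rewrite gram_row_mx /g -/t; congr (f (hblock _ _ _)).
    rewrite xE adjmxM adj_col_mx adjmx0 -mulmxA -[X in row_mx _ _ *m X]vsubmxK.
    by rewrite mul_row_col mul0mx addr0 adj_realmx1 mul_scalar_mx.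
  by rewrite adjmxM trmxCK -mulmxA (mulmxA U) (unitarymxP Uu) mul1mx.
rewrite (@integral_lebesgue_mxC_unitaryl R (1 + k) p (U ^t* ) g UU mg g0).
rewrite (@integral_lebesgue_mxC_col R 1 k p g mg g0); apply: eq_integral => y _.
apply: eq_integral => Z _; rewrite /g col_mxKu; congr (f (hblock _ _ _)).
by rewrite adj_col_mx mul_row_col.
Qed.

End wishart.

Lemma ge0_integralZlT d (T : measurableType d) (R : realType)
    (mu : {measure set T -> \bar R}) (c : R) (f : T -> \bar R) :
  0 <= c -> meas f -> (forall x, 0 <= f x)%E ->
  (c%:E * \int[mu]_x f x = \int[mu]_x (c%:E * f x))%E.
Proof. by move=> c0 mf f0; rewrite ge0_integralZl// lee_fin. Qed.

Section wishart_main.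
Variable R : realType.
Local Notation mR := (measurableTypeR R).
Local Notation mu := (@lebesgue_measure R).
Local Notation C := R[i].
Local Notation lam m n := (@lebesgue_mxC R m n).
Local Notation lamH p := (@lebesgue_herm R p).

(** Both matrix spaces are single points of mass 1; on the left the mass is read off the Gaussian
    integral pi^0. *)
Lemma integral_wishart0 m (f : 'M[C]_0 -> \bar R) :
  meas f -> (forall V, 0 <= f V)%E ->
  (\int[lam m 0]_X f (X ^t* *m X) = \int[lamH 0]_W (f W * (wishart_weight m W)%:E))%E.
Proof.
move=> mf f0.
have M0 k (X Y : 'M[C]_(k, 0)) : X = Y by apply/matrixP => i [].
transitivity (f 0%R); last apply/esym.
- transitivity (\int[lam m 0]_X (f 0%R * (gaussmx X)%:E))%E.
    apply: eq_integral => X _; rewrite (M0 _ (X ^t* *m X) 0) /gaussmx /sqnorm big1; last first.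
      by move=> i _; rewrite big_ord0.
    by rewrite oppr0 expR0 mule1.
  rewrite ge0_integralZl//.
  + by rewrite integral_gaussmx muln0 expr0 mule1.
  + by apply/measurable_EFinP; exact: measurable_gaussmx.
  + by move=> X _; rewrite lee_fin gaussmx_ge0.
- rewrite integral_lebesgue_herm; last 2 first.
  + apply: emeasurable_funM => //; apply/measurable_EFinP.
    exact: measurable_wishart_weight.
  + by move=> V; rewrite mule_ge0// lee_fin wishart_weight_ge0.
  have e := @integral_lebesgue_mx_prod R 0 0 (fun _ _ => cst 1)
    (fun _ _ => measurable_cst _) (fun _ _ _ => ler01).
  rewrite big_ord0 in e.
  transitivity (\int[@lebesgue_mx R 0 0]_X (f 0%R * (\prod_(i < 0) \prod_(j < 0) cst 1 (X i j))%:E))%E.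
    apply: eq_integral => X _; rewrite (M0 _ (herm_mx X) 0) big_ord0; congr (f _ * _%:E)%E.
    have -> : wishart_weight m (0 : 'M[C]_0) = 1.
      rewrite /wishart_weight /rdet det_mx00/= expr1n; case: posdefbP => // -[].
      split=> [|v]; first exact: M0.
      by rewrite (_ : v = 0) ?eqxx//; apply/matrixP => -[].
    by [].
  rewrite ge0_integralZl//.
  + by rewrite e mule1.
  + by under eq_fun do rewrite big_ord0; exact: measurable_cst.
  + by move=> X _; rewrite big_ord0 lee_fin.
Qed.

Lemma wishart_const_ge0 m p : (p <= m)%N -> 0 <= wishart_const R m p.
Proof.
move=> pm; apply: prodr_ge0 => i _; rewrite divr_ge0 ?exprn_ge0 ?pi_ge0//.
have : (0 < m - i)%N by rewrite subn_gt0 (leq_trans (ltn_ord i)).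
by case: (m - i)%N => // l _; rewrite ltW//; have [] := Gamma_natP R l.
Qed.

(** For p + 1 columns and m = k + 1, the induction hypothesis on the k x p block Z gives the weight
    |S|^(k-p) for S = Z^H Z. With D = y^H y + S and w = sqrt t y, S becomes the Schur complement of
    t in the bordered matrix, and dy is t^-p dw. The radial density t^k leaves t^(k-p), and t |S| is
    the full determinant. *)
Lemma integral_wishart m p (f : 'M[C]_p -> \bar R) : (p <= m)%N ->
  meas f -> (forall V, 0 <= f V)%E ->
  (\int[lam m p]_X f (X ^t* *m X) = (wishart_const R m p)%:E *
   \int[lamH p]_W (f W * (wishart_weight (m - p) W)%:E))%E.
Proof.
elim: p m f => [|p ih] m f pm mf f0.
  by rewrite /wishart_const big_ord0 mul1e subn0; exact: integral_wishart0.
case: m pm => // k; rewrite ltnS => pk.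
have mh d (U : measurableType d) (t : U -> mR) (w : U -> 'rV[C]_p) (D : U -> 'M[C]_p) :
  meas t -> meas w -> meas D ->
  meas (fun u => f (hblock (t u) (w u) (D u))).
  by move=> mt mw mD; apply: (measurableT_comp mf); exact: measurable_fun_hblock.
rewrite (@integral_lebesgue_mxC_row R k.+1 1 p (fun X => f (X ^t* *m X))); last 2 first.
- by apply: (measurableT_comp mf); exact: measurable_fun_gram.
- by move=> X; exact: f0.
pose Psi (t : mR) : \bar R := (\int[lam 1 p]_y \int[lam k p]_Z f (hblock t
     ((Num.sqrt t)%:C *: y) (y ^t* *m y + Z ^t* *m Z)))%E.
have mPsi : meas Psi.
  have msqrt : meas (@Num.sqrt R).
    by apply: continuous_measurable_fun; exact: sqrt_continuous.
  apply: (@measurable_integral_snd _ _ _ _ _ _ (fun (t : mR) (y : 'rV[C]_p) =>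
     \int[lam k p]_Z f (hblock t ((Num.sqrt t)%:C *: y) (y ^t* *m y + Z ^t* *m Z)))%E).
    apply: (@measurable_integral_snd _ _ _ _ _ _ (fun (z : mR * 'rV[C]_p) (Z : 'M[C]_(k, p)) =>
      f (hblock z.1 ((Num.sqrt z.1)%:C *: z.2) (z.2 ^t* *m z.2 + Z ^t* *m Z)))%E) => //.
    have m1 : meas (fun z : (mR * 'rV[C]_p) * 'M[C]_(k, p) => z.1.1).
      exact: (measurableT_comp measurable_fst measurable_fst).
    have m2 : meas (fun z : (mR * 'rV[C]_p) * 'M[C]_(k, p) => z.1.2).
      exact: (measurableT_comp measurable_snd measurable_fst).
    apply: mh => //.
    - apply: measurable_fun_scalemx => //; apply: measurable_funRC.
      exact: (measurableT_comp msqrt m1).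
    - apply: measurable_fun_addmx; apply: measurable_fun_gram => //.
  by move=> t y; exact: integral_ge0.
have Psi0 t : (0 <= Psi t)%E by apply: integral_ge0 => y _; exact: integral_ge0.
have k1 : (0 < k.+1 * 1)%N by [].
(* The reduction to a function of |x|^2 is available off x = 0, whose measure is 0. *)
rewrite (ge0_integral_eq_off (g := fun x => Psi (sqnorm x))
  (@measurable_sqnorm0 R k.+1 1) (lebesgue_mxC_sqnorm0 R k1)); last 5 first.
- apply: (@measurable_integral_snd _ _ _ _ _ _ (fun (x : 'M[C]_(k.+1, 1)) (Y : 'M[C]_(k.+1, p)) =>
    f ((row_mx x Y) ^t* *m row_mx x Y))) => //.
  have mr : meas
      (fun z : 'M[C]_(k.+1, 1) * 'M[C]_(k.+1, p) => row_mx z.1 z.2).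
    exact: measurable_fun_row_mx.
  exact: (measurableT_comp mf (measurable_fun_gram mr)).
- exact: (measurableT_comp mPsi (@measurable_sqnorm R k.+1 1)).
- by move=> x; exact: integral_ge0.
- by move=> x; exact: Psi0.
- by move=> x /eqP x0; exact: integral_gram_column.
rewrite (integral_sqnorm k mPsi Psi0) /wishart_const big_ord_recl subn0.
rewrite [in RHS]EFinM -[in RHS]muleA; congr (_ * _)%E.
rewrite (_ : \prod_(i < p) _ = wishart_const R k p); last first.
  by apply: eq_bigr => i _; rewrite /= /bump/= add1n subSS.
have mwh j d (U : measurableType d) (t : U -> mR) (w : U -> 'rV[C]_p) (D : U -> 'M[C]_p) :
  meas t -> meas w -> meas D ->
  meas (fun u => (f (hblock (t u) (w u) (D u)) *
    (wishart_weight j (schur (t u) (w u) (D u)))%:E)%E).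
  move=> mt mw mD; apply: emeasurable_funM; first exact: mh.
  apply/measurable_EFinP; apply: (measurableT_comp (@measurable_wishart_weight R j p)).
  exact: measurable_fun_schur.
have PsiE (t : R) : 0 < t -> (Psi t = (wishart_const R k p)%:E * ((t^-1 ^+ p)%:E *
   \int[lam 1 p]_w \int[lamH p]_D (f (hblock t w D) *
      (wishart_weight (k - p) (schur t w D))%:E)))%E.
  move=> t0; pose s := Num.sqrt t; have s0 : 0 < s by rewrite sqrtr_gt0.
  have ss : s ^+ 2 = t by rewrite sqr_sqrtr// ltW.
  pose phi (w : 'rV[C]_p) : \bar R := (\int[lamH p]_D (f (hblock t w D) *
      (wishart_weight (k - p) (schur t w D))%:E))%E.
  have mphi : meas phi.
    apply: (@measurable_integral_snd _ _ _ _ _ _ (fun (w : 'rV[C]_p) (D : 'M[C]_p) =>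
      f (hblock t w D) * (wishart_weight (k - p) (schur t w D))%:E)%E).
      by apply: mwh; [exact: measurable_cst|exact: measurable_fst|exact: measurable_snd].
    by move=> w D; rewrite mule_ge0// lee_fin wishart_weight_ge0.
  have phi0 w : (0 <= phi w)%E.
    by apply: integral_ge0 => D _; rewrite mule_ge0// lee_fin wishart_weight_ge0.
  transitivity (\int[lam 1 p]_y ((wishart_const R k p)%:E * phi (s%:C *: y)%R))%E.
    apply: eq_integral => y _.
    pose g (S : 'M[C]_p) := f (hblock t (s%:C *: y) (y ^t* *m y + S)).
    have mg : meas g.
      apply: mh; [exact: measurable_cst|exact: measurable_cst|].
      by apply: measurable_fun_addmx.
    rewrite (ih k g pk mg) => [|V]; last exact: f0.
    congr (_ * _)%E.
    have Ah : (- (y ^t* *m y)) ^t* = - (y ^t* *m y) by rewrite adjmxN adjmxM trmxCK.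
    (* Translation by - y^H y makes D = y^H y + S the free variable. *)
    rewrite (@integral_lebesgue_hermD R p _ (fun W => (g W * (wishart_weight (k - p) W)%:E)%E) Ah).
    - apply: eq_integral => D _; rewrite /g addrC subrK; congr (_ * (wishart_weight _ _)%:E)%E.
      rewrite /schur adjmxZ -scalemxAl -scalemxAr !scalerA -!rmorphM -mulrA -expr2 ss.
      by rewrite mulVf ?scale1r// gt_eqF.
    - apply: emeasurable_funM => //; apply/measurable_EFinP.
      exact: measurable_wishart_weight.
    - by move=> V; rewrite mule_ge0 ?f0// lee_fin wishart_weight_ge0.
  have mphis : meas (fun y : 'rV[C]_p => phi (s%:C *: y)).
    apply: (measurableT_comp mphi); exact: measurable_fun_scalemx.
  rewrite ge0_integralZl//; last by rewrite lee_fin wishart_const_ge0.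
  congr (_ * _)%E; apply: (etrans (integral_lebesgue_mxC_scale s0 mphi phi0)).
  by rewrite exprM ss mul1n exprVn.
have mfw : meas
    (fun W : 'M[C]_(1 + p) => (f W * (wishart_weight (k.+1 - p.+1) W)%:E)%E).
  apply: emeasurable_funM => //; apply/measurable_EFinP.
  exact: measurable_wishart_weight.
have fw0 (W : 'M[C]_(1 + p)) : (0 <= f W * (wishart_weight (k.+1 - p.+1) W)%:E)%E.
  by rewrite mule_ge0 ?f0// lee_fin wishart_weight_ge0.
have e := integral_lebesgue_herm_hblock mfw fw0.
apply/esym; apply: (etrans (congr1 (fun z => (wishart_const R k p)%:E * z)%E e)).
apply/esym.
pose G (t : mR) (w : 'rV[C]_p) : \bar R := (\int[lamH p]_D (f (hblock t w D) *
      (wishart_weight (k - p) (schur t w D))%:E))%E.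
have G0 t w : (0 <= G t w)%E.
  by apply: integral_ge0 => D _; rewrite mule_ge0 ?f0// lee_fin wishart_weight_ge0.
have mG : meas (fun z : mR * 'rV[C]_p => G z.1 z.2).
  apply: (@measurable_integral_snd _ _ _ _ _ _ (fun (z : mR * 'rV[C]_p) (D : 'M[C]_p) =>
    f (hblock z.1 z.2 D) * (wishart_weight (k - p) (schur z.1 z.2 D))%:E)%E).
    apply: mwh; last exact: measurable_snd.
      exact: (measurableT_comp measurable_fst measurable_fst).
    exact: (measurableT_comp measurable_snd measurable_fst).
  by move=> z D; rewrite mule_ge0 ?f0// lee_fin wishart_weight_ge0.
have mGt (t : mR) : meas (G t).
  apply: (@measurable_integral_snd _ _ _ _ _ _ (fun (w : 'rV[C]_p) (D : 'M[C]_p) =>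
    f (hblock t w D) * (wishart_weight (k - p) (schur t w D))%:E)%E).
    by apply: mwh; [exact: measurable_cst|exact: measurable_fst|exact: measurable_snd].
  by move=> z D; rewrite mule_ge0 ?f0// lee_fin wishart_weight_ge0.
pose q (t : mR) : R := if 0 < t then t ^+ (k - p) else 0.
have q0 t : 0 <= q t by rewrite /q; case: ifP => // t0; rewrite exprn_ge0// ltW.
have mq : meas q.
  apply: measurable_fun_ifT; [|exact: exprn_measurable|exact: measurable_cst].
  by apply: measurable_fun_ltr => //; exact: measurable_cst.
have mDG (t : mR) (w : 'rV[C]_p) : meas (fun D : 'M[C]_p =>
    f (hblock t w D) * (wishart_weight (k - p) (schur t w D))%:E)%E.
  by apply: mwh; [exact: measurable_cst|exact: measurable_cst|exact: measurable_id].
have DG0 t (w : 'rV[C]_p) D :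
    (0 <= f (hblock t w D) * (wishart_weight (k - p) (schur t w D))%:E)%E.
  by rewrite mule_ge0 ?f0// lee_fin wishart_weight_ge0.
have mIG : meas (fun t : mR => \int[lam 1 p]_w G t w)%E.
  exact: (@measurable_integral_snd _ _ _ _ _ _ G mG G0).
transitivity ((wishart_const R k p)%:E *
    \int[mu]_t ((q t)%:E * \int[lam 1 p]_w G t w))%E; last first.
  congr (_ * _)%E; apply: eq_integral => t _.
  rewrite (ge0_integralZlT _ (q0 t) (mGt t) (G0 t)).
  apply: eq_integral => w _; rewrite (ge0_integralZlT _ (q0 t) (mDG t w) (DG0 t w)).
  apply: eq_integral => D _; rewrite muleCA -EFinM.
  rewrite wishart_weight_hblock subSS /q; case: ifP => // _.
  by rewrite mul0r.
have mqIG : meas (fun t : mR => (q t)%:E * \int[lam 1 p]_w G t w)%E.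
  by apply: emeasurable_funM => //; exact/measurable_EFinP.
have qIG0 (t : mR) : (0 <= (q t)%:E * \int[lam 1 p]_w G t w)%E.
  by rewrite mule_ge0 ?lee_fin//; exact: integral_ge0.
rewrite (ge0_integralZlT _ (wishart_const_ge0 pk) mqIG qIG0).
apply: eq_integral => t _; have [t0|t0] := ltP 0 t; last first.
  by rewrite mule0 /q ltNge t0/= mul0e mule0.
rewrite PsiE// -muleA; congr (_ * _)%E; rewrite muleAC -EFinM; congr (_%:E * _)%E.
(* t^k t^-p = t^(k - p), the subtraction being exact since p <= k. *)
rewrite /q t0 exprVn -{1}(subnK pk) exprD mulrC -mulrA divff ?mulr1//.
by rewrite expf_neq0// gt_eqF.
Qed.

End wishart_main.

(** * Jacobians *)

Section jacobians.
Variable R : realType.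
Local Notation mR := (measurableTypeR R).
Local Notation C := R[i].
Local Notation lam m n := (@lebesgue_mxC R m n).
Local Notation lamH p := (@lebesgue_herm R p).

(** The Gaussian weight seen on Gram matrices; taking the real part keeps it real-valued on all
    matrices. *)
Definition etr p (W : 'M[C]_p) : R := expR (- complex.Re (\tr W)).

Lemma etr_ge0 p (W : 'M[C]_p) : 0 <= etr W. Proof. exact: expR_ge0. Qed.

Lemma measurable_etr p : meas (@etr p).
Proof.
apply: measurableT_comp => //; apply: measurableT_comp => //.
by apply: measurable_funRe; exact: measurable_fun_mxtrace.
Qed.

Lemma gaussmx_etr m p (X : 'M[C]_(m, p)) : gaussmx X = etr (X ^t* *m X).
Proof. by rewrite /gaussmx sqnormE. Qed.

Lemma integral_etr_wishart m p : (p <= m)%N ->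
  ((wishart_const R m p)%:E * \int[lamH p]_W ((etr W)%:E * (wishart_weight (m - p) W)%:E) =
   (pi ^+ (m * p))%:E)%E.
Proof.
move=> pm; rewrite -integral_gaussmx -(integral_wishart (f := fun W => (etr W)%:E) pm).
- by apply: eq_integral => X _; rewrite gaussmx_etr.
- by apply/measurable_EFinP; exact: measurable_etr.
- by move=> W; rewrite lee_fin etr_ge0.
Qed.

Lemma wishart_const_gt0 m p : (p <= m)%N -> 0 < wishart_const R m p.
Proof.
move=> pm; apply: prodr_gt0 => i _; rewrite divr_gt0 ?exprn_gt0 ?pi_gt0//.
have : (0 < m - i)%N by rewrite subn_gt0 (leq_trans (ltn_ord i)).
by case: (m - i)%N => // l _; have [] := Gamma_natP R l.
Qed.

Lemma wishart_weightM j k p (W : 'M[C]_p) :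
  wishart_weight j W * wishart_weight k W = wishart_weight (j + k) W.
Proof.
by rewrite /wishart_weight; case: posdefbP => _; rewrite ?mul0r// exprD.
Qed.

Lemma posdefb_congr p (T W : 'M[C]_p) : T \in unitmx ->
  posdefb (T ^t* *m W *m T) = posdefb W.
Proof. by move=> Tu; apply/posdefbP/posdefbP => /(posdef_congr _ Tu). Qed.

Lemma wishart_weight_congr k p (T W : 'M[C]_p) : T \in unitmx ->
  wishart_weight k (T ^t* *m W *m T) = rdet (T ^t* *m T) ^+ k * wishart_weight k W.
Proof.
move=> Tu; rewrite /wishart_weight posdefb_congr// rdet_congr exprMn.
by case: ifP => // _; rewrite mulr0.
Qed.

Lemma rdet_gram_gt0 p (T : 'M[C]_p) : T \in unitmx -> 0 < rdet (T ^t* *m T).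
Proof. by move=> Tu; exact/posdef_rdet_gt0/posdef_gram. Qed.

Lemma measurable_fun_mulr m p (T : 'M[C]_p) :
  meas (fun X : 'M[C]_(m, p) => X *m T).
Proof. by apply: measurable_fun_mulmx. Qed.

(** The Gaussian weight factors over rows and T acts on each row separately, so the unknown Jacobian
    for m rows is governed by a single number, that of one row. *)
Lemma integral_gaussmx_mulr m p (T : 'M[C]_p) :
  (\int[lam m p]_X (gaussmx (X *m T))%:E =
   \prod_(i < m) \int[lam 1 p]_x (gaussmx (x *m T))%:E)%E.
Proof.
have mg k : meas (fun X : 'M[C]_(k, p) => (gaussmx (X *m T))%:E).
  apply/measurable_EFinP.
  exact: (measurableT_comp (@measurable_gaussmx R k p) (measurable_fun_mulr T)).
have g0 k (X : 'M[C]_(k, p)) : (0 <= (gaussmx (X *m T))%:E)%E.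
  by rewrite lee_fin gaussmx_ge0.
elim: m => [|m ih].
  rewrite big_ord0; transitivity (\int[lam 0 p]_X (gaussmx X)%:E)%E.
    by apply: eq_integral => X _; rewrite (_ : X *m T = X)//; apply/matrixP => -[].
  by rewrite integral_gaussmx mul0n expr0.
rewrite big_ord_recl -ih -integral_prod_mul; [|exact: mg|exact: mg|exact: g0|exact: g0].
apply: (etrans (integral_lebesgue_mxC_col (mg (1 + m)%N) (g0 (1 + m)%N))).
apply: eq_integral => x _; apply: eq_integral => X _.
rewrite mul_col_mx /gaussmx /sqnorm big_split_ord/= opprD expRD EFinM.
congr (_%:E * _%:E)%E; congr (expR (- _)); apply: eq_bigr => i _;
  by apply: eq_bigr => j _; rewrite ?col_mxEu ?col_mxEd.
Qed.

Section mulr.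
Variables (p : nat) (T : 'M[C]_p).
Hypothesis Tu : T \in unitmx.
Let q := (\int[lam 1 p]_x (gaussmx (x *m T))%:E)%E.
Let d := rdet (T ^t* *m T).

Let mulr_raw m (f : 'M[C]_(m, p) -> \bar R) :
  meas f -> (forall Z, 0 <= f Z)%E ->
  (\int[lam m p]_X f (X *m T) =
   (pi ^- (m * p))%:E * (\int[lam m p]_X (gaussmx (X *m T))%:E) * \int[lam m p]_X f X)%E.
Proof.
move=> mf f0.
apply: (@integral_lebesgue_mxC_additive R m p (mulmxr T) (mulmxr (invmx T)) f) => //.
- by move=> X Y; rewrite /= mulmxDl.
- by move=> X; rewrite /= (mulmxKV Tu).
- exact: measurable_fun_mulr.
Qed.

(** Multiplication by T followed by its inverse writes pi^p as pi^-p times q times another integral,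
    so q is neither 0 nor infinite. *)
Let q_fin : exists2 r : R, 0 < r & q = r%:E.
Proof.
have pip : pi ^- (1 * p) * pi ^+ (1 * p) = 1 :> R.
  by rewrite mulVf// expf_neq0// gt_eqF ?pi_gt0.
have q0 : (0 <= q)%E by apply: integral_ge0 => x _; rewrite lee_fin gaussmx_ge0.
have mg : meas (fun X : 'M[C]_(1, p) => (gaussmx (X *m invmx T))%:E).
  apply/measurable_EFinP.
  exact: (measurableT_comp (@measurable_gaussmx R 1 p) (measurable_fun_mulr _)).
have eT : (\int[lam 1 p]_X (gaussmx X)%:E =
    \int[lam 1 p]_X (gaussmx (X *m T *m invmx T))%:E)%E.
  by apply: eq_integral => X _; rewrite (mulmxK Tu).
have := etrans eT (@mulr_raw 1 (fun X => (gaussmx (X *m invmx T))%:E) mg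
  (fun X => gaussmx_ge0 _ : (0 <= (gaussmx (X *m invmx T))%:E)%E)).
rewrite {eT} integral_gaussmx -/q.
have I0 : (0 <= \int[lam 1 p]_X (gaussmx (X *m invmx T))%:E)%E.
  by apply: integral_ge0 => x _; rewrite lee_fin gaussmx_ge0.
have pi0 : 0 < pi ^+ (1 * p) :> R by rewrite exprn_gt0// pi_gt0.
move: q0 I0; case: q => [r| |]//.
  rewrite lee_fin le_eqVlt => /orP[/eqP <- _|r0 _ _]; last by exists r.
  by rewrite mule0 mul0e => -[] /eqP; rewrite gt_eqF.
move=> _; rewrite gt0_muley ?lte_fin ?invr_gt0//.
move: (integral _ _ _) => [s| |]//; rewrite ?mulyy//.
rewrite lee_fin le_eqVlt => /orP[/eqP <-|s0].
  by rewrite mule0 => -[] /eqP; rewrite gt_eqF.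
by rewrite gt0_mulye.
Qed.

(** Two evaluations of one Jacobian. With p + 1 rows the Gaussian integral of X T is r^(p+1), and on
    Gram matrices it carries the weight |W|; with p rows the weight is 1 and the Jacobian involves
    r^p. Moving |W| through W -> T^H W T costs 1 / d, whence r^(p+1) = d^-1 pi^p r^p. *)
Let q_det : q = (d^-1 * pi ^+ p)%:E.
Proof.
have [r r0 qE] := q_fin.
have gE m : (\int[lam m p]_X (gaussmx (X *m T))%:E = (r ^+ m)%:E)%E.
  by rewrite integral_gaussmx_mulr -/q qE prodEFin prodr_const card_ord.
have d0 : 0 < d by exact: rdet_gram_gt0.
pose h (W : 'M[C]_p) : \bar R := ((etr W)%:E * (wishart_weight 1 W)%:E)%E.
have mh : meas h.
  apply: emeasurable_funM; apply/measurable_EFinP; first exact: measurable_etr.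
  exact: measurable_wishart_weight.
have h0 W : (0 <= h W)%E by rewrite mule_ge0// lee_fin ?etr_ge0 ?wishart_weight_ge0.
have mc : meas (fun W : 'M[C]_p => T ^t* *m W *m T).
  by apply: measurable_fun_mulmx => //; exact: measurable_fun_mulmx.
have metr : meas (fun W : 'M[C]_p => (etr (T ^t* *m W *m T))%:E).
  by apply/measurable_EFinP; exact: (measurableT_comp (@measurable_etr p) mc).
have etr0 (W : 'M[C]_p) : (0 <= (etr (T ^t* *m W *m T))%:E)%E by rewrite lee_fin etr_ge0.
have congrE m (X : 'M[C]_(m, p)) : (X *m T) ^t* *m (X *m T) = T ^t* *m (X ^t* *m X) *m T.
  by rewrite adjmxM !mulmxA.
have e1 : (r ^+ p.+1)%:E = ((wishart_const R p.+1 p)%:E *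
    \int[lamH p]_W ((d^-1)%:E * (h (T ^t* *m W *m T) * (wishart_weight 0 W)%:E)))%E.
  rewrite -gE; under eq_integral do rewrite gaussmx_etr congrE.
  rewrite (integral_wishart (leqnSn p) metr etr0) subSnn; congr (_ * _)%E.
  apply: eq_integral => W _; rewrite /h wishart_weight_congr// expr1 -/d -!EFinM.
  congr EFin; rewrite -mulrA -[in RHS]mulrA wishart_weightM addn0.
  by rewrite mulrCA mulKf// gt_eqF.
have mhc : meas (fun W => h (T ^t* *m W *m T)) by exact: (measurableT_comp mh mc).
have e2 : ((wishart_const R p p)%:E *
    \int[lamH p]_W (h (T ^t* *m W *m T) * (wishart_weight 0 W)%:E) =
    (pi ^- (p * p) * r ^+ p)%:E * \int[lam p p]_X h (X ^t* *m X))%E.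
  have := @integral_wishart R p p _ (leqnn p) mhc (fun W => h0 _).
  rewrite subnn => <-; rewrite EFinM -gE.
  have mhg : meas (fun X : 'M[C]_(p, p) => h (X ^t* *m X)).
    apply: (measurableT_comp mh); exact: measurable_fun_gram.
  rewrite -(mulr_raw mhg (fun X => h0 _)).
  by apply: eq_integral => X _; rewrite congrE.
have e3 : (\int[lam p p]_X h (X ^t* *m X) = (wishart_const R p p)%:E *
    ((wishart_const R p.+1 p)^-1 * pi ^+ (p.+1 * p))%:E)%E.
  rewrite (integral_wishart (leqnn p) mh h0) subnn; congr (_ * _)%E.
  have := @integral_etr_wishart p.+1 p (leqnSn p); rewrite subSnn EFinM => <-.
  rewrite muleA -EFinM mulVf ?mul1e; last by rewrite gt_eqF// wishart_const_gt0.
  apply: eq_integral => W _; rewrite /h -muleA -EFinM wishart_weightM addn0.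
  by [].
have Kp : wishart_const R p p != 0 by rewrite gt_eqF// wishart_const_gt0.
have Kp1 : wishart_const R p.+1 p != 0 by rewrite gt_eqF// wishart_const_gt0.
have pip k : pi ^+ k != 0 :> R by rewrite expf_neq0// gt_eqF ?pi_gt0.
set I := (\int[lamH p]_W (h (T ^t* *m W *m T) * (wishart_weight 0 W)%:E))%E in e2.
have eI : I = ((wishart_const R p.+1 p)^-1 * (r ^+ p * pi ^+ p))%:E.
  rewrite -[LHS]mul1e (_ : 1%E = ((wishart_const R p p)^-1 * wishart_const R p p)%:E); last first.
    by rewrite (mulVf Kp).
  rewrite EFinM -muleA e2 e3 -!EFinM; congr EFin.
  rewrite (_ : (p.+1 * p)%N = (p * p + p)%N) ?mulSn 1?addnC// exprD.
  move: (wishart_const _ _ _) (wishart_const _ _ _) (pi ^+ (p * p)) (pi ^+ p) (r ^+ p)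
    Kp Kp1 (pip (p * p)%N) => a b c e x a0 b0 c0.
  by field; rewrite c0 b0 a0.
have mI : meas
    (fun W => h (T ^t* *m W *m T) * (wishart_weight 0 W)%:E)%E.
  apply: emeasurable_funM => //; apply/measurable_EFinP; exact: measurable_wishart_weight.
have I0 W : (0 <= h (T ^t* *m W *m T) * (wishart_weight 0 W)%:E)%E.
  by rewrite mule_ge0// lee_fin wishart_weight_ge0.
have dV0 : 0 <= d^-1 by rewrite invr_ge0 ltW.
move: e1; rewrite -(ge0_integralZlT _ dV0 mI I0) -/I eI -!EFinM => -[].
rewrite qE => e; congr EFin; apply: (mulIf (expf_neq0 p (lt0r_neq0 r0))).
rewrite -exprS e mulrCA mulVKf// -[in RHS]mulrA; congr (_ * _).
by rewrite mulrC.
Qed.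

Lemma integral_mulmxr m (f : 'M[C]_(m, p) -> \bar R) :
  meas f -> (forall Z, 0 <= f Z)%E ->
  (\int[lam m p]_X f (X *m T) = (d ^- m)%:E * \int[lam m p]_X f X)%E.
Proof.
move=> mf f0; rewrite (mulr_raw mf f0) integral_gaussmx_mulr -/q q_det prodEFin.
rewrite prodr_const card_ord -EFinM; congr (_%:E * _)%E.
rewrite exprMn -exprM mulnC mulrCA mulVf ?mulr1 ?exprVn//.
by rewrite expf_neq0// gt_eqF ?pi_gt0.
Qed.

End mulr.

Lemma rdet_gram_tr p (T : 'M[C]_p) : rdet (T^T ^t* *m T^T) = rdet (T ^t* *m T).
Proof. by rewrite /rdet !det_gram det_tr. Qed.

Lemma rdet_gramM p (S T : 'M[C]_p) :
  rdet ((S *m T) ^t* *m (S *m T)) = rdet (S ^t* *m S) * rdet (T ^t* *m T).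
Proof.
rewrite adjmxM mulmxA -(mulmxA _ _ S) rdet_congr mulrC.
by [].
Qed.

Lemma integral_mulmxl m p (T : 'M[C]_m) (f : 'M[C]_(m, p) -> \bar R) :
  T \in unitmx -> meas f -> (forall Z, 0 <= f Z)%E ->
  (\int[lam m p]_X f (T *m X) = (rdet (T ^t* *m T) ^- p)%:E * \int[lam m p]_X f X)%E.
Proof.
move=> Tu mf f0.
have mT k l : meas (fun X : 'M[C]_(k, l) => X^T).
  exact: measurable_fun_trmx.
have mTl : meas (fun X : 'M[C]_(m, p) => T *m X).
  exact: measurable_fun_mulmx.
have TTu : T^T \in unitmx by rewrite unitmx_tr.
rewrite (integral_lebesgue_mxC_tr (measurableT_comp mf mTl) (fun X => f0 _)).
rewrite (integral_lebesgue_mxC_tr mf f0) -rdet_gram_tr.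
rewrite -(@integral_mulmxr m _ TTu p (fun X => f X^T) (measurableT_comp mf (mT _ _)) (fun X => f0 _)).
by apply: eq_integral => X _; rewrite trmx_mul trmxK.
Qed.

(** Lift through W = X^H X with X square, where the Wishart weight is the indicator of the cone: the
    congruence becomes X -> X T, of known Jacobian. *)
Lemma integral_herm_congr p (T : 'M[C]_p) (f : 'M[C]_p -> \bar R) :
  T \in unitmx -> meas f -> (forall Z, 0 <= f Z)%E ->
  (\int[lamH p]_W (f (T ^t* *m W *m T) * (wishart_weight 0 W)%:E) =
   (rdet (T ^t* *m T) ^- p)%:E * \int[lamH p]_W (f W * (wishart_weight 0 W)%:E))%E.
Proof.
move=> Tu mf f0.
have K0 := wishart_const_gt0 (leqnn p).
have KE (x y : \bar R) : ((wishart_const R p p)%:E * x = (wishart_const R p p)%:E * y -> x = y)%E.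
  move=> /(congr1 (fun z => ((wishart_const R p p)^-1)%:E * z)%E).
  by rewrite !muleA -EFinM mulVf ?gt_eqF// !mul1e.
have mc : meas (fun W : 'M[C]_p => T ^t* *m W *m T).
  by apply: measurable_fun_mulmx => //; exact: measurable_fun_mulmx.
have mfc := measurableT_comp mf mc.
have mfg : meas (fun X : 'M[C]_(p, p) => f (X ^t* *m X)).
  by apply: (measurableT_comp mf); exact: measurable_fun_gram.
apply: KE; rewrite muleCA.
have := @integral_wishart R p p _ (leqnn p) mfc (fun W => f0 _).
rewrite subnn => <-.
have := @integral_wishart R p p _ (leqnn p) mf f0.
rewrite subnn => <-.
rewrite -(integral_mulmxr Tu mfg (fun X => f0 _)).
by apply: eq_integral => X _ /=; congr f; rewrite adjmxM !mulmxA.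
Qed.

End jacobians.

Lemma ge0_integralZeT d (T : measurableType d) (R : realType)
    (mu : {measure set T -> \bar R}) (c : \bar R) (f : T -> \bar R) :
  (0 <= c)%E -> meas f -> (forall x, 0 <= f x)%E ->
  (c * \int[mu]_x f x = \int[mu]_x (c * f x))%E.
Proof. by move=> c0 mf f0; rewrite ge0_integralZl. Qed.

(** * Inversion on Hermitian matrices *)

Section inversion.
Variables (R : realType) (p : nat).
Local Notation C := R[i].
Local Notation lam m n := (@lebesgue_mxC R m n).
Local Notation lamH p := (@lebesgue_herm R p).
Implicit Types (X T : 'M[C]_p) (F : 'M[C]_p -> \bar R).

Lemma measurable_fun_unitmx d (U : measurableType d) (A : U -> 'M[C]_p) :
  meas A -> meas (fun u => A u \in unitmx).
Proof.
move=> mA; under eq_fun do rewrite unitmxE unitfE.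
apply: measurable_neg; apply: measurable_fun_eqC; last exact: measurable_cst.
exact: measurable_fun_det.
Qed.

(** |det X|^(-2p), the density of Haar measure of GL_p(C); the exponent offsets the Jacobians of X
    -> T X and X -> X T on square matrices. *)
Definition haar_weight X : R :=
  if X \in unitmx then (rdet (X ^t* *m X))^-1 ^+ p else 0.

Lemma haar_weight_ge0 X : 0 <= haar_weight X.
Proof.
rewrite /haar_weight; case: ifP => // Xu.
by rewrite exprn_ge0// invr_ge0 ltW// rdet_gram_gt0.
Qed.

Lemma measurable_haar_weight : meas haar_weight.
Proof.
apply: measurable_fun_ifT; [|apply: measurable_funX|exact: measurable_cst].
  exact: measurable_fun_unitmx.
apply: measurable_funV; apply: measurable_fun_rdet; exact: measurable_fun_gram.
Qed.

Let haar_map (L : 'M[C]_p -> 'M[C]_p) (d : R) F : 0 < d -> meas L ->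
  (forall X, haar_weight (L X) = d^-1 ^+ p * haar_weight X) ->
  (forall G, meas G -> (forall X, 0 <= G X)%E ->
    (\int[lam p p]_X G (L X) = (d ^- p)%:E * \int[lam p p]_X G X)%E) ->
  meas F -> (forall X, 0 <= F X)%E ->
  (\int[lam p p]_X (F (L X) * (haar_weight X)%:E) =
   \int[lam p p]_X (F X * (haar_weight X)%:E))%E.
Proof.
move=> d0 mL wL intL mF F0.
have mG : meas (fun X : 'M[C]_p => F X * (haar_weight X)%:E)%E.
  by apply: emeasurable_funM => //; apply/measurable_EFinP; exact: measurable_haar_weight.
have G0 X : (0 <= F X * (haar_weight X)%:E)%E by rewrite mule_ge0// lee_fin haar_weight_ge0.
have mGL : meas (fun X : 'M[C]_p => F (L X) * (haar_weight (L X))%:E)%E.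
  exact: (measurableT_comp mG mL).
have dp0 : 0 <= d ^+ p by rewrite exprn_ge0// ltW.
transitivity (\int[lam p p]_X ((d ^+ p)%:E *
    (F (L X) * (haar_weight (L X))%:E)))%E.
  apply: eq_integral => X _; rewrite wL muleCA -EFinM mulrA.
  by rewrite -exprMn mulfV ?gt_eqF// expr1n mul1r.
apply: (etrans (esym (ge0_integralZlT _ dp0 mGL (fun X => G0 _)))).
apply: (etrans (congr1 (fun z => (d ^+ p)%:E * z)%E (intL _ mG G0))).
by rewrite muleA -EFinM mulfV ?mul1e// expf_neq0// gt_eqF.
Qed.

Lemma haar_mull T F : T \in unitmx -> meas F -> (forall X, 0 <= F X)%E ->
  (\int[lam p p]_X (F (T *m X) * (haar_weight X)%:E) =
   \int[lam p p]_X (F X * (haar_weight X)%:E))%E.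
Proof.
move=> Tu; apply: (haar_map (L := fun X => T *m X) (rdet_gram_gt0 Tu)).
- exact: measurable_fun_mulmx.
- move=> X; rewrite /haar_weight unitmx_mul Tu/=; case: ifP => _; last by rewrite mulr0.
  by rewrite rdet_gramM invfM exprMn.
- by move=> G; exact: integral_mulmxl.
Qed.

Lemma haar_mulr T F : T \in unitmx -> meas F -> (forall X, 0 <= F X)%E ->
  (\int[lam p p]_X (F (X *m T) * (haar_weight X)%:E) =
   \int[lam p p]_X (F X * (haar_weight X)%:E))%E.
Proof.
move=> Tu; apply: (haar_map (L := fun X => X *m T) (rdet_gram_gt0 Tu)).
- exact: measurable_fun_mulmx.
- move=> X; rewrite /haar_weight unitmx_mul Tu andbT; case: ifP => _; last by rewrite mulr0.
  by rewrite rdet_gramM invfM exprMn mulrC.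
- by move=> G; exact: integral_mulmxr.
Qed.

Lemma gram_unitmx X : (X ^t* *m X \in unitmx) = (X \in unitmx).
Proof. by rewrite unitmx_mul adj_unitmx andbb. Qed.

(** The determinant undoes [haar_weight], so [b] integrates against Haar measure to the Gaussian
    mass, which is finite and nonzero and can be divided out. *)
Let b X : R := gaussmx X * rdet (X ^t* *m X) ^+ p.

Let b0 X : 0 <= b X.
Proof.
by rewrite mulr_ge0 ?gaussmx_ge0// exprn_ge0//; apply/psd_rdet_ge0/psdmx_gram.
Qed.

Let mb : meas b.
Proof.
apply: measurable_funM; first exact: measurable_gaussmx.
by apply: measurable_funX; apply: measurable_fun_rdet; exact: measurable_fun_gram.
Qed.

Let int_b : (\int[lam p p]_X ((b X)%:E * (haar_weight X)%:E) = (pi ^+ (p * p))%:E)%E.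
Proof.
(* Restricting to invertible W changes nothing on the Wishart side, whose weight lives on positive
   definite matrices. *)
pose f (W : 'M[C]_p) : R := if W \in unitmx then etr W else 0.
have mf : meas (fun W => (f W)%:E).
  apply/measurable_EFinP; apply: measurable_fun_ifT; last exact: measurable_cst.
    exact: measurable_fun_unitmx.
  exact: measurable_etr.
have f0 W : (0 <= (f W)%:E)%E by rewrite lee_fin /f; case: ifP; rewrite ?etr_ge0.
rewrite -(integral_etr_wishart R (leqnn p)) subnn.
have := integral_wishart (leqnn p) mf f0; rewrite subnn => e.
transitivity (\int[lam p p]_X (f (X ^t* *m X))%:E)%E.
  apply: eq_integral => X _; rewrite -EFinM /f gram_unitmx /haar_weight /b; congr EFin.
  case: ifP => Xu; last by rewrite mulr0.
  rewrite -mulrA -exprMn mulfV ?expr1n ?mulr1 ?gaussmx_etr//.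
  by rewrite gt_eqF// rdet_gram_gt0.
rewrite e; congr (_ * _)%E; apply: eq_integral => W _; rewrite /f /wishart_weight.
by case: posdefbP => [/posdef_unit ->|_]//; rewrite !mule0.
Qed.

(* Inversion invariance, from the double integral of a(x) b(yx) against the
   product of two bi-invariant measures. *)
Lemma haar_inv F : meas F -> (forall X, 0 <= F X)%E ->
  (\int[lam p p]_X (F (invmx X) * (haar_weight X)%:E) =
   \int[lam p p]_X (F X * (haar_weight X)%:E))%E.
Proof.
move=> mF F0; set w := haar_weight.
have w0 X : 0 <= w X by exact: haar_weight_ge0.
have mw : meas w by exact: measurable_haar_weight.
have wN X : X \notin unitmx -> w X = 0 by rewrite /w /haar_weight => /negbTE ->.
have mFw : meas (fun X : 'M[C]_p => F X * (w X)%:E)%E.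
  by apply: emeasurable_funM => //; exact/measurable_EFinP.
have Fw0 X : (0 <= F X * (w X)%:E)%E by rewrite mule_ge0// lee_fin.
have mbw : meas (fun X : 'M[C]_p => (b X)%:E * (w X)%:E)%E.
  by apply: emeasurable_funM; exact/measurable_EFinP.
have bw0 X : (0 <= (b X)%:E * (w X)%:E)%E by rewrite mule_ge0// lee_fin.
have mi : meas (@invmx C p) by exact: measurable_fun_invmx.
have mFi : meas (fun X : 'M[C]_p => F (invmx X)) by exact: (measurableT_comp mF mi).
have mFiw : meas (fun X : 'M[C]_p => F (invmx X) * (w X)%:E)%E.
  by apply: emeasurable_funM => //; exact/measurable_EFinP.
have m1 : meas (fun z : 'M[C]_p * 'M[C]_p => z.1) by exact: measurable_fst.
have m2 : meas (fun z : 'M[C]_p * 'M[C]_p => z.2) by exact: measurable_snd.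
have mw1 : meas (fun z : 'M[C]_p * 'M[C]_p => (w z.1)%:E).
  by apply/measurable_EFinP; exact: (measurableT_comp mw m1).
have mw2 : meas (fun z : 'M[C]_p * 'M[C]_p => (w z.2)%:E).
  by apply/measurable_EFinP; exact: (measurableT_comp mw m2).
have pip0 : 0 < pi ^+ (p * p) :> R by rewrite exprn_gt0// pi_gt0.
suff : ((\int[lam p p]_X (F X * (w X)%:E)) * (\int[lam p p]_X ((b X)%:E * (w X)%:E)) =
    (\int[lam p p]_X (F (invmx X) * (w X)%:E)) * \int[lam p p]_X ((b X)%:E * (w X)%:E))%E.
  rewrite int_b => /(congr1 (fun z => z * ((pi ^+ (p * p))^-1)%:E)%E).
  by rewrite -!muleA -EFinM mulfV ?mule1 ?gt_eqF.
have bxw0 x y : (0 <= (b (y *m x))%:E * (w y)%:E)%E by rewrite mule_ge0// lee_fin.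
(* Right invariance in y replaces b (y) by b (y x) for each invertible x. *)
transitivity (\int[lam p p]_x \int[lam p p]_y
    (F x * (w x)%:E * ((b (y *m x))%:E * (w y)%:E)))%E.
  rewrite -(integral_prod_mul _ _ mFw mbw Fw0 bw0); apply: eq_integral => x _.
  have [xu|xN] := boolP (x \in unitmx); last first.
    by apply: eq_integral => y _; rewrite (wN _ xN) mule0 !mul0e.
  have mbx : meas (fun y : 'M[C]_p => (b (y *m x))%:E).
    apply/measurable_EFinP; apply: (measurableT_comp mb); exact: measurable_fun_mulmx.
  have mbxw : meas (fun y : 'M[C]_p => (b (y *m x))%:E * (w y)%:E)%E.
    by apply: emeasurable_funM => //; exact/measurable_EFinP.
  apply: (etrans (esym (ge0_integralZeT _ (Fw0 x) mbw bw0))).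
  apply: (etrans _ (ge0_integralZeT _ (Fw0 x) mbxw (bxw0 x))).
  have mbE : meas (fun X : 'M[C]_p => (b X)%:E).
    exact/measurable_EFinP.
  by rewrite -(haar_mulr xu mbE (fun X => b0 X : (0 <= (b X)%:E)%E)).
have mb21 : meas (fun z : 'M[C]_p * 'M[C]_p => (b (z.2 *m z.1))%:E).
  by apply/measurable_EFinP; apply: (measurableT_comp mb); exact: measurable_fun_mulmx.
rewrite integral_swap; last 2 first.
- apply: emeasurable_funM; apply: emeasurable_funM.
  + exact: (measurableT_comp mF m1).
  + exact: mw1.
  + exact: mb21.
  + exact: mw2.
- by move=> x y; exact: (mule_ge0 (Fw0 x) (bxw0 x y)).
have mF21 : meas (fun z : 'M[C]_p * 'M[C]_p => F (invmx z.1 *m z.2)).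
  apply: (measurableT_comp mF); apply: measurable_fun_mulmx => //.
  exact: measurable_fun_invmx.
have mb2 : meas (fun z : 'M[C]_p * 'M[C]_p => (b z.2)%:E).
  by apply/measurable_EFinP; exact: (measurableT_comp mb m2).
(* Left invariance in x replaces x by y^-1 x, which frees b of y. *)
transitivity (\int[lam p p]_y \int[lam p p]_x
    (F (invmx y *m x) * ((b x)%:E * (w y)%:E) * (w x)%:E))%E.
  apply: eq_integral => y _.
  have [yu|yN] := boolP (y \in unitmx); last first.
    by apply: eq_integral => x _; rewrite (wN _ yN) !mule0 mul0e.
  have yiu : invmx y \in unitmx by rewrite unitmx_inv.
  have mFy : meas (fun x : 'M[C]_p => F x * ((b (y *m x))%:E * (w y)%:E))%E.
    apply: emeasurable_funM; first exact: mF.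
    apply: emeasurable_funM; last exact: measurable_cst.
    by apply/measurable_EFinP; apply: (measurableT_comp mb); exact: measurable_fun_mulmx.
  have Fy0 x : (0 <= F x * ((b (y *m x))%:E * (w y)%:E))%E.
    exact: (mule_ge0 (F0 x) (bxw0 x y)).
  transitivity (\int[lam p p]_x (F x * ((b (y *m x))%:E * (w y)%:E) * (w x)%:E))%E.
    by apply: eq_integral => x _; rewrite muleAC.
  apply: (etrans (esym (haar_mull yiu mFy Fy0))); apply: eq_integral => x _.
  by rewrite (mulKVmx yu).
rewrite integral_swap; last 2 first.
- apply: emeasurable_funM; last exact: mw2.
  apply: emeasurable_funM; first exact: mF21.
  by apply: emeasurable_funM; [exact: mb2|exact: mw1].
- move=> x y; rewrite mule_ge0 ?lee_fin// mule_ge0 ?F0//.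
  by rewrite -EFinM lee_fin mulr_ge0.
have Fiw0 X : (0 <= F (invmx X) * (w X)%:E)%E by rewrite mule_ge0// lee_fin.
rewrite [RHS]muleC -(integral_prod_mul _ _ mbw mFiw bw0 Fiw0).
apply: eq_integral => x _.
have [xu|xN] := boolP (x \in unitmx); last first.
  by apply: eq_integral => y _; rewrite (wN _ xN) !mule0 mul0e.
have mFx : meas (fun y : 'M[C]_p => F (invmx y *m x) * ((b x)%:E * (w x)%:E))%E.
  apply: emeasurable_funM; last exact: measurable_cst.
  apply: (measurableT_comp mF); apply: measurable_fun_mulmx.
    exact: measurable_fun_invmx.
  exact: measurable_cst.
have Fx0 y : (0 <= F (invmx y *m x) * ((b x)%:E * (w x)%:E))%E.
  exact: (mule_ge0 (F0 _) (bw0 x)).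
transitivity (\int[lam p p]_y (F (invmx y *m x) * ((b x)%:E * (w x)%:E) * (w y)%:E))%E.
  have comm4 (s t u v : \bar R) : (s * (t * u) * v = s * (t * v) * u)%E.
    by rewrite -!muleA (muleC u).
  by apply: eq_integral => y _; exact: comm4.
(* Left invariance in y replaces y by x y; as (x y)^-1 x = y^-1, the variables separate. *)
apply: (etrans (esym (haar_mull xu mFx Fx0))); apply: eq_integral => y _; rewrite -/w.
have [yu|yN] := boolP (y \in unitmx); last by rewrite (wN _ yN) !mule0.
have -> : invmx (x *m y) *m x = invmx y.
  have xyu : x *m y \in unitmx by rewrite unitmx_mul xu.
  by rewrite -{2}[x](mulmxK yu) (mulKmx xyu).
by rewrite -muleA muleCA.
Qed.

(** Lift through W = X^H X. Replacing X by its adjoint, the inverse of X X^H is the Gram matrix of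
    X^-1, so inversion of W becomes inversion in GL_p(C). The constant 1 is written as [haar_weight]
    of X^-1 times that of X; after inversion both factors are |W|^-p, whence |W|^(-2p). *)
Lemma integral_herm_inv F : meas F -> (forall X, 0 <= F X)%E ->
  (\int[lamH p]_W (F (invmx W) * (wishart_weight 0 W)%:E) =
   \int[lamH p]_W (F W * ((rdet W)^-1 ^+ (2 * p) * wishart_weight 0 W)%:E))%E.
Proof.
move=> mF F0.
have K0 := wishart_const_gt0 R (leqnn p).
have KE (x y : \bar R) : ((wishart_const R p p)%:E * x = (wishart_const R p p)%:E * y -> x = y)%E.
  move=> /(congr1 (fun z => ((wishart_const R p p)^-1)%:E * z)%E).
  by rewrite !muleA -EFinM mulVf ?gt_eqF// !mul1e.
pose c (W : 'M[C]_p) : R := if posdefb W then (rdet W)^-1 ^+ p else 0.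
have c0 W : 0 <= c W.
  rewrite /c; case: posdefbP => // /posdef_rdet_gt0 W0.
  by rewrite exprn_ge0// invr_ge0 ltW.
have mc : meas c.
  apply: measurable_fun_ifT; [exact: measurable_fun_posdefb|apply: measurable_funX|exact: measurable_cst].
  by apply: measurable_funV; exact: measurable_fun_rdet.
have mi : meas (@invmx C p) by exact: measurable_fun_invmx.
pose f1 (W : 'M[C]_p) : \bar R := (F (invmx W) * (wishart_weight 0 W)%:E)%E.
pose f2 (W : 'M[C]_p) : \bar R := (F W * (c W * c W)%:E)%E.
have mf1 : meas f1.
  apply: emeasurable_funM; first exact: (measurableT_comp mF mi).
  by apply/measurable_EFinP; exact: measurable_wishart_weight.
have mf2 : meas f2.
  apply: emeasurable_funM; first exact: mF.
  by apply/measurable_EFinP; apply: measurable_funM; exact: mc.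
have f10 W : (0 <= f1 W)%E by rewrite mule_ge0 ?F0// lee_fin wishart_weight_ge0.
have f20 W : (0 <= f2 W)%E by rewrite mule_ge0 ?F0// lee_fin mulr_ge0.
have cw (X : 'M[C]_p) : c (X ^t* *m X) = haar_weight X.
  rewrite /c /haar_weight; have [Xu|XN] := boolP (X \in unitmx).
    by case: posdefbP => // -[]; exact: posdef_gram.
  by case: posdefbP => // /posdef_unit; rewrite gram_unitmx (negbTE XN).
pose a (X : 'M[C]_p) : \bar R :=
  (F (X ^t* *m X) * (c (X ^t* *m X))%:E)%E.
have ma : meas a.
  have mg : meas (fun X : 'M[C]_p => X ^t* *m X) by exact: measurable_fun_gram.
  apply: emeasurable_funM; first exact: (measurableT_comp mF mg).
  by apply/measurable_EFinP; exact: (measurableT_comp mc mg).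
have a0 X : (0 <= a X)%E by rewrite mule_ge0 ?F0// lee_fin.
have ww (X : 'M[C]_p) : X \in unitmx -> haar_weight (invmx X) * haar_weight X = 1.
  move=> Xu; rewrite /haar_weight unitmx_inv Xu -exprMn -invfM -rdet_gramM.
  by rewrite (mulVmx Xu) adjmx1 mulmx1 /rdet det1 invr1 expr1n.
have wish0 (W : 'M[C]_p) : wishart_weight 0 W = if posdefb W then 1 else 0.
  by rewrite /wishart_weight expr0.
apply: KE; transitivity (\int[lam p p]_X f1 (X ^t* *m X))%E.
  have := integral_wishart (leqnn p) mf1 f10; rewrite subnn => ->.
  congr (_ * _)%E; apply: eq_integral => W _.
  by rewrite /f1 -muleA -EFinM wishart_weightM.
have mf1g : meas (fun X : 'M[C]_p => f1 (X ^t* *m X)).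
  by apply: (measurableT_comp mf1); exact: measurable_fun_gram.
rewrite (integral_lebesgue_mxC_adj mf1g (fun X => f10 _)).
transitivity (\int[lam p p]_X (a (invmx X) * (haar_weight X)%:E))%E.
  apply: eq_integral => X _; rewrite trmxCK.
  have [Xu|XN] := boolP (X \in unitmx); last first.
    rewrite /haar_weight (negbTE XN) mule0 /f1 wish0; case: posdefbP => [|_].
      by move=> /posdef_unit; rewrite unitmx_mul adj_unitmx (negbTE XN).
    by rewrite mule0.
  rewrite /a cw -muleA -EFinM ww// mule1 /f1 wish0.
  have Xau : X ^t* \in unitmx by rewrite adj_unitmx.
  have -> : posdefb (X *m X ^t* ).
    by apply/posdefbP; rewrite -{1}[X]trmxCK; exact: posdef_gram.
  rewrite mule1; congr F; rewrite adj_invmx.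
  have XXu : X *m X ^t* \in unitmx by rewrite unitmx_mul Xu Xau.
  have XX1 : X *m X ^t* *m (invmx (X ^t* ) *m invmx X) = 1%:M.
    by rewrite mulmxA -(mulmxA X) (mulmxV Xau) mulmx1 (mulmxV Xu).
  by rewrite -[RHS](mulKmx XXu) XX1 mulmx1.
rewrite haar_inv//.
transitivity (\int[lam p p]_X f2 (X ^t* *m X))%E.
  by apply: eq_integral => X _; rewrite /a /f2 cw -muleA -EFinM.
have := integral_wishart (leqnn p) mf2 f20; rewrite subnn => ->.
congr (_ * _)%E; apply: eq_integral => W _; rewrite /f2 -muleA -EFinM.
rewrite wish0 /c; case: ifP => _; last by rewrite !mulr0.
by rewrite !mulr1 -exprD mul2n addnn.
Qed.

End inversion.

(** * The matrix beta law of random projections *)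

Section projection_law.
Variable R : realType.
Local Notation C := R[i].
Local Notation lam m n := (@lebesgue_mxC R m n).
Local Notation lamH p := (@lebesgue_herm R p).

Lemma posdef_gram_unit n p (X : 'M[C]_(n, p)) : X ^t* *m X \in unitmx -> posdef (X ^t* *m X).
Proof. by move=> Xu; apply: psd_unit_posdef => //; exact: psdmx_gram. Qed.

(** With T a factor of the common Gram matrix, [gram_unitary] brings both matrices to T stacked over
    0. *)
Lemma gram_eq_unitary n p (X X' : 'M[C]_(n, p)) :
  X ^t* *m X \in unitmx -> X ^t* *m X = X' ^t* *m X' ->
  exists2 W : 'M[C]_n, W \is unitarymx & X = W *m X'.
Proof.
move=> Xu XX'; have [T Tu XT] := posdef_factor (posdef_gram_unit Xu).
have pn : (p <= n)%N.
  by rewrite -(mxrank_unit Xu) (leq_trans (mxrankM_maxr _ _)) ?rank_leq_row.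
have [l nE] : exists l, n = (p + l)%N by exists (n - p)%N; rewrite subnKC.
subst n.
have [W1 W1u XE] := gram_unitary Tu XT.
have [W2 W2u XE'] := gram_unitary Tu (etrans (esym XX') XT).
exists (W1 *m W2 ^t* ).
  by apply: mul_unitarymx; [exact: W1u|rewrite trmxC_unitary].
have W2i : W2 ^t* *m W2 = 1%:M by move: W2u; rewrite -trmxC_unitary => /unitarymxP; rewrite trmxCK.
by rewrite XE' -mulmxA (mulmxA (W2 ^t* )) W2i mul1mx.
Qed.

Lemma measurable_gramN n p : measurable [set X : 'M[C]_(n, p) | X ^t* *m X \notin unitmx].
Proof.
have m1 : meas (fun X : 'M[C]_(n, p) => X ^t* *m X \in unitmx).
  by apply: measurable_fun_unitmx; exact: measurable_fun_gram.
rewrite (_ : [set _ | _] = setT `&` (fun X : 'M[C]_(n, p) => X ^t* *m X \in unitmx) @^-1` [set false]).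
  exact: m1.
by rewrite setTI; apply/seteqP; split => X /=; [move/negbTE|move->].
Qed.

Let sing p (W : 'M[C]_p) : R := if W \in unitmx then 0 else 1.

Let msing p : meas (fun W : 'M[C]_p => (sing W)%:E).
Proof.
apply/measurable_EFinP; apply: measurable_fun_ifT; [|exact: measurable_cst..].
exact: measurable_fun_unitmx.
Qed.

Let sing0 p (W : 'M[C]_p) : (0 <= (sing W)%:E)%E.
Proof. by rewrite lee_fin /sing; case: ifP. Qed.

(** The Wishart formula carries all the mass on the open cone, where no matrix is singular. *)
Let integral_sing n p : (p <= n)%N -> (\int[lam n p]_X (sing (X ^t* *m X))%:E = 0)%E.
Proof.
move=> pn; rewrite (integral_wishart pn (@msing p) (@sing0 p)).
rewrite [X in (_ * X)%E]integral0_eq ?mule0// => W _.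
rewrite /sing /wishart_weight; case: posdefbP => [/posdef_unit ->|_]; first by rewrite mul0e.
by rewrite mule0.
Qed.

Lemma lebesgue_gramN n p : (p <= n)%N ->
  lam n p [set X | X ^t* *m X \notin unitmx] = 0%E.
Proof.
move=> pn; rewrite -[X in lam n p X]setIT -integral_indic//; last exact: measurable_gramN.
rewrite -(integral_sing pn).
apply: eq_integral => X _; rewrite indicE /sing; congr EFin.
by case: ifPn => XX; [rewrite memNset//=; apply/negP; rewrite negbK|rewrite mem_set].
Qed.

Lemma measurable_gram_adjN m n : measurable [set A : 'M[C]_(m, n) | A *m A ^t* \notin unitmx].
Proof.
have m1 : meas (fun A : 'M[C]_(m, n) => A *m A ^t* \in unitmx).
  apply: measurable_fun_unitmx; apply: measurable_fun_mulmx => //.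
  exact: measurable_fun_adjmx.
rewrite (_ : [set _ | _] = setT `&` (fun A : 'M[C]_(m, n) => A *m A ^t* \in unitmx) @^-1` [set false]).
  exact: m1.
by rewrite setTI; apply/seteqP; split => A /=; [move/negbTE|move->].
Qed.

Lemma lebesgue_gram_adjN m n : (m <= n)%N ->
  lam m n [set A | A *m A ^t* \notin unitmx] = 0%E.
Proof.
move=> mn; rewrite -[X in lam m n X]setIT -integral_indic//; last exact: measurable_gram_adjN.
have ms : meas (fun Z : 'M[C]_(n, m) => (sing (Z ^t* *m Z))%:E).
  by apply: (measurableT_comp (@msing m)); exact: measurable_fun_gram.
rewrite -(integral_sing mn) (integral_lebesgue_mxC_adj ms (fun Z => sing0 _)).
apply: eq_integral => A _; rewrite indicE /sing trmxCK; congr EFin.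
by case: ifPn => XX; [rewrite memNset//=; apply/negP; rewrite negbK|rewrite mem_set].
Qed.

Lemma measurable_fun_row_proj d (U : measurableType d) m n (A : U -> 'M[C]_(m, n)) :
  meas A -> meas (fun u => row_proj (A u)).
Proof.
move=> mA; have mAa := measurable_fun_adjmx mA.
apply: measurable_fun_mulmx => //; apply: measurable_fun_mulmx => //.
by apply: measurable_fun_invmx; exact: measurable_fun_mulmx.
Qed.

Section two_blocks.
Variables (m l p : nat) (k : 'M[C]_p -> 'M[C]_p -> \bar R).
Hypotheses (pm : (p <= m)%N) (pl : (p <= l)%N).
Hypothesis mk : meas (fun z : 'M[C]_p * 'M[C]_p => k z.1 z.2).
Hypothesis k0 : forall V J, (0 <= k V J)%E.

(** The Wishart formula is applied to X2 and then to X1; for fixed V the translation W -> J = V + W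
    has Jacobian 1. *)
Lemma integral_two_wishart :
  (\int[lam (m + l) p]_X k ((usubmx X) ^t* *m usubmx X) (X ^t* *m X) =
   (wishart_const R m p * wishart_const R l p)%:E *
   \int[lamH p]_J \int[lamH p]_V (k V J *
     (wishart_weight (m - p) V * wishart_weight (l - p) (J - V))%:E))%E.
Proof.
have mkc d (U : measurableType d) (A B : U -> 'M[C]_p) :
    meas A -> meas B ->
    meas (fun u => k (A u) (B u)).
  by move=> mA mB; exact: (measurableT_comp mk (measurable_fun_pair mA mB)).
have mw j d (U : measurableType d) (A : U -> 'M[C]_p) :
    meas A -> meas (fun u => (wishart_weight j (A u))%:E).
  move=> mA; apply/measurable_EFinP.
  exact: (measurableT_comp (@measurable_wishart_weight R j p) mA).
have w0 j (W : 'M[C]_p) : (0 <= (wishart_weight j W)%:E)%E.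
  by rewrite lee_fin wishart_weight_ge0.
have msub : meas (fun z : 'M[C]_p * 'M[C]_p => z.2 - z.1).
  apply: measurable_fun_addmx; first exact: measurable_snd.
  by apply: measurable_fun_oppmx; exact: measurable_fst.
have m1 : meas (fun z : 'M[C]_p * 'M[C]_p => z.1) by exact: measurable_fst.
have m2 : meas (fun z : 'M[C]_p * 'M[C]_p => z.2) by exact: measurable_snd.
pose f1 (X1 : 'M[C]_(m, p)) (W : 'M[C]_p) := k (X1 ^t* *m X1) (X1 ^t* *m X1 + W).
rewrite (@integral_lebesgue_mxC_col R m l p
  (fun X => k ((usubmx X) ^t* *m usubmx X) (X ^t* *m X))); last 2 first.
- apply: mkc; apply: measurable_fun_gram => //; exact: measurable_fun_usubmx.
- by move=> X; exact: k0.
transitivity (\int[lam m p]_X1 ((wishart_const R l p)%:E *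
    \int[lamH p]_W (k (X1 ^t* *m X1) (X1 ^t* *m X1 + W) * (wishart_weight (l - p) W)%:E)))%E.
  apply: eq_integral => X1 _.
  rewrite -(@integral_wishart R l p (f1 X1) pl); last 2 first.
  - by apply: mkc; [exact: measurable_cst|exact: measurable_fun_addmx].
  - by move=> W; exact: k0.
  apply: eq_integral => X2 _; rewrite /f1 col_mxKu; congr (k _ _).
  by rewrite adj_col_mx mul_row_col.
pose f2 (V : 'M[C]_p) : \bar R :=
  (\int[lamH p]_W (k V (V + W)%R * (wishart_weight (l - p) W)%:E))%E.
have f20 V : (0 <= f2 V)%E by apply: integral_ge0 => W _; rewrite mule_ge0.
have mf2 : meas f2.
  apply: (@measurable_integral_snd _ _ _ _ _ _ (fun V W : 'M[C]_p =>
    k V (V + W)%R * (wishart_weight (l - p) W)%:E)%E).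
    apply: emeasurable_funM; last exact: mw.
    by apply: mkc; [exact: m1|exact: measurable_fun_addmx].
  by move=> V W; rewrite mule_ge0.
have mf2g : meas (fun X1 : 'M[C]_(m, p) => f2 (X1 ^t* *m X1)).
  by apply: (measurableT_comp mf2); exact: measurable_fun_gram.
rewrite -(ge0_integralZlT _ (wishart_const_ge0 R pl) mf2g (fun X1 => f20 _)).
rewrite (integral_wishart pm mf2 f20) muleA -EFinM mulrC; congr (_ * _)%E.
have mk2 : meas (fun z : 'M[C]_p * 'M[C]_p => (k z.1 z.2 *
     (wishart_weight (m - p) z.1 * wishart_weight (l - p) (z.2 - z.1))%:E)%E).
  apply: emeasurable_funM; first exact: mk.
  by under eq_fun do rewrite EFinM; apply: emeasurable_funM; apply: mw;
    [exact: m1|exact: msub].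
rewrite [RHS]integral_swap; last 2 first.
- exact: (measurableT_comp mk2 (measurable_fun_pair m2 m1)).
- move=> J V; apply: mule_ge0; first exact: k0.
  by rewrite lee_fin mulr_ge0 ?wishart_weight_ge0.
apply: eq_integral => V _.
(* For V off the cone both sides vanish; on it V is Hermitian, so that the translation is
   admissible. *)
have [pV|pV] := boolP (posdefb V); last first.
  rewrite /wishart_weight (negbTE pV) mule0; apply/esym; apply: integral0_eq => J _.
  by rewrite mul0r mule0.
have VN : (- V) ^t* = - V by rewrite adjmxN; move/posdefbP: pV => [-> _].
rewrite /f2 (integral_lebesgue_hermD
  (f := fun W => (k V (V + W)%R * (wishart_weight (l - p) W)%:E)%E) VN); last 2 first.
- apply: emeasurable_funM; last exact: mw.
  by apply: mkc; [exact: measurable_cst|exact: measurable_fun_addmx].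
- by move=> W; rewrite mule_ge0.
rewrite -ge0_integralZr//; last 2 first.
- apply: emeasurable_funM.
    by apply: mkc; [exact: measurable_cst|];
      apply: measurable_fun_addmx => //; exact: measurable_fun_addmx.
  by apply: mw; exact: measurable_fun_addmx.
- by move=> J _; rewrite mule_ge0.
apply: eq_integral => J _; rewrite addrC subrK -muleA -EFinM.
by rewrite (mulrC (wishart_weight _ V)).
Qed.

End two_blocks.
End projection_law.

(** * Beta weights and averaging over orthonormal frames *)

Section projection_density.
Variable R : realType.
Local Notation C := R[i].
Local Notation lam m n := (@lebesgue_mxC R m n).
Local Notation lamH p := (@lebesgue_herm R p).

Definition beta_weight a b p (J V : 'M[C]_p) : R :=
  wishart_weight a V * wishart_weight b (J - V).

Lemma beta_weight_ge0 a b p (J V : 'M[C]_p) : 0 <= beta_weight a b J V.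
Proof. by rewrite mulr_ge0 ?wishart_weight_ge0. Qed.

Lemma measurable_fun_beta_weight a b p d (U : measurableType d) (J V : U -> 'M[C]_p) :
  meas J -> meas V ->
  meas (fun u => beta_weight a b (J u) (V u)).
Proof.
move=> mJ mV; apply: measurable_funM.
  exact: (measurableT_comp (@measurable_wishart_weight R a p) mV).
apply: (measurableT_comp (@measurable_wishart_weight R b p)).
by apply: measurable_fun_addmx => //; exact: measurable_fun_oppmx.
Qed.

Lemma beta_weight_congr a b p (T V : 'M[C]_p) : T \in unitmx ->
  beta_weight a b (T ^t* *m T) (T ^t* *m V *m T) =
  rdet (T ^t* *m T) ^+ (a + b) * beta_weight a b 1%:M V.
Proof.
move=> Tu; rewrite /beta_weight wishart_weight_congr//.
have -> : T ^t* *m T - T ^t* *m V *m T = T ^t* *m (1%:M - V) *m T.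
  by rewrite mulmxBr mulmxBl mulmx1.
by rewrite wishart_weight_congr// mulrACA exprD.
Qed.

(** In the exponent, a + b is the homogeneity of the beta weight and p the Jacobian of the
    congruence. The indicator of the cone in [integral_herm_congr] is already contained in the beta
    weight. *)
Lemma integral_beta_congr a b p (T : 'M[C]_p) (h : 'M[C]_p -> \bar R) :
  T \in unitmx -> meas h -> (forall V, 0 <= h V)%E ->
  (\int[lamH p]_V (h (T ^t* *m V *m T) * (beta_weight a b 1%:M V)%:E) =
   (rdet (T ^t* *m T) ^- (a + b + p))%:E *
   \int[lamH p]_V (h V * (beta_weight a b (T ^t* *m T) V)%:E))%E.
Proof.
move=> Tu mh h0; set d := rdet _; have d0 : 0 < d by exact: rdet_gram_gt0.
pose f V : \bar R := (h V * (beta_weight a b (T ^t* *m T) V)%:E)%E.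
have mf : meas f.
  apply: emeasurable_funM; first exact: mh.
  by apply/measurable_EFinP; exact: measurable_fun_beta_weight.
have f0 V : (0 <= f V)%E by rewrite mule_ge0// lee_fin beta_weight_ge0.
have fw V : (f V * (wishart_weight 0 V)%:E)%E = f V.
  rewrite /f -muleA -EFinM /beta_weight mulrAC wishart_weightM addn0.
  by [].
have mc : meas (fun W : 'M[C]_p => T ^t* *m W *m T).
  by apply: measurable_fun_mulmx => //; exact: measurable_fun_mulmx.
have mfc : meas (fun V => f (T ^t* *m V *m T) * (wishart_weight 0 V)%:E)%E.
  apply: emeasurable_funM; first exact: (measurableT_comp mf mc).
  apply/measurable_EFinP; exact: measurable_wishart_weight.
have fc0 V : (0 <= f (T ^t* *m V *m T) * (wishart_weight 0 V)%:E)%E.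
  by rewrite mule_ge0// lee_fin wishart_weight_ge0.
have dV0 : 0 <= d^-1 ^+ (a + b) by rewrite exprn_ge0// invr_ge0 ltW.
transitivity ((d^-1 ^+ (a + b))%:E *
    \int[lamH p]_V (f (T ^t* *m V *m T) * (wishart_weight 0 V)%:E))%E.
  rewrite (ge0_integralZlT _ dV0 mfc fc0); apply: eq_integral => V _.
  rewrite /f beta_weight_congr// -/d -!muleA.
  rewrite [in RHS](muleCA (d^-1 ^+ _)%:E); congr (_ * _)%E.
  rewrite -!EFinM; congr EFin; rewrite /beta_weight.
  rewrite -!mulrA [in RHS](mulrC _ (wishart_weight 0 V)).
  rewrite [in RHS](mulrA (wishart_weight a V)) wishart_weightM addn0.
  by rewrite mulrA -exprMn mulVf ?gt_eqF// expr1n mul1r.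
rewrite (integral_herm_congr Tu mf f0) -/d muleA -EFinM.
rewrite -!exprVn -exprD; congr (_ * _)%E.
by apply: eq_integral => V _; rewrite fw.
Qed.

Section fixed_frame.
Variables (m l p : nat) (pm : (p <= m)%N) (pl : (p <= l)%N).
Variables (g : 'M[C]_m -> R) (h : 'M[C]_p -> \bar R).
Hypothesis mg : meas (fun A : 'M[C]_(m, m + l) => g (A *m A ^t* )).
Hypothesis g0 : forall A : 'M[C]_(m, m + l), 0 <= g (A *m A ^t* ).
Hypothesis g1 : (\int[lam m (m + l)]_A (g (A *m A ^t* ))%:E = 1)%E.
Hypothesis mh : meas h.
Hypothesis h0 : forall V, (0 <= h V)%E.

Let n := (m + l)%N.
Let F (Y : 'M[C]_(n, p)) (A : 'M[C]_(m, n)) : \bar R :=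
  (h (Y ^t* *m row_proj A *m Y) * (g (A *m A ^t* ))%:E)%E.

Let F0 Y A : (0 <= F Y A)%E. Proof. by rewrite mule_ge0// lee_fin g0. Qed.

Let mF d (U : measurableType d) (Y : U -> 'M[C]_(n, p)) (A : U -> 'M[C]_(m, n)) :
  meas Y -> meas A ->
  meas (fun u => F (Y u) (A u)).
Proof.
move=> mY mA; have mYa := measurable_fun_adjmx mY.
apply: emeasurable_funM.
  apply: (measurableT_comp mh); apply: measurable_fun_mulmx => //.
  by apply: measurable_fun_mulmx => //; exact: measurable_fun_row_proj.
by apply/measurable_EFinP; exact: (measurableT_comp mg mA).
Qed.

(** Y = W Y' with W unitary, and the substitution A -> A W transfers W to A while preserving both A
    A^H and Lebesgue measure. *)
Let orthonormal_frames (Y Y' : 'M[C]_(n, p)) :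
  Y ^t* *m Y = 1%:M -> Y' ^t* *m Y' = 1%:M ->
  (\int[lam m n]_A F Y A = \int[lam m n]_A F Y' A)%E.
Proof.
move=> Y1 Y'1.
have Yu : Y ^t* *m Y \in unitmx by rewrite Y1 unitmx1.
have [W Wu ->] := gram_eq_unitary Yu (etrans Y1 (esym Y'1)).
have mFY : meas (F Y') by apply: mF => //; exact: measurable_cst.
rewrite -(integral_lebesgue_mxC_unitaryr Wu mFY (F0 Y')).
apply: eq_integral => A _; rewrite /F (row_proj_unitaryr A Wu) !adjmxM !mulmxA.
by rewrite -(mulmxA A W) (unitarymxP Wu) mulmx1.
Qed.

(** Right factor making the columns of X orthonormal. It depends on X only through X^H X, hence is
    unchanged when a unitary matrix acts on X from the left; [proj_side] relies on this. *)
Let S (X : 'M[C]_(n, p)) : 'M[C]_p := invmx (cholesky (X ^t* *m X)).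

Let pn : (p <= n)%N. Proof. exact: (leq_trans pm (leq_addr _ _)). Qed.

Let SP (X : 'M[C]_(n, p)) : X ^t* *m X \in unitmx -> (X *m S X) ^t* *m (X *m S X) = 1%:M.
Proof.
move=> Xu; have [Tu TT] := choleskyP (posdef_gram_unit Xu).
rewrite adjmxM mulmxA -(mulmxA _ (X ^t* )) /S adj_invmx.
move: Tu TT; move: (cholesky _) => T Tu TT; rewrite -TT.
have Tau : T ^t* \in unitmx by rewrite adj_unitmx.
by rewrite mulmxA (mulVmx Tau) mul1mx (mulmxV Tu).
Qed.

Let mS : meas S.
Proof.
apply: measurable_fun_invmx; apply: measurable_fun_cholesky.
exact: measurable_fun_gram.
Qed.

Let mFS : meas (fun z : 'M[C]_(n, p) * 'M[C]_(m, n) =>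
  (F (z.1 *m S z.1) z.2 * (gaussmx z.1)%:E)%E).
Proof.
have m1 : meas (fun z : 'M[C]_(n, p) * 'M[C]_(m, n) => z.1).
  exact: measurable_fst.
apply: emeasurable_funM.
  apply: mF; last exact: measurable_snd.
  by apply: measurable_fun_mulmx => //; exact: (measurableT_comp mS m1).
by apply/measurable_EFinP; exact: (measurableT_comp (@measurable_gaussmx R n p) m1).
Qed.

Let FS0 X A : (0 <= F (X *m S X) A * (gaussmx X)%:E)%E.
Proof. by apply: mule_ge0; [exact: F0|rewrite lee_fin gaussmx_ge0]. Qed.

(** For almost every X the inner integral is the one at Y, by independence of the frame, and the
    Gaussian mass factors out. *)
Let frame_side (Y : 'M[C]_(n, p)) : Y ^t* *m Y = 1%:M ->
  (\int[lam n p]_X \int[lam m n]_A (F (X *m S X) A * (gaussmx X)%:E) =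
   (pi ^+ (n * p))%:E * \int[lam m n]_A F Y A)%E.
Proof.
move=> Y1; set c := (\int[lam m n]_A F Y A)%E.
have c0 : (0 <= c)%E by apply: integral_ge0 => A _; exact: F0.
have mgE : meas (fun X : 'M[C]_(n, p) => (gaussmx X)%:E).
  by apply/measurable_EFinP; exact: measurable_gaussmx.
have gE0 (X : 'M[C]_(n, p)) : (0 <= (gaussmx X)%:E)%E by rewrite lee_fin gaussmx_ge0.
rewrite -integral_gaussmx muleC (ge0_integralZeT _ c0 mgE gE0).
apply: (ge0_integral_eq_off (@measurable_gramN R n p) (lebesgue_gramN R pn)).
- exact: (@measurable_integral_snd _ _ _ _ _ (lam m n)
    (fun (X : 'M[C]_(n, p)) (A : 'M[C]_(m, n)) => F (X *m S X) A * (gaussmx X)%:E)%E mFS FS0).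
- by apply: emeasurable_funM => //; exact: measurable_cst.
- by move=> X; apply: integral_ge0 => A _; exact: FS0.
- by move=> X; rewrite mule_ge0.
move=> X /= /negP; rewrite negbK => Xu.
have mFX : meas (F (X *m S X)) by apply: mF => //; exact: measurable_cst.
have -> : c = (\int[lam m n]_A F (X *m S X) A)%E := orthonormal_frames Y1 (SP Xu).
rewrite muleC (ge0_integralZeT _ (gE0 X) mFX (F0 _)).
by apply: eq_integral => A _; rewrite muleC.
Qed.

Let B : \bar R := (\int[lamH p]_V (h V * (beta_weight (m - p) (l - p) 1%:M V)%:E))%E.

(** The integrand of the double integral once the projection has become the selection of the first m
    rows: V is the Gram matrix of the upper block, J that of X. *)
Let k (V J : 'M[C]_p) : \bar R :=
  (h ((invmx (cholesky J)) ^t* *m V *m invmx (cholesky J)) * (etr J)%:E)%E.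

Let mk : meas (fun z : 'M[C]_p * 'M[C]_p => k z.1 z.2).
Proof.
have m1 : meas (fun z : 'M[C]_p * 'M[C]_p => z.1) by exact: measurable_fst.
have m2 : meas (fun z : 'M[C]_p * 'M[C]_p => z.2) by exact: measurable_snd.
have mi : meas (fun z : 'M[C]_p * 'M[C]_p => invmx (cholesky z.2)).
  by apply: measurable_fun_invmx; exact: measurable_fun_cholesky.
have mia := measurable_fun_adjmx mi.
apply: emeasurable_funM.
  apply: (measurableT_comp mh); apply: measurable_fun_mulmx => //.
  exact: measurable_fun_mulmx.
by apply/measurable_EFinP; exact: (measurableT_comp (@measurable_etr R p) m2).
Qed.

Let k0 V J : (0 <= k V J)%E.
Proof. by apply: mule_ge0; [exact: h0|rewrite lee_fin etr_ge0]. Qed.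

(** Congruence by T = [cholesky J] carries the beta weight at J to the one at 1, whose integral B
    does not involve J. The power of |J| released on the way is the Wishart weight of an n-row Gram
    matrix. *)
Let inner (J : 'M[C]_p) :
  (\int[lamH p]_V (k V J * (wishart_weight (m - p) V * wishart_weight (l - p) (J - V))%:E) =
   B * (etr J * wishart_weight (n - p) J)%:E)%E.
Proof.
(* Off the cone both sides vanish: V and J - V positive definite would make J so. *)
have [pJ|pJ] := boolP (posdefb J); last first.
  rewrite /wishart_weight (negbTE pJ) mulr0 mule0; apply: integral0_eq => V _.
  case: posdefbP => [pV|_]; last by rewrite mul0r mule0.
  case: posdefbP => [pJV|_]; last by rewrite mulr0 mule0.
  case/posdefbP: pJ; rewrite -(subrK V J) addrC; apply: posdefDl => //.
  exact: posdef_psd.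
have /posdefbP pdJ := pJ; have [Tu TT] := choleskyP pdJ.
pose T := cholesky J; rewrite -/T in Tu TT.
have Tau : T ^t* \in unitmx by rewrite adj_unitmx.
pose h' (V : 'M[C]_p) := h ((invmx T) ^t* *m V *m invmx T).
have mh' : meas h'.
  apply: (measurableT_comp mh); apply: measurable_fun_mulmx => //.
  exact: measurable_fun_mulmx.
have -> : B = (\int[lamH p]_V (h' (T ^t* *m V *m T) *
    (beta_weight (m - p) (l - p) 1%:M V)%:E))%E.
  apply: eq_integral => V _; rewrite /h' !mulmxA adj_invmx (mulVmx Tau) mul1mx.
  by rewrite -mulmxA (mulmxV Tu) mulmx1.
have e := integral_beta_congr (m - p) (l - p) Tu mh' (fun V => h0 _).
rewrite {}e TT.
have mhb : meas (fun V => h' V * (beta_weight (m - p) (l - p) J V)%:E)%E.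
  apply: emeasurable_funM; first exact: mh'.
  by apply/measurable_EFinP; apply: measurable_fun_beta_weight.
have hb0 V : (0 <= h' V * (beta_weight (m - p) (l - p) J V)%:E)%E.
  by apply: mule_ge0; [exact: h0|rewrite lee_fin beta_weight_ge0].
rewrite muleAC -EFinM.
(* (m - p) + (l - p) + p = n - p, exact because p <= m and p <= l. *)
have -> : rdet J ^- (m - p + (l - p) + p) * (etr J * wishart_weight (n - p) J) = etr J.
  have -> : (m - p + (l - p) + p = n - p)%N by rewrite -addnA subnK// /n addnBAC.
  rewrite /wishart_weight pJ mulrCA mulVf ?mulr1// expf_neq0// gt_eqF//.
  exact: posdef_rdet_gt0.
rewrite (ge0_integralZlT _ (etr_ge0 J) mhb hb0); apply: eq_integral => V _.
by rewrite /k -/T -/(h' V) [RHS]muleCA muleA.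
Qed.

(** The J-integral left over is the mass pi^(np) of the n x p Gaussian divided by its Wishart
    constant. *)
Let blocks : (\int[lam n p]_X k ((usubmx X) ^t* *m usubmx X) (X ^t* *m X) =
  (wishart_const R m p * wishart_const R l p / wishart_const R n p * pi ^+ (n * p))%:E * B)%E.
Proof.
have B0 : (0 <= B)%E.
  by apply: integral_ge0 => V _; apply: mule_ge0; [exact: h0|rewrite lee_fin beta_weight_ge0].
rewrite (integral_two_wishart pm pl mk k0).
have e : (\int[lamH p]_J \int[lamH p]_V (k V J *
     (wishart_weight (m - p) V * wishart_weight (l - p) (J - V))%:E) =
   B * \int[lamH p]_J ((etr J)%:E * (wishart_weight (n - p) J)%:E))%E.
  rewrite (ge0_integralZeT _ B0).
  - by apply: eq_integral => J _; rewrite inner EFinM.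
  - apply: emeasurable_funM; apply/measurable_EFinP; first exact: measurable_etr.
    exact: measurable_wishart_weight.
  - by move=> J; rewrite -EFinM lee_fin mulr_ge0 ?etr_ge0 ?wishart_weight_ge0.
rewrite {}e; have c0 := wishart_const_gt0 R pn.
have -> : (\int[lamH p]_J ((etr J)%:E * (wishart_weight (n - p) J)%:E) =
    ((wishart_const R n p)^-1 * pi ^+ (n * p))%:E)%E.
  rewrite [RHS]EFinM -(integral_etr_wishart R pn) muleA -EFinM mulVf ?gt_eqF//.
  by rewrite mul1e.
by rewrite muleC -muleA -EFinM muleC mulrC !mulrA.
Qed.

(** When A A^H is invertible, a unitary U turns the projection into the selection of the first m
    rows of U X, and X -> U X preserves X^H X. The X-integral is then a constant times g, and g has
    mass 1. *)
Let proj_side :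
  (\int[lam m n]_A \int[lam n p]_X (F (X *m S X) A * (gaussmx X)%:E) =
   (wishart_const R m p * wishart_const R l p / wishart_const R n p * pi ^+ (n * p))%:E * B)%E.
Proof.
rewrite -blocks; set c := (\int[lam n p]_X _)%E.
have c0 : (0 <= c)%E by apply: integral_ge0 => X _; exact: k0.
have gE0 (A : 'M[C]_(m, n)) : (0 <= (g (A *m A ^t* ))%:E)%E by rewrite lee_fin g0.
have mgE : meas (fun A : 'M[C]_(m, n) => (g (A *m A ^t* ))%:E).
  exact/measurable_EFinP.
rewrite -[RHS]mule1 -g1 (ge0_integralZeT _ c0 mgE gE0).
pose N : set 'M[C]_(m, n) := [set A | A *m A ^t* \notin unitmx].
have mN : measurable N by exact: measurable_gram_adjN.
have N0 : lam m n N = 0%E by exact: lebesgue_gram_adjN (leq_addr l m).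
apply: (ge0_integral_eq_off mN N0).
- exact: (@measurable_integral_fst _ _ _ _ _ (lam n p)
    (fun (X : 'M[C]_(n, p)) (A : 'M[C]_(m, n)) => F (X *m S X) A * (gaussmx X)%:E)%E mFS FS0).
- by apply: emeasurable_funM => //; exact: measurable_cst.
- by move=> A; apply: integral_ge0 => X _; exact: FS0.
- by move=> A; apply: mule_ge0.
move=> A /negP; rewrite negbK => Au.
have [U Uu UP] := row_proj_unitary Au.
have mk1 : meas
    (fun X : 'M[C]_(n, p) => k ((usubmx X) ^t* *m usubmx X) (X ^t* *m X)).
  apply: (measurableT_comp mk (measurable_fun_pair _ _)); apply: measurable_fun_gram => //.
  exact: measurable_fun_usubmx.
rewrite muleC /c -(integral_lebesgue_mxC_unitaryl Uu mk1 (fun X => k0 _ _)).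
rewrite (ge0_integralZeT _ (gE0 A)); last 2 first.
- by apply: (measurableT_comp mk1); exact: measurable_fun_mulmx.
- by move=> X; exact: k0.
apply: eq_integral => X _.
have UX : (U *m X) ^t* *m (U *m X) = X ^t* *m X.
  have U1 : U ^t* *m U = 1%:M.
    by move: Uu; rewrite -trmxC_unitary => /unitarymxP; rewrite trmxCK.
  by rewrite adjmxM mulmxA -(mulmxA _ (U ^t* )) U1 mulmx1.
rewrite /k UX -UP gaussmx_etr /F /S muleA; congr (_ * _)%E.
by rewrite muleC adjmxM !mulmxA.
Qed.

Lemma integral_proj_frame (Y : 'M[C]_(n, p)) : Y ^t* *m Y = 1%:M ->
  (\int[lam m n]_A (h (Y ^t* *m row_proj A *m Y) * (g (A *m A ^t* ))%:E) =
   (wishart_const R m p * wishart_const R l p / wishart_const R n p)%:E *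
   \int[lamH p]_V (h V * (beta_weight (m - p) (l - p) 1%:M V)%:E))%E.
Proof.
move=> Y1; have pi0 : 0 < pi ^+ (n * p) :> R by rewrite exprn_gt0// pi_gt0.
have e : ((pi ^+ (n * p))%:E * \int[lam m n]_A F Y A =
    (wishart_const R m p * wishart_const R l p / wishart_const R n p * pi ^+ (n * p))%:E * B)%E.
  rewrite -(frame_side Y1) -proj_side.
  exact: (@integral_swap _ _ _ _ _ (lam n p) (lam m n) _ mFS FS0).
rewrite -[LHS]mul1e -(mulVf (lt0r_neq0 pi0)) EFinM -muleA e muleA -EFinM mulrC.
by rewrite mulfK// gt_eqF.
Qed.

End fixed_frame.

(** Write G = Y T with Y orthonormal and T a factor of G^H G. The orthonormal case is applied to h
    precomposed with the congruence by T; [integral_beta_congr] undoes the congruence and yields the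
    power of the determinant. *)
Lemma integral_projection m l p (g : 'M[C]_m -> R) (h : 'M[C]_p -> \bar R)
    (G : 'M[C]_(m + l, p)) :
  (p <= m)%N -> (p <= l)%N ->
  meas (fun A : 'M[C]_(m, m + l) => g (A *m A ^t* )) ->
  (forall A : 'M[C]_(m, m + l), 0 <= g (A *m A ^t* )) ->
  (\int[lam m (m + l)]_A (g (A *m A ^t* ))%:E = 1)%E ->
  meas h -> (forall V, (0 <= h V)%E) ->
  G ^t* *m G \in unitmx ->
  (\int[lam m (m + l)]_A (h (G ^t* *m row_proj A *m G) * (g (A *m A ^t* ))%:E) =
   (wishart_const R m p * wishart_const R l p / wishart_const R (m + l) p *
    rdet (G ^t* *m G) ^- (m + l - p))%:E *
   \int[lamH p]_V (h V * (beta_weight (m - p) (l - p) (G ^t* *m G) V)%:E))%E.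
Proof.
move=> pm pl mg g0 g1 mh h0 Gu.
have [T Tu TT] := posdef_factor (posdef_gram_unit Gu).
have Tau : T ^t* \in unitmx by rewrite adj_unitmx.
pose Y := G *m invmx T.
have Y1 : Y ^t* *m Y = 1%:M.
  rewrite /Y adjmxM mulmxA -(mulmxA _ (G ^t* )) TT adj_invmx mulmxA.
  by rewrite (mulVmx Tau) mul1mx (mulmxV Tu).
have GY : G = Y *m T by rewrite /Y -mulmxA (mulVmx Tu) mulmx1.
pose h' V := h (T ^t* *m V *m T).
have mh' : meas h'.
  apply: (measurableT_comp mh); apply: measurable_fun_mulmx => //.
  exact: measurable_fun_mulmx.
have e := integral_proj_frame pm pl mg g0 g1 mh' (fun V => h0 _) Y1.
transitivity (\int[lam m (m + l)]_A (h' (Y ^t* *m row_proj A *m Y) * (g (A *m A ^t* ))%:E))%E.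
  by apply: eq_integral => A _; rewrite /h' {1 2}GY adjmxM !mulmxA.
rewrite {}e /h' (integral_beta_congr _ _ Tu mh h0) muleA -EFinM TT.
by have -> : (m - p + (l - p) + p = m + l - p)%N by rewrite -addnA subnK// addnBAC.
Qed.

End projection_density.

(** * Densities of the compressed Fisher matrix and of its inverse *)

Section fisher_law.
Variable R : realType.
Local Notation C := R[i].
Local Notation lam m n := (@lebesgue_mxC R m n).
Local Notation lamH p := (@lebesgue_herm R p).

(** After a shift of the index by one the Gamma factors cancel pairwise. The powers of pi add up
    because p (p - 1) / 2 is the sum of the i < p, and (m - i) + i = m. *)
Lemma multiGamma_wishart m p : (p <= m)%N ->
  multiGamma p m%:R * wishart_const R m p = pi ^+ (m * p).
Proof.
move=> pm; rewrite /multiGamma /wishart_const big_add1 /= big_mkord.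
rewrite -mulrA -big_split /=.
have -> : \prod_(i < p) (Gamma (m%:R - i.+1%:R + 1) * (pi ^+ (m - i) / Gamma (m - i)%N%:R)) =
    \prod_(i < p) (pi ^+ (m - i) : R).
  apply: eq_bigr => i _.
  have im : (i < m)%N := leq_trans (ltn_ord i) pm.
  have -> : m%:R - i.+1%:R + 1 = (m - i)%N%:R :> R.
    by rewrite natrB ?(ltnW im)// -natr1 opprD addrA subrK.
  have [g0 _] := @Gamma_natP R (m - i).-1; rewrite prednK ?subn_gt0// in g0.
  by rewrite mulrCA divff ?mulr1// gt_eqF.
rewrite prodrXr -exprD -bin2 -bin2_sum big_mkord -big_split /=; congr (_ ^+ _).
rewrite (eq_bigr (fun=> m)) ?sum_nat_const ?card_ord 1?mulnC// => i _.
by rewrite subnKC// ltnW// (leq_trans (ltn_ord i) pm).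
Qed.

(** Powers of pi drop out since (m + l) p = m p + l p. *)
Lemma c5_wishart m l p : (p <= m)%N -> (p <= l)%N ->
  c5 R (m + l) m p =
  wishart_const R m p * wishart_const R l p / wishart_const R (m + l) p.
Proof.
move=> pm pl; have pn : (p <= m + l)%N := leq_trans pm (leq_addr _ _).
have piE k : pi ^+ k != 0 :> R by rewrite gt_eqF// exprn_gt0// pi_gt0.
have gE k : (p <= k)%N -> multiGamma p k%:R = pi ^+ (k * p) / wishart_const R k p.
  by move=> pk; rewrite -(multiGamma_wishart pk) mulfK// gt_eqF// wishart_const_gt0.
have w0 k : (p <= k)%N -> wishart_const R k p != 0.
  by move=> pk; rewrite gt_eqF// wishart_const_gt0.
rewrite /c5 natrD addrAC subrr add0r -natrD !gE// mulnDl exprD.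
have := piE (m * p)%N; have := piE (l * p)%N; have := w0 _ pm; have := w0 _ pl; have := w0 _ pn.
move: (pi ^+ _) (pi ^+ _) (wishart_const R _ _) (wishart_const R _ _) (wishart_const R _ _).
by move=> a b x y z x0 y0 z0 b0 a0; field; rewrite a0 b0 x0 y0 z0.
Qed.

(** The bounds on p turn the integer exponents into natural ones, up to an inverse for |J|. *)
Lemma fisher_densityE m l p (J V : 'M[C]_p) : (p <= m)%N -> (p <= l)%N ->
  fisher_density (m + l) m J V =
  if `[< psdmx V >] && `[< psdmx (J - V) >] then
    c5 R (m + l) m p * rdet J ^- (m + l - p) * rdet V ^+ (m - p) * rdet (J - V) ^+ (l - p)
  else 0.
Proof.
move=> pm pl; rewrite /fisher_density asbool_and /loewner_le subr0.
have -> : (p%:Z - (m + l)%:Z = - (m + l - p)%N%:Z)%R.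
  by rewrite -subzn ?opprB// (leq_trans pm (leq_addr _ _)).
have -> : (m%:Z - p%:Z = (m - p)%N%:Z)%R by rewrite subzn.
have -> : ((m + l)%:Z - m%:Z - p%:Z = (l - p)%N%:Z)%R.
  by rewrite PoszD [X in X - _]addrAC subrr add0r subzn.
by rewrite -exprnN -!exprnP.
Qed.

Lemma inv_fisher_densityE m l p (J K : 'M[C]_p) : (p <= m)%N -> (p <= l)%N ->
  inv_fisher_density (m + l) m J K =
  if `[< psdmx (K - invmx J) >] then
    c5 R (m + l) m p * rdet J ^- (m + l - p) * (rdet K)^-1 ^+ (m + l)
      * rdet (J *m K - 1%:M) ^+ (l - p)
  else 0.
Proof.
move=> pm pl; rewrite /inv_fisher_density /loewner_le.
have -> : (p%:Z - (m + l)%:Z = - (m + l - p)%N%:Z)%R.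
  by rewrite -subzn ?opprB// (leq_trans pm (leq_addr _ _)).
have -> : ((m + l)%:Z - m%:Z - p%:Z = (l - p)%N%:Z)%R.
  by rewrite PoszD [X in X - _]addrAC subrr add0r subzn.
by rewrite -!exprnN -!exprnP exprVn.
Qed.

Section density.
Variables (m l p : nat) (J : 'M[C]_p).
Hypotheses (pm : (p <= m)%N) (pl : (p <= l)%N) (pJ : posdef J).

Let n := (m + l)%N.
Let c := c5 R n m p * rdet J ^- (n - p).

Let c0 : 0 <= c.
Proof.
have pn : (p <= n)%N := leq_trans pm (leq_addr _ _).
rewrite /c c5_wishart// mulr_ge0//; last first.
  by rewrite invr_ge0 exprn_ge0// ltW// posdef_rdet_gt0.
by rewrite !mulr_ge0 ?invr_ge0 ?ltW ?wishart_const_gt0.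
Qed.

Lemma fisher_density_ge0 V : 0 <= fisher_density n m J V.
Proof.
rewrite fisher_densityE// -/n -/c; case: ifP => // /andP[/asboolP V0 /asboolP JV0].
by rewrite mulr_ge0 ?exprn_ge0 ?psd_rdet_ge0// mulr_ge0 ?exprn_ge0 ?psd_rdet_ge0.
Qed.

Lemma measurable_fisher_density : meas (@fisher_density R n m p J).
Proof.
have mJV : meas (fun V : 'M[C]_p => J - V).
  by apply: measurable_fun_addmx; [exact: measurable_cst|exact: measurable_fun_oppmx].
have -> : @fisher_density R n m p J = (fun V =>
    if `[< psdmx V >] && `[< psdmx (J - V) >] then
      c * rdet V ^+ (m - p) * rdet (J - V) ^+ (l - p) else 0).
  by apply/funext => V; exact: fisher_densityE.
apply: measurable_fun_ifT; last exact: measurable_cst.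
  by apply: measurable_and; exact: measurable_fun_psd.
apply: measurable_funM; last by apply: measurable_funX; exact: measurable_fun_rdet.
apply: measurable_funM; first exact: measurable_cst.
by apply: measurable_funX; exact: measurable_fun_rdet.
Qed.

(** The density is supported on a closed order interval, the beta weight on the open cones. A
    semidefinite invertible matrix is definite, so the two agree off the zero sets of the
    determinants; on the boundary they can differ when an exponent is 0. *)
Lemma fisher_density_beta V : \det V != 0 -> \det (J - V) != 0 ->
  fisher_density n m J V = c * beta_weight (m - p) (l - p) J V.
Proof.
move=> V0 JV0; rewrite fisher_densityE// -/n -/c /beta_weight /wishart_weight.
have e (W : 'M[C]_p) : \det W != 0 -> `[< psdmx W >] = posdefb W.
  move=> W0; apply/asboolP/posdefbP; last exact: posdef_psd.
  by move=> W1; apply: psd_unit_posdef => //; rewrite unitmxE unitfE.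
rewrite (e _ V0) (e _ JV0); case: (posdefb V); last by rewrite mul0r mulr0.
by case: (posdefb (J - V)); rewrite ?mulr0// !mulrA.
Qed.

Let N0 : set 'M[C]_p := [set V | \det V = 0].
Let N1 : set 'M[C]_p := [set V | \det (J - V) = 0].

Let mN d (U : measurableType d) (W : U -> 'M[C]_p) :
  meas W -> measurable [set u | \det (W u) = 0].
Proof.
move=> mW.
have m1 : meas (fun u => \det (W u) == 0).
  by apply: measurable_fun_eqC; [exact: measurable_fun_det|exact: measurable_cst].
rewrite (_ : [set _ | _] = setT `&` (fun u => \det (W u) == 0) @^-1` [set true]).
  exact: m1.
by rewrite setTI; apply/seteqP; split => u /=; [move->; rewrite eqxx|move/eqP].
Qed.

Let mN0 : measurable N0. Proof. by apply: mN; exact: measurable_id. Qed.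

Let mN1 : measurable N1.
Proof.
apply: mN; apply: measurable_fun_addmx; first exact: measurable_cst.
exact: measurable_fun_oppmx.
Qed.

(** Translation by J carries the singular matrices to [N1], as det (V - J) and det (J - V) differ by
    a sign only. *)
Let N1_null : lamH p N1 = 0%E.
Proof.
have Jh : (- J) ^t* = - J by rewrite adjmxN; case: pJ => ->.
have e1 := integral_indic (lamH p) measurableT mN1; rewrite setIT in e1.
have e0 := integral_indic (lamH p) measurableT mN0; rewrite setIT in e0.
have mi : meas (fun V : 'M[C]_p => (\1_N0 V : R)%:E).
  by apply/measurable_EFinP; exact: (measurable_indic mN0).
have i0 (V : 'M[C]_p) : (0 <= (\1_N0 V : R)%:E)%E by rewrite lee_fin indicE ler0n.
have e2 := integral_lebesgue_hermD Jh mi i0.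
rewrite -e1 -(lebesgue_herm_det0 R p) -/N0 -e0 e2; apply: eq_integral => V _.
rewrite !indicE; congr (_%:R%:E); congr (nat_of_bool _).
have E : \det (V - J) = (-1) ^+ p * \det (J - V) by rewrite -opprB -scaleN1r detZ.
by apply/idP/idP; rewrite !inE /N0 /N1 /= E => /eqP;
  rewrite ?mulf_eq0 ?signr_eq0/= => /eqP -> //; rewrite mulr0.
Qed.

Let N01_null : lamH p (N0 `|` N1) = 0%E.
Proof. exact: (null_set_setU mN0 mN1 (lebesgue_herm_det0 R p) N1_null). Qed.

Lemma integral_fisher_density (h : 'M[C]_p -> \bar R) :
  meas h -> (forall V, (0 <= h V)%E) ->
  (\int[lamH p]_V (h V * (fisher_density n m J V)%:E) =
   c%:E * \int[lamH p]_V (h V * (beta_weight (m - p) (l - p) J V)%:E))%E.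
Proof.
move=> mh h0.
have mhb : meas (fun V => h V * (beta_weight (m - p) (l - p) J V)%:E)%E.
  apply: emeasurable_funM; first exact: mh.
  by apply/measurable_EFinP; apply: measurable_fun_beta_weight.
have hb0 V : (0 <= h V * (beta_weight (m - p) (l - p) J V)%:E)%E.
  by apply: mule_ge0; [exact: h0|rewrite lee_fin beta_weight_ge0].
rewrite (ge0_integralZlT _ c0 mhb hb0).
apply: (ge0_integral_eq_off (measurableU _ _ mN0 mN1) N01_null).
- apply: emeasurable_funM; first exact: mh.
  by apply/measurable_EFinP; exact: measurable_fisher_density.
- by apply: emeasurable_funM => //; exact: measurable_cst.
- by move=> V; apply: mule_ge0; [exact: h0|rewrite lee_fin fisher_density_ge0].
- by move=> V; rewrite mule_ge0.
move=> V; rewrite -[X in ~ X -> _]/(\det V = 0 \/ \det (J - V) = 0) => /not_orP[/eqP V0 /eqP JV0].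
by rewrite fisher_density_beta// EFinM muleCA.
Qed.

Let posdef_above K : psdmx (K - invmx J) -> posdef K.
Proof.
move=> K0; rewrite -(subrK (invmx J) K) addrC.
exact: (posdefDl (posdef_inv pJ) K0).
Qed.

(** J K - 1 is not Hermitian in general; factoring it as (J - K^-1) K, with det K real, brings its
    determinant back to Hermitian matrices. *)
Let rdet_mulB1 K : posdef K -> rdet (J *m K - 1%:M) = rdet (J - invmx K) * rdet K.
Proof.
move=> pK; have -> : J *m K - 1%:M = (J - invmx K) *m K.
  by rewrite mulmxBl (mulVmx (posdef_unit pK)).
rewrite {1}/rdet det_mulmx (posdef_detE pK) /rdet.
by case: (\det (J - invmx K)) => a b /=; rewrite mulr0 subr0.
Qed.

Lemma inv_fisher_density_ge0 K : 0 <= inv_fisher_density n m J K.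
Proof.
rewrite inv_fisher_densityE// -/n -/c; case: ifP => // /asboolP K0.
have pK := posdef_above K0.
have JK0 : 0 <= rdet (J - invmx K) by apply: psd_rdet_ge0; exact: (psd_sub_inv pK pJ K0).
have dK := ltW (posdef_rdet_gt0 pK).
rewrite (rdet_mulB1 pK); apply: mulr_ge0; last by rewrite exprn_ge0// mulr_ge0.
by apply: mulr_ge0; [exact: c0|rewrite exprn_ge0// invr_ge0].
Qed.

Lemma measurable_inv_fisher_density :
  meas (@inv_fisher_density R n m p J).
Proof.
have mJV : meas (fun K : 'M[C]_p => K - invmx J).
  by apply: measurable_fun_addmx; [exact: measurable_id|exact: measurable_cst].
have mJK : meas (fun K : 'M[C]_p => J *m K - 1%:M).
  apply: measurable_fun_addmx; last exact: measurable_cst.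
  by apply: measurable_fun_mulmx; [exact: measurable_cst|exact: measurable_id].
have -> : @inv_fisher_density R n m p J = (fun K =>
    if `[< psdmx (K - invmx J) >] then
      c * (rdet K)^-1 ^+ n * rdet (J *m K - 1%:M) ^+ (l - p) else 0).
  by apply/funext => K; exact: inv_fisher_densityE.
apply: measurable_fun_ifT; [exact: measurable_fun_psd| |exact: measurable_cst].
apply: measurable_funM; last by apply: measurable_funX; exact: measurable_fun_rdet.
apply: measurable_funM; first exact: measurable_cst.
by apply: measurable_funX; apply: measurable_funV; exact: measurable_fun_rdet.
Qed.

(** The supports match by [psd_sub_inv], used in both directions; what remains is a count of the
    powers of |K|. *)
Lemma fisher_density_inv K :
  fisher_density n m J (invmx K) * ((rdet K)^-1 ^+ (2 * p) * wishart_weight 0 K) =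
  inv_fisher_density n m J K.
Proof.
rewrite inv_fisher_densityE// -/n -/c /wishart_weight expr0.
case: asboolP => [K0|K0].
  have pK := posdef_above K0; have dK := posdef_rdet_gt0 pK.
  have -> : posdefb K by apply/posdefbP.
  rewrite fisher_densityE// -/n -/c.
  have -> : `[< psdmx (invmx K) >] by apply/asboolP/posdef_psd/posdef_inv.
  have -> : `[< psdmx (J - invmx K) >] by apply/asboolP; exact: (psd_sub_inv pK pJ K0).
  rewrite /= mulr1 (rdet_mulB1 pK) (rdet_inv pK) exprMn.
  (* 2 p comes from the Jacobian of inversion, m - p from |K^-1|, and l - p from |J - K^-1| = |J K -
     1| / |K|. *)
  have -> : n = (2 * p + (m - p) + (l - p))%N.
    by rewrite mul2n -addnn -!addnA (addnC p (_ + _)%N) addnA subnKC// -addnA subnK.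
  have alg (x d e : R) a b k : d != 0 ->
      x * d^-1 ^+ a * e ^+ b * d^-1 ^+ k = x * d^-1 ^+ (k + a + b) * (e ^+ b * d ^+ b).
    by move=> d0; rewrite !exprVn !exprD; field; rewrite !expf_neq0.
  exact: (alg c (rdet K) _ (m - p)%N (l - p)%N (2 * p)%N (lt0r_neq0 dK)).
have [pK|pK] := boolP (posdefb K); last by rewrite !mulr0.
move/posdefbP: pK => pK; rewrite fisher_densityE//.
case: ifP => [/andP[_ /asboolP JK]|_]; last by rewrite mul0r.
by case: K0; exact: (psd_sub_inv pJ pK JK).
Qed.

Lemma integral_inv_fisher_density (h : 'M[C]_p -> \bar R) :
  meas h -> (forall V, (0 <= h V)%E) ->
  (\int[lamH p]_V (h (invmx V) * (fisher_density n m J V)%:E) =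
   \int[lamH p]_K (h K * (inv_fisher_density n m J K)%:E))%E.
Proof.
move=> mh h0.
pose F K := (h K * (fisher_density n m J (invmx K))%:E)%E.
have minv : meas (fun V : 'M[C]_p => invmx V).
  by apply: measurable_fun_invmx; exact: measurable_id.
have mF : meas F.
  apply: emeasurable_funM; first exact: mh.
  by apply/measurable_EFinP; exact: (measurableT_comp measurable_fisher_density minv).
have F0 K : (0 <= F K)%E.
  by apply: mule_ge0; [exact: h0|rewrite lee_fin fisher_density_ge0].
have e := integral_herm_inv mF F0.
transitivity (\int[lamH p]_V (F (invmx V) * (wishart_weight 0 V)%:E))%E.
  (* An invertible V in the support is positive definite, so inserting the indicator of the cone
     alters the integrand on a null set only. *)
  apply: (ge0_integral_eq_off mN0 (lebesgue_herm_det0 R p)).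
  - apply: emeasurable_funM; first exact: (measurableT_comp mh minv).
    by apply/measurable_EFinP; exact: measurable_fisher_density.
  - apply: emeasurable_funM; first exact: (measurableT_comp mF minv).
    by apply/measurable_EFinP; exact: measurable_wishart_weight.
  - by move=> V; apply: mule_ge0; [exact: h0|rewrite lee_fin fisher_density_ge0].
  - by move=> V; apply: mule_ge0; [exact: F0|rewrite lee_fin wishart_weight_ge0].
  move=> V /eqP V0; rewrite /F invmxK /wishart_weight expr0.
  case: posdefbP => [_|pV]; first by rewrite mule1.
  rewrite mule0 (fisher_densityE _ _ pm pl); case: ifP => [/andP[/asboolP V1 _]|_]; last by rewrite mule0.
  by case: pV; apply: psd_unit_posdef => //; rewrite unitmxE unitfE.
rewrite {}e; apply: eq_integral => K _.
by rewrite /F -muleA -EFinM fisher_density_inv.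
Qed.

End density.

Lemma posdef_gram_rank n p (G : 'M[C]_(n, p)) : \rank G = p -> posdef (G ^t* *m G).
Proof.
move=> Gp; have pn : (p <= n)%N by rewrite -Gp rank_leq_row.
have [k nE] : exists k, n = (p + k)%N by exists (n - p)%N; rewrite subnKC.
subst n; have [S [U [Su Uu GE]]] := row_free_unitary (etrans (rank_adjmx G) Gp).
apply: posdef_gram_unit; rewrite -{2}[G]trmxCK GE adjmxM mulmxA -(mulmxA S).
by rewrite (usubmx_unitary Uu) mulmx1 unitmx_mul Su adj_unitmx.
Qed.

(** Absorbs the variance into the frame: with r the inverse square root of [sigma2], both Fisher
    matrices are quadratic in r G. *)
Let root_scale (sigma2 : R) : 0 < sigma2 ->
  exists2 r : R, r != 0 & (sigma2^-1)%:C = r%:C * r%:C :> C.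
Proof.
move=> s0; exists (Num.sqrt sigma2)^-1; first by rewrite invr_neq0// gt_eqF// sqrtr_gt0.
by rewrite -rmorphM -invfM -expr2 sqr_sqrtr// ltW.
Qed.

Let fisher_scale n p (sigma2 r : R) (G : 'M[C]_(n, p)) : (sigma2^-1)%:C = r%:C * r%:C :> C ->
  fisher sigma2 G = (r%:C *: G) ^t* *m (r%:C *: G).
Proof. by move=> rr; rewrite /fisher rr adjmxZ -scalemxAl -scalemxAr scalerA. Qed.

Lemma posdef_fisher n p (sigma2 : R) (G : 'M[C]_(n, p)) :
  0 < sigma2 -> \rank G = p -> posdef (fisher sigma2 G).
Proof.
move=> /root_scale[r r0 rr] Gp; rewrite (fisher_scale G rr); apply: posdef_gram_rank.
by rewrite mxrank_scale_nz// fmorph_eq0.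
Qed.

Lemma measurable_compressed_fisher m n p (sigma2 : R) (G : 'M[C]_(n, p)) :
  meas (@compressed_fisher R m n p sigma2 G).
Proof.
apply: measurable_fun_scalemx; first exact: measurable_cst.
apply: measurable_fun_mulmx; last exact: measurable_cst.
apply: measurable_fun_mulmx; first exact: measurable_cst.
by apply: measurable_fun_row_proj; exact: measurable_id.
Qed.

Lemma integral_compressed_fisher m l p (sigma2 : R) (G : 'M[C]_(m + l, p))
    (g : 'M[C]_m -> R) (h : 'M[C]_p -> \bar R) :
  (p <= m)%N -> (p <= l)%N -> 0 < sigma2 -> \rank G = p ->
  meas (fun A : 'M[C]_(m, m + l) => g (A *m A ^t* )) ->
  (forall A : 'M[C]_(m, m + l), 0 <= g (A *m A ^t* )) ->
  (\int[lam m (m + l)]_A (g (A *m A ^t* ))%:E = 1)%E ->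
  meas h -> (forall V, (0 <= h V)%E) ->
  (\int[lam m (m + l)]_A (h (compressed_fisher sigma2 G A) * (g (A *m A ^t* ))%:E) =
   \int[lamH p]_V (h V * (fisher_density (m + l) m (fisher sigma2 G) V)%:E))%E.
Proof.
move=> pm pl s0 Gp mg g0 g1 mh h0.
have [r r0 rr] := root_scale s0; have pJ := posdef_fisher s0 Gp.
pose G' := r%:C *: G; have JE := fisher_scale G rr; rewrite -/G' in JE.
have AE (A : 'M[C]_(m, m + l)) : compressed_fisher sigma2 G A = G' ^t* *m row_proj A *m G'.
  by rewrite /compressed_fisher rr /G' adjmxZ -!scalemxAl -scalemxAr scalerA.
have Gu : G' ^t* *m G' \in unitmx by rewrite -JE posdef_unit.
have e := integral_projection pm pl mg g0 g1 mh h0 Gu.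
rewrite (integral_fisher_density pm pl pJ mh h0) JE c5_wishart// -e.
by apply: eq_integral => A _; rewrite AE.
Qed.

(** The identity at the indicator of a measurable set is the defining property of a density. The map
    X is left general so as to cover the Fisher matrix and its inverse alike. *)
Lemma has_density_law d (Omega : measurableType d) (P : probability Omega R)
    m n p (Phi : Omega -> 'M[C]_(m, n)) (f : 'M[C]_(m, n) -> R)
    (X : 'M[C]_(m, n) -> 'M[C]_p) (q : 'M[C]_p -> R) :
  has_density P Phi (lam m n) f -> meas X ->
  meas q -> (forall V, 0 <= q V) ->
  (forall h : 'M[C]_p -> \bar R, meas h -> (forall V, (0 <= h V)%E) ->
    (\int[lam m n]_A (h (X A) * (f A)%:E) = \int[lamH p]_V (h V * (q V)%:E))%E) ->
  has_density P (fun w => X (Phi w)) (lamH p) q.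
Proof.
move=> [mPhi mf f0 Pf] mX mq q0 XE; split => //.
  exact: (measurableT_comp mX mPhi).
move=> A mA.
have mXA : measurable (X @^-1` A) by rewrite -[X in measurable X]setTI; exact: mX.
rewrite -[X in P X]/(Phi @^-1` (X @^-1` A)) Pf//.
rewrite [LHS]integral_mkcond [RHS]integral_mkcond.
have p1 (T : Type) (B : set T) (q' : T -> R) :
    (EFin \o q') \_ B = (fun x => (\1_B x)%:E * (q' x)%:E)%E.
  apply/funext => x; rewrite patchE indicE; case: ifP => _; last by rewrite mul0e.
  by rewrite mul1e.
rewrite (p1 _ _ f) (p1 _ _ q) -XE//.
by apply/measurable_EFinP; exact: measurable_indic.
Qed.

End fisher_law.

Theorem mainTheorem3 (R : realType) (n m p : nat)
    (n_gt0 : (0 < n)%N) (m_gt0 : (0 < m)%N) (p_gt0 : (0 < p)%N)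
    (le_pm : (p <= m)%N) (le_mnp : (m <= n - p)%N)
    (x : 'cV[R]_p -> 'cV[R[i]]_n) (theta : 'cV[R]_p)
    (G : 'M[R[i]]_(n, p))
    (G_jacobian : is_mean_jacobian x theta G)
    (G_rank : \rank G = p)
    (sigma2 : R) (sigma2_gt0 : 0 < sigma2)
    (d : measure_display) (Omega : measurableType d) (P : probability Omega R)
    (Phi : Omega -> 'M[R[i]]_(m, n)) (g : 'M[R[i]]_m -> R)
    (Phi_density : has_density P Phi (@lebesgue_mxC R m n)
                     (fun A => g (A *m A ^t* ))) :
  let J := fisher sigma2 G in
  let Jhat := fun w : Omega => compressed_fisher sigma2 G (Phi w) in
  let Khat := fun w : Omega => invmx (Jhat w) in
  has_density P Jhat (@lebesgue_herm R p) (fisher_density n m J) /\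
  has_density P Khat (@lebesgue_herm R p) (inv_fisher_density n m J).
Proof.
have [l nE pl] : exists2 l, n = (m + l)%N & (p <= l)%N.
  (* As m > 0, the bound m <= n - p forces p < n, so the truncated subtraction is a true one. *)
  have pn0 : (p <= n)%N by rewrite ltnW// -subn_gt0 (leq_trans m_gt0).
  have pn : (m + p <= n)%N by rewrite addnC -leq_subRL.
  exists (n - m)%N; first by rewrite subnKC// (leq_trans (leq_addr _ _) pn).
  by rewrite leq_subRL// (leq_trans (leq_addr _ _) pn).
clear G_jacobian x n_gt0 le_mnp; subst n => J Jhat Khat.
have [mPhi mg g0 Pg] := Phi_density.
(* The density of [Phi] has mass 1 because P is a probability. *)
have g1 : (\int[@lebesgue_mxC R m (m + l)]_A (g (A *m A ^t* ))%:E = 1)%E.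
  by rewrite -Pg// preimage_setT probability_setT.
have pJ : posdef J by exact: posdef_fisher.
have law := integral_compressed_fisher le_pm pl sigma2_gt0 G_rank mg g0 g1.
have mX := @measurable_compressed_fisher R m (m + l) p sigma2 G.
split.
  apply: (has_density_law Phi_density mX _ _ law).
    exact: measurable_fisher_density.
  exact: fisher_density_ge0.
have minv : meas (fun V : 'M[R[i]]_p => invmx V).
  by apply: measurable_fun_invmx; exact: measurable_id.
apply: (has_density_law Phi_density (measurableT_comp minv mX)).
- exact: measurable_inv_fisher_density.
- exact: inv_fisher_density_ge0.
move=> h mh h0.
(* The law of [Jhat] tested on h composed with [invmx] is the law of [Khat] tested on h. *)
have e := law _ (measurableT_comp mh minv) (fun V => h0 _).
by rewrite (integral_inv_fisher_density le_pm pl pJ mh h0) in e.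
Qed.
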